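(* Let $\omega$ be a weight on $\mathbb R^n$ and $\varphi\in\Phi_w(\mathbb R^n)$. Assume that $(\varphi,\omega)$ satisfies $(\mathcal H_{\mathbb R^n})$, that $\omega\in A_{p_\varphi(\cdot)}(\mathbb R^n)$, and that $\psi_\varphi$ satisfies $(aDec)_{q_\psi}$ for some $q_\psi<\infty$. Then, for every $k\in\mathbb N$, $C_c^\infty(\mathbb R^n)$ is dense in $W^{k,\varphi(\cdot)}_\omega(\mathbb R^n)$.
   Context: **Basics.** A ball is a Euclidean ball $B\subset\mathbb R^n$; $\chi_E$ is the characteristic function of $E$. A weight on $\mathbb R^n$ is a locally integrable function $\omega$ with $0<\omega(x)<\infty$ for a.e. $x$. **Weak $\Phi$-functions.** $\Phi_w(\mathbb R^n)$ is the class of functions $\Phi:\mathbb R^n\times[0,\infty)\to[0,\infty]$ such that $\Phi(\cdot,|f|)$ is measurable for every measurable $f:\mathbb R^n\to\mathbb R$; for a.e. $x$, $t\mapsto\Phi(x,t)$ is increasing (not necessarily strictly), $\Phi(x,0)=\lim_{t\to0+}\Phi(x,t)=0$, $\lim_{t\to\infty}\Phi(x,t)=\infty$; and there is $L\ge1$ with $\Phi(x,s)/s\le L\,\Phi(x,t)/t$ for a.e. $x$ and all $0<s<t$. The generalized inverse is $\Phi^{-1}(x,\tau)=\inf\{t\ge0:\Phi(x,t)\ge\tau\}$, $\tau\ge0$. **Exponents.** $P(\mathbb R^n)$ is the set of measurable $p$ with $1<p^-:=\operatorname{ess\,inf}p\le p^+:=\operatorname{ess\,sup}p<\infty$; $p'(x)=p(x)/(p(x)-1)$.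 $p\in P^{\log}(\mathbb R^n)$ means $p\in P(\mathbb R^n)$ and, for some $C>0$ and $p_\infty\in\mathbb R$, $|p(x)-p(y)|\le C/\log(e+1/|x-y|)$ for all $x\neq y$ and $|p(x)-p_\infty|\le C/\log(e+|x|)$ for all $x$. **Spaces.** $\|f\|_{L^{p(\cdot)}_\omega(\mathbb R^n)}=\inf\{\lambda>0:\int|f/\lambda|^{p(x)}\omega\,dx\le1\}$; $L^{p(\cdot)}(\mathbb R^n)$ is the case $\omega\equiv1$. $\|f\|_{L^{\varphi(\cdot)}_\omega(\mathbb R^n)}=\inf\{\lambda>0:\int_{\mathbb R^n}\varphi(x,|f(x)|/\lambda)\omega(x)\,dx\le1\}$; $L^{\varphi(\cdot)}_\omega(\mathbb R^n)$ consists of the measurable $f$ for which this is finite. For $k\in\mathbb N$, $$W^{k,\varphi(\cdot)}_\omega(\mathbb R^n)=\{u\in W^{k,1}_{\mathrm{loc}}(\mathbb R^n): D^\alpha u\in L^{\varphi(\cdot)}_\omega(\mathbb R^n)\text{ for all }|\alpha|\le k\},$$ with quasi-norm $\|u\|_{W^{k,\varphi(\cdot)}_\omega(\mathbb R^n)}=\sum_{|\alpha|\le k}\|D^\alpha u\|_{L^{\varphi(\cdot)}_\omega(\mathbb R^n)}$. **Muckenhoupt class.** $\omega\in A_{p(\cdot)}(\mathbb R^n)$ means $\sup_{B}|B|^{-1}\|\chi_B\|_{L^{p(\cdot)}_\omega(\mathbb R^n)}\|\omega^{-1/p(\cdot)}\chi_B\|_{L^{p'(\cdot)}(\mathbb R^n)}<\infty$,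 the supremum over all balls. **Lower index and normalization.** For $0<\lambda<1$ put $g_\varphi(x,\lambda)=\sup\{\varphi(x,\lambda t)/\varphi(x,t): t>0,\ 0<\varphi(x,t)<\infty\}$ (considered only where the admissible set is nonempty). Whenever the limit exists, $p_\varphi(x)=\lim_{\lambda\to0+}\frac{\log g_\varphi(x,\lambda)}{\log\lambda}$. Set $\psi_\varphi(x,t)=\varphi(x,t)^{1/p_\varphi(x)}$. **Structural conditions** for $\Phi\in\Phi_w(\mathbb R^n)$: - $(A0)$: there is $\beta_0\in(0,1]$ with $\beta_0\le\Phi^{-1}(x,1)\le\beta_0^{-1}$ for a.e. $x$. - $(A1)_{\omega,p}$ (for $p\in P(\mathbb R^n)$): there is $\beta_1\in(0,1]$ such that for every ball $B$ with $\|\chi_B\|_{L^{p(\cdot)}_\omega}\le1$, a.e. $x,y\in B$ and every $1\le s\le\|\chi_B\|_{L^{p(\cdot)}_\omega}^{-1}$, one has $\beta_1\Phi^{-1}(y,s)\le\Phi^{-1}(x,s)$. - $(A2)_\omega$: for every $s>0$ there are $\beta_s\in(0,1]$ and $0\le h_s\in L^1_\omega(\mathbb R^n)\cap L^\infty(\mathbb R^n)$ such that $\beta_s\Phi^{-1}(y,\tau)\le\Phi^{-1}(x,\tau+h_s(x)+h_s(y))$ for a.e. $x,y$ and all $\tau\in[0,s]$. - $(aInc)_{p(\cdot)}$: there is $L\ge1$ with $\Phi(x,s)/s^{p(x)}\le L\,\Phi(x,t)/t^{p(x)}$ for a.e. $x$ and all $0<s<t$. - $(aDec)_q$, $q\in[1,\infty)$: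 there is $C\ge1$ with $\Phi(x,\lambda t)\le C\lambda^q\Phi(x,t)$ for a.e. $x$, all $\lambda\ge1$ and all $t\ge0$. **$(\mathcal H_{\mathbb R^n})$** for $(\varphi,\omega)$: (i) $p_\varphi$ exists a.e., is measurable, $1<p_\varphi^-\le p_\varphi^+<\infty$ and $p_\varphi\in P^{\log}(\mathbb R^n)$; (ii) $\varphi$ satisfies $(aInc)_{p_\varphi(\cdot)}$; (iii) $\psi_\varphi\in\Phi_w(\mathbb R^n)$ and $\psi_\varphi$ satisfies $(A0)$, $(A1)_{\omega,p_\varphi}$ and $(A2)_\omega$. *)

(* Defs.v *)
From HB Require Import structures.
From mathcomp Require Import all_boot all_order all_algebra.
From mathcomp Require Import all_classical all_reals all_analysis.
From mathcomp Require Import measurable_realfun ess_sup_inf.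
Import Order.TTheory GRing.Theory Num.Theory.
Import numFieldNormedType.Exports.

Set Implicit Arguments.
Unset Strict Implicit.
Unset Printing Implicit Defensive.

Local Open Scope classical_set_scope.
Local Open Scope ring_scope.

Section LebesgueMeasure.
Context (R : realType) (n : nat).
Local Notation Rn := 'rV[R]_n.

Definition box (ab : Rn * Rn) : set Rn :=
  [set x | forall i, ab.1 0 i < x 0 i <= ab.2 0 i].

Definition box_vol (ab : Rn * Rn) : R :=
  \prod_(i < n) Num.max 0 (ab.2 0 i - ab.1 0 i).

(* At most countable covers by half-open boxes ([None] stands for the empty
   set, so that the definition is also correct when n = 0). *)
Definition box_cover (A : set Rn) : set (nat -> option (Rn * Rn)) :=
  [set F | A `<=` \bigcup_k oapp box set0 (F k)].

Local Open Scope ereal_scope.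

Definition leb_outer (A : set Rn) : \bar R :=
  ereal_inf [set \sum_(k <oo) (oapp box_vol 0%R (F k))%:E | F in box_cover A].

Let vol_ge0 (o : option (Rn * Rn)) : 0 <= (oapp box_vol 0%R o)%:E.
Proof.
by rewrite lee_fin; case: o => //= ab; apply: prodr_ge0 => i _; rewrite le_max lexx.
Qed.

Let le_leb_outer : {homo leb_outer : A B / A `<=` B >-> A <= B}.
Proof.
move=> A B AB; apply/ereal_inf_le_tmp => _ [F BF <-].
by exists F => //; exact: subset_trans AB BF.
Qed.

Let leb_outer_ge0 A : 0 <= leb_outer A.
Proof. by apply: le_ereal_inf_tmp => _ [F AF <-]; exact: nneseries_ge0. Qed.

Let leb_outer0 : leb_outer set0 = 0.
Proof.
apply/eqP; rewrite eq_le leb_outer_ge0 andbT; apply: ereal_inf_lbound.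
exists (fun=> None) => //; exact: eseries0.
Qed.

Let leb_outer_sigma_subadditive : sigma_subadditive leb_outer.
Proof.
move=> A; have [[i ioo]|] := pselect (exists i, leb_outer (A i) = +oo).
  rewrite (eseries_pinfty _ _ ioo) ?leey// => k _.
  by rewrite -ltNye (lt_le_trans _ (leb_outer_ge0 _)).
rewrite -forallNE => Aoo.
apply/lee_addgt0Pr => e e0.
rewrite (le_trans _ (epsilon_trick _ _ (ltW e0)))//.
pose P k (F : nat -> option (Rn * Rn)) := box_cover (A k) F /\
  \sum_(j <oo) (oapp box_vol 0%R (F j))%:E <= leb_outer (A k) + (e / (2 ^ k.+1)%:R)%:E.
have [G PG] : {G : nat -> nat -> option (Rn * Rn) & forall k, P k (G k)}.
  apply: (@choice _ _ P) => k.
  have fin : leb_outer (A k) \is a fin_num.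
    by rewrite ge0_fin_numE// ltey; apply/eqP; exact: Aoo.
  have ek : (0 < e / (2 ^ k.+1)%:R)%R by rewrite divr_gt0// ltr0n expn_gt0.
  have [_ [F AF <-] Fe] := lb_ereal_inf_adherent ek fin.
  by exists F; split => //; exact: ltW.
have /card_esym/ppcard_eqP[f] := card_nat2.
pose v (ij : nat * nat) := (oapp box_vol 0%R (uncurry G ij))%:E.
have v0 x : 0 <= v x by exact: vol_ge0.
apply: (@le_trans _ _ (\esum_(i in setT) v i)).
  apply: ereal_inf_lbound; exists (uncurry G \o f).
    move=> t [i _ /(PG i).1 [j _ Gij]]; exists (f^-1%FUN (i, j)) => //=.
    by rewrite invK ?inE.
  rewrite -[LHS]/(\sum_(k <oo) v (f k)).
  rewrite -(esum_pred_image v _ xpredT) ?[fun=> _]set_true//.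
  by rewrite image_eq.
rewrite (_ : esum _ _ = \sum_(i <oo) \sum_(j <oo) v (i, j)); last first.
  pose J : nat -> set (nat * nat) := fun i => [set (i, j) | j in setT].
  rewrite (_ : setT = \bigcup_k J k); last first.
    by rewrite predeqE => -[a b]; split => // _; exists a => //; exists b.
  rewrite esum_bigcupT /=; last 2 first.
    - apply/trivIsetP => i j _ _ ij.
      rewrite predeqE => -[k m] /=; split => //= -[] [_] _ [<-{k} _].
      by move=> [m' _] [] /esym/eqP; rewrite (negbTE ij).
    - by move=> ?; exact: vol_ge0.
  rewrite -(image_id [set: nat]) -fun_true esum_pred_image//; last first.
    by move=> k _; exact: esum_ge0.
  apply: eq_eseriesr => /= j _.
  rewrite -(esum_pred_image v (pair j) predT)//=; last first.
    by move=> ? ? _ _; exact: (@can_inj _ _ _ snd).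
  by congr esum; rewrite predeqE => -[a b]; split; move=> [i _ <-]; exists i.
apply: lee_nneseries => [k _ _|k _]; first exact: nneseries_ge0.
exact: (PG k).2.
Qed.

HB.instance Definition _ := isOuterMeasure.Build R Rn leb_outer
  leb_outer0 leb_outer_ge0 le_leb_outer leb_outer_sigma_subadditive.

End LebesgueMeasure.

(* Lebesgue measurable sets of R^n: this sigma-algebra is complete, so that
   measurability is insensitive to modifications on null sets. *)
HB.instance Definition _ (R : realType) (n : nat) :=
  Measurable.copy 'rV[R]_n (caratheodory_type (@leb_outer R n)).

Section LebesgueMeasureInstance.
Context (R : realType) (n : nat).
Local Open Scope ereal_scope.

Definition leb : set 'rV[R]_n -> \bar R := @leb_outer R n.

Let leb0 : leb set0 = 0. Proof. exact: outer_measure0. Qed.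

Let leb_ge0 A : 0 <= leb A. Proof. exact: outer_measure_ge0. Qed.

Let leb_sigma_additive : semi_sigma_additive leb.
Proof.
exact: (@caratheodory_measure_sigma_additive R 'rV[R]_n (@leb_outer R n)).
Qed.

HB.instance Definition _ := isMeasure.Build _ 'rV[R]_n R leb
  leb0 leb_ge0 leb_sigma_additive.

End LebesgueMeasureInstance.

Section GeneralizedOrlicz.
Context (R : realType) (n : nat).
Local Notation Rn := 'rV[R]_n.
Local Notation mu := (@leb R n).
Implicit Types (Phi phi : Rn -> R -> \bar R) (w p f u v : Rn -> R).

(* The library norm on 'rV[R]_n is the sup norm. *)
Definition enorm (x : Rn) : R := Num.sqrt (\sum_(i < n) x 0 i ^+ 2).

Definition eball (c : Rn) (r : R) : set Rn := [set x | enorm (x - c) < r].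

Definition loc_integrable f : Prop :=
  measurable_fun [set: Rn] f /\
  forall K : set Rn, compact K -> mu.-integrable K (EFin \o f).

Definition is_weight w : Prop :=
  loc_integrable w /\ \forall x \ae mu, 0 < w x.

(* In all that follows [Phi x t] is only meaningful for [0 <= t]. *)
Record weak_Phi Phi : Prop := WeakPhi {
  weak_Phi_ge0 : forall x (t : R), 0 <= t -> (0 <= Phi x t)%E ;
  weak_Phi_meas : forall f, measurable_fun [set: Rn] f ->
    measurable_fun [set: Rn] (fun x => Phi x `|f x|) ;
  weak_Phi_incr : \forall x \ae mu, forall s t : R, 0 <= s -> s <= t ->
    (Phi x s <= Phi x t)%E ;
  weak_Phi_at0 : \forall x \ae mu, Phi x 0 = 0%E ;
  weak_Phi_cvg0 : \forall x \ae mu, Phi x t @[t --> 0^'+] --> 0%E ;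
  weak_Phi_cvgy : \forall x \ae mu, Phi x t @[t --> +oo] --> +oo%E ;
  weak_Phi_aInc1 : exists2 L : R, 1 <= L &
    \forall x \ae mu, forall s t : R, 0 < s -> s < t ->
      (Phi x s / s%:E <= L%:E * (Phi x t / t%:E))%E }.

Definition gen_inv Phi (x : Rn) (tau : R) : \bar R :=
  ereal_inf [set t%:E | t in [set t : R | 0 <= t /\ (tau%:E <= Phi x t)%E]].

Definition lux_norm Phi w f : \bar R :=
  ereal_inf [set l%:E | l in [set l : R | 0 < l /\
    (\int[mu]_x (Phi x (`|f x| / l)%R * (w x)%:E) <= 1)%E]].

Definition Lphi Phi w : set (Rn -> R) :=
  [set f | measurable_fun [set: Rn] f /\ (lux_norm Phi w f < +oo)%E].

Definition lp_norm p w f : \bar R :=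
  lux_norm (fun x t => (t `^ p x)%R%:E) w f.

Definition exponent p : Prop :=
  [/\ measurable_fun [set: Rn] p,
      (1 < ess_inf mu (EFin \o p))%E & (ess_sup mu (EFin \o p) < +oo)%E].

Definition log_exponent p : Prop :=
  exponent p /\ exists C pinf : R,
    [/\ 0 < C,
        forall x y : Rn, x != y ->
          `|p x - p y| <= C / ln (expR 1 + (enorm (x - y))^-1) &
        forall x : Rn, `|p x - pinf| <= C / ln (expR 1 + enorm x)].

Definition conj_exponent p : Rn -> R := fun x => p x / (p x - 1).

Definition muckenhoupt p w : Prop :=
  (ereal_sup [set e | exists (c : Rn) (r : R), (0 < r)%R /\
     let B := eball c r in
     e = (mu B)^-1 * lp_norm p w \1_B *
         lp_norm (conj_exponent p) (cst 1%R)
           (fun x => w x `^ (- (p x)^-1) * \1_B x)%R] < +oo)%E.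

Definition growth phi (x : Rn) (l : R) : \bar R :=
  ereal_sup [set (phi x (l * t)%R / phi x t)%E |
    t in [set t : R | 0 < t /\ (0 < phi x t < +oo)%E]].

(* [p] is a version of the lower index of [phi], which is only defined almost
   everywhere: at almost every point the limit exists and equals [p x]. *)
Definition lower_index phi p : Prop :=
  \forall x \ae mu,
    (exists t : R, 0 < t /\ (0 < phi x t < +oo)%E) /\
    (lne (growth phi x l) / (ln l)%:E)%E @[l --> 0^'+] --> (p x)%:E.

Definition psi phi p : Rn -> R -> \bar R :=
  fun x t => (phi x t `^ (p x)^-1%R)%E.

Definition condA0 Phi : Prop :=
  exists2 b : R, 0 < b <= 1 &
    \forall x \ae mu, (b%:E <= gen_inv Phi x 1 <= b^-1%R%:E)%E.

Definition condA1 w p Phi : Prop :=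
  exists2 b : R, 0 < b <= 1 & forall (c : Rn) (r : R), 0 < r ->
    let B := eball c r in
    (lp_norm p w \1_B <= 1)%E ->
    \forall x \ae mu, \forall y \ae mu, B x -> B y ->
      forall s : R, 1 <= s -> (s%:E <= (lp_norm p w \1_B)^-1)%E ->
      (b%:E * gen_inv Phi y s <= gen_inv Phi x s)%E.

Definition condA2 w Phi : Prop :=
  forall s : R, 0 < s -> exists (b : R) (h : Rn -> R),
    [/\ 0 < b <= 1,
        (forall x, 0 <= h x),
        measurable_fun [set: Rn] h,
        mu.-integrable [set: Rn] (fun x => (h x * w x)%:E) /\
          (ess_sup mu (EFin \o h) < +oo)%E &
        \forall x \ae mu, \forall y \ae mu, forall tau : R, 0 <= tau <= s ->
          (b%:E * gen_inv Phi y tau <= gen_inv Phi x (tau + h x + h y)%R)%E].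

Definition aInc p Phi : Prop :=
  exists2 L : R, 1 <= L & \forall x \ae mu, forall s t : R, 0 < s -> s < t ->
    (Phi x s / (s `^ p x)%R%:E <= L%:E * (Phi x t / (t `^ p x)%R%:E))%E.

Definition aDec (q : R) Phi : Prop :=
  exists2 C : R, 1 <= C & \forall x \ae mu, forall l t : R, 1 <= l -> 0 <= t ->
    (Phi x (l * t)%R <= (C * l `^ q)%R%:E * Phi x t)%E.

Record condH phi w p : Prop := CondH {
  condH_index : lower_index phi p ;
  condH_log : log_exponent p ;
  condH_aInc : aInc p phi ;
  condH_psi : weak_Phi (psi phi p) ;
  condH_A0 : condA0 (psi phi p) ;
  condH_A1 : condA1 w p (psi phi p) ;
  condH_A2 : condA2 w (psi phi p) }.

End GeneralizedOrlicz.

Section Sobolev.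
Context (R : realType) (n : nat).
Local Notation Rn := 'rV[R]_n.
Local Notation mu := (@leb R n).
Implicit Types (Phi : Rn -> R -> \bar R) (w f u v : Rn -> R).

Definition partial (i : 'I_n) f : Rn -> R := fun x => 'D_(delta_mx 0 i) f x.

Definition smooth f : Prop := forall s : seq 'I_n,
  let g := foldr partial f s in
  continuous g /\ forall i x, derivable g x (delta_mx 0 i).

Definition Cc_infty : set (Rn -> R) :=
  [set f | smooth f /\ compact (closure [set x | f x != 0])].

Definition morder (a : 'I_n -> nat) : nat := (\sum_(i < n) a i)%N.

(* The order of differentiation is irrelevant for smooth functions. *)
Definition pderiv (a : 'I_n -> nat) f : Rn -> R :=
  foldr (fun i => iter (a i) (partial i)) f (enum 'I_n).

Definition weak_derivative (a : 'I_n -> nat) u v : Prop :=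
  [/\ loc_integrable u, loc_integrable v &
      forall eta, Cc_infty eta ->
        \int[mu]_x (u x * pderiv a eta x) =
        (-1) ^+ morder a * \int[mu]_x (v x * eta x)].

(* A choice of weak derivative; it is unique up to a null set. *)
Definition weakD (a : 'I_n -> nat) u : Rn -> R :=
  xget (cst 0) [set v | weak_derivative a u v].

Definition W1loc (k : nat) : set (Rn -> R) :=
  [set u | loc_integrable u /\
    forall a, (morder a <= k)%N -> exists v, weak_derivative a u v].

Definition sobolev (k : nat) Phi w : set (Rn -> R) :=
  [set u | W1loc k u /\
    forall a, (morder a <= k)%N -> Lphi Phi w (weakD a u)].

Definition sobolev_norm (k : nat) Phi w u : \bar R :=
  (\sum_(a : {ffun 'I_n -> 'I_k.+1} | (morder (fun i => a i) <= k)%N)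
     lux_norm Phi w (weakD (fun i => a i) u))%E.

Definition dense_in_sobolev (A : set (Rn -> R)) (k : nat) Phi w : Prop :=
  A `<=` sobolev k Phi w /\
  forall u, sobolev k Phi w u -> forall eps : R, 0 < eps ->
    exists2 f, A f & (sobolev_norm k Phi w (u \- f)%R < eps%:E)%E.

End Sobolev.

(* Main.v *)
From HB Require Import structures.
Require Import Defs.
From mathcomp Require Import all_boot all_order all_algebra.
From mathcomp Require Import all_classical all_reals all_analysis.
From mathcomp Require Import measurable_realfun ess_sup_inf.
From mathcomp Require Import ring lra.
Import Order.TTheory GRing.Theory Num.Theory.
Import numFieldNormedType.Exports HBNNSimple.

Set Implicit Arguments.
Unset Strict Implicit.
Unset Printing Implicit Defensive.

Local Open Scope classical_set_scope.
Local Open Scope ring_scope.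

(** Write rho(f) for the modular of [f], the integral of phi(x, |f|) w. The
    hypotheses make phi doubling and almost increasing after division by its
    argument, so that finite norm is finite modular and small modular is small
    norm ([doubling_Phi_phi], [LphiP], [lux_norm_lt]). Everything is then proved
    for the modular.

    A function [u] of the space is approximated by chi_r (u * e_m), where chi_r is
    a smooth cutoff equal to 1 on a large cube and e_m is a mollifier of radius
    1/m. Since the weak derivatives of [u] commute with mollification
    ([wderiv_convol_mollifier]), the Leibniz rule writes a derivative of the error
    as a sum of terms (d - D^s chi_r) v, where d is 1 if [s] is empty and 0
    otherwise, and of terms D^s chi_r (v - v * e_m), with weak derivatives [v] of
    [u]. The terms of the first kind tend to 0 with growing [r] by dominated
    convergence ([tail_small]). For fixed [r], those of the second kind tend to 0
    with growing [m] as soon as v * e_m tends to [v] in modular on bounded sets,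
    for every locally integrable [v] with finite modular ([mollif_cvg_modular]).

    That convergence is obtained by density. It holds for the indicator of a finite
    union of boxes, which is locally constant off a null set, and passes to
    indicators of bounded measurable sets, to simple functions, and to all
    functions of finite modular. The limits are justified by a uniform bound: on a
    bounded region, rho(c (v * e_m)) <= C whenever rho(v) <= 1 and [m] is large
    ([local_mollifier_bound]). For this the region is cut into tiles of side 1/m.
    At each point of a tile |v * e_m| is at most a multiple of the average of |v|
    over a ball [B] around the tile, and the balls have bounded overlap. It remains
    to estimate the modular of an average over one small ball by quantities that
    can be added up ([ball_estimate]).

    On such a ball let t be the larger of |B| and the modular of [v] over [B], and
    let lam = t^(1/p(c)), with [c] the centre. By the log-Hoelder condition
    lam^p(x) is comparable with t throughout the ball ([log_hoelder_power]). Let nu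
    be comparable with the norm of the indicator of [B] in the weighted space with
    exponent [p]. Young's inequality and the Muckenhoupt condition bound the mean
    of F(y) = psi(y, |v(y)|) over [B] by a multiple of lam/nu ([young_psi],
    [muckenhoupt_modular]). With s = max(1, lam/nu), which is in the range of the
    condition (A1), the inverses psi^-1(y, s) are comparable on the ball, and
    |v(y)| is at most a multiple of psi^-1(x, s) (1 + F(y)/s); averaging shows that
    psi(x, .) at a small multiple of the average of |v| is at most [s]
    ([jensen_ball]). Thus phi(x, .) there is at most s^p(x), hence at most
    1 + K t nu^(-p(x)), and the integral of nu^(-p) w over [B] is at most 1 by the
    choice of nu. *)

(** * Lebesgue measure of boxes *)

Section Boxes.
Context (R : realType) (n : nat).
Local Notation Rn := 'rV[R]_n.
Local Notation mu := (@leb R n).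

Definition set_coord (x : Rn) (i : 'I_n) (c : R) : Rn :=
  \row_j (if j == i then c else x 0 j).

Lemma box_vol_ge0 (ab : Rn * Rn) : 0 <= box_vol ab.
Proof. by apply: prodr_ge0 => i _; rewrite le_max lexx. Qed.

(** Cutting a box by a coordinate hyperplane gives two boxes whose volumes add
    up; this is all that the Caratheodory criterion asks of a half-space. *)
Lemma box_vol_split (a b : Rn) i c :
  box_vol (a, set_coord b i (Num.min (b 0 i) c)) +
  box_vol (set_coord a i (Num.max (a 0 i) c), b) <= box_vol (a, b).
Proof.
rewrite /box_vol /= (bigD1 i)//= [X in _ + X](bigD1 i)//= [leRHS](bigD1 i)//=.
rewrite !mxE eqxx.
rewrite (eq_bigr (fun j => Num.max 0 (b 0 j - a 0 j))); last first.
  by move=> j ji; rewrite !mxE (negbTE ji).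
rewrite [X in _ + _ * X](eq_bigr (fun j => Num.max 0 (b 0 j - a 0 j))); last first.
  by move=> j ji; rewrite !mxE (negbTE ji).
rewrite -mulrDl ler_wpM2r//; first by apply: prodr_ge0 => j _; rewrite le_max lexx.
case: (leP (b 0 i) c) => h1; case: (leP (a 0 i) c) => h2;
  rewrite /Num.max; repeat case: ifPn; rewrite -?leNgt; lra.
Qed.

Lemma box_halfspace_le (a b : Rn) i c :
  box (a, b) `&` [set x : Rn | x 0 i <= c] `<=`
  box (a, set_coord b i (Num.min (b 0 i) c)).
Proof.
move=> x [xab xc] j; rewrite /= mxE; have /andP[-> /= xb] := xab j.
by case: eqP => // ji; move: xb; rewrite ji le_min => ->.
Qed.

Lemma box_halfspace_gt (a b : Rn) i c :
  box (a, b) `&` ~` [set x : Rn | x 0 i <= c] `<=`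
  box (set_coord a i (Num.max (a 0 i) c), b).
Proof.
move=> x [xab /negP]; rewrite -ltNge => xc j; rewrite /= mxE.
have /andP[xa ->] := xab j; rewrite andbT.
by case: eqP => // ji; move: xa; rewrite ji gt_max => ->.
Qed.

Lemma measurable_halfspace i c : measurable [set x : Rn | x 0 i <= c].
Proof.
apply: (@le_caratheodory_measurable R Rn (@leb_outer R n)) => X.
apply: le_ereal_inf_tmp => _ [F XF <-].
pose F1 k := omap (fun ab : Rn * Rn =>
  (ab.1, set_coord ab.2 i (Num.min (ab.2 0 i) c))) (F k).
pose F2 k := omap (fun ab : Rn * Rn =>
  (set_coord ab.1 i (Num.max (ab.1 0 i) c), ab.2)) (F k).
have v0 (G : nat -> option (Rn * Rn)) k :
    (0 <= (oapp (@box_vol R n) 0%R (G k))%:E)%E.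
  by rewrite lee_fin; case: (G k) => //= ?; exact: box_vol_ge0.
apply: (@le_trans _ _ (\sum_(k <oo) (oapp (@box_vol R n) 0 (F1 k))%:E +
   \sum_(k <oo) (oapp (@box_vol R n) 0 (F2 k))%:E)%E).
  apply: leeD; apply: ereal_inf_lbound; eexists; try reflexivity.
    move=> x [Xx xc]; have [k _ Fx] := XF x Xx; exists k => //.
    rewrite /F1; case: (F k) Fx => //= -[a b] xab.
    exact: box_halfspace_le.
  move=> x [Xx xc]; have [k _ Fx] := XF x Xx; exists k => //.
  rewrite /F2; case: (F k) Fx => //= -[a b] xab.
  exact: box_halfspace_gt.
rewrite -nneseriesD//.
apply: lee_nneseries => [k _ _|k _].
  by apply: adde_ge0; exact: v0.
rewrite -EFinD lee_fin /F1 /F2; case: (F k) => /= [[a b]|]; last by rewrite addr0.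
exact: box_vol_split.
Qed.

Lemma measurable_box (ab : Rn * Rn) : measurable (box ab).
Proof.
rewrite (_ : box ab = \bigcap_(i in [set: 'I_n])
   (~` [set x : Rn | x 0 i <= ab.1 0 i] `&` [set x : Rn | x 0 i <= ab.2 0 i])).
  apply: fin_bigcap_measurable => // i _; apply: measurableI.
    by apply: measurableC; exact: measurable_halfspace.
  exact: measurable_halfspace.
apply/seteqP; split => x /=.
  move=> xab i _; have /andP[h1 h2] := xab i; split => //=.
  by apply/negP; rewrite -ltNge.
by move=> xab i; have [/negP] := xab i I; rewrite -ltNge => -> /= ->.
Qed.

Lemma measurable_coord i : measurable_fun [set: Rn] (fun x : Rn => x 0 i).
Proof.
apply: (measurability _ (RGenOInfty.measurableE R)) => // _ [_ [c ->] <-].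
rewrite setTI (_ : _ @^-1` _ = ~` [set x : Rn | x 0 i <= c]).
  by apply: measurableC; exact: measurable_halfspace.
by apply/seteqP; split => x /=; rewrite in_itv/= andbT ltNge => /negP.
Qed.

Definition grid_cell (e : R) (z : 'I_n -> int) : set Rn :=
  box (\row_i (e * (z i)%:~R), \row_i (e * (z i + 1)%:~R)).

Lemma grid_cellP (e : R) (x : Rn) : 0 < e -> exists z : {ffun 'I_n -> int},
  grid_cell e z x.
Proof.
move=> e0; exists [ffun i => Num.ceil (x 0 i / e) - 1]; move=> i.
rewrite /= !mxE ffunE subrK.
by have := ceil_itv (x 0 i / e); rewrite ler_pdivrMr// ltr_pdivlMr// !(mulrC e).
Qed.

Lemma box_norm_lt (e : R) (z : 'I_n -> int) (x y : Rn) : 0 < e ->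
  grid_cell e z x -> grid_cell e z y -> `|x - y| <= e.
Proof.
move=> e0 xz yz; rewrite [leLHS]/Num.norm /= mx_normrE; apply/bigmax_leP; split; first exact: ltW.
move=> [i j] _ /=; rewrite ord1 !mxE.
have := xz j; have := yz j; rewrite /= !mxE intrD mulrDr mulr1.
by rewrite ler_norml => /andP[h1 h2] /andP[h3 h4]; apply/andP; split; lra.
Qed.

(** The cells of the grids of mesh 1/(k+1) are countably many and form a basis
    of neighbourhoods, so that every open set is a countable union of boxes. *)
Lemma measurable_open (U : set Rn) : open U -> measurable U.
Proof.
move=> oU.
pose C (kz : nat * {ffun 'I_n -> int}) := grid_cell (kz.1.+1%:R^-1) kz.2.
rewrite (_ : U = \bigcup_kz (if `[< C kz `<=` U >] then C kz else set0)).
  apply: countable_bigcupT_measurable; first exact: countableP.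
  by move=> kz; case: ifPn => // _; exact: measurable_box.
apply/seteqP; split => x.
  move=> Ux; have /nbhs_ballP[e /= e0 eU] := open_nbhs_nbhs (conj oU Ux).
  have [k ke] : exists k : nat, k.+1%:R^-1 < e.
    have [k _ /(_ k (leqnn k)) H] := near_infty_natSinv_lt (PosNum e0).
    by exists k.
  have k0 : (0 : R) < k.+1%:R^-1 by rewrite invr_gt0.
  have [z xz] := @grid_cellP (k.+1%:R^-1) x k0.
  exists (k, z) => //; case: ifPn => // /asboolP []; move=> y yz; apply: eU.
  rewrite -ball_normE /=; apply: le_lt_trans ke.
  exact: (box_norm_lt k0 xz yz).
by move=> [kz _]; case: ifPn => // /asboolP; exact.
Qed.

Lemma continuous_measurable (f : Rn -> R) :
  continuous f -> measurable_fun [set: Rn] f.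
Proof.
move=> cf; apply: (measurability _ (RGenOInfty.measurableE R)) => // _ [_ [c ->] <-].
rewrite setTI; apply: measurable_open; move/continuousP : cf; apply.
exact: interval_open.
Qed.

End Boxes.

(** The uniform distribution on a box, on the type of tuples that carries the
    product sigma-algebra. It serves as a measure with which a countable cover
    of the box can be bounded from below. *)
Lemma uniform_tuple_prob (R : realType) (n : nat) (a b : 'I_n -> R)
    (ab : forall i, a i < b i) :
  exists P : probability (n.-tuple (measurableTypeR R)) R, forall c d : 'I_n -> R,
    measurable [set t : n.-tuple (measurableTypeR R) | forall i, c i < tnth t i <= d i] /\
    (P [set t | forall i, (c i < tnth t i <= d i)%R] =
    \prod_(i < n) uniform_prob (ab i) `]c i, d i])%E.
Proof.
elim: n a b ab => [|n IH] a b ab.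
  exists (\d_([tuple] : 0.-tuple (measurableTypeR R))) => c d; split.
    by rewrite (_ : [set _ | _] = setT)//; apply/seteqP; split => // t _ [].
  by rewrite big_ord0 /= diracE mem_set//; case.
have [P hP] := IH (fun i => a (lift ord0 i)) (fun i => b (lift ord0 i))
  (fun i => ab (lift ord0 i)).
pose f (xt : R * n.-tuple (measurableTypeR R)) := [the n.+1.-tuple (measurableTypeR R) of xt.1 :: xt.2].
have mf : measurable_fun [set: measurableTypeR R * n.-tuple (measurableTypeR R)] f by exact: measurable_cons.
pose f' : {mfun (measurableTypeR R * n.-tuple (measurableTypeR R))%type >-> n.+1.-tuple (measurableTypeR R)} :=
  HB.pack f (isMeasurableFun.Build _ _ _ _ _ mf).
exists (distribution (uniform_prob (ab ord0) \x P)%E f') => c d.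
have mc : measurable [set t : n.+1.-tuple (measurableTypeR R) | forall i, c i < tnth t i <= d i].
  rewrite (_ : [set _ | _] =
    \bigcap_(i in setT) ((@tnth _ R ^~ i) @^-1` `]c i, d i])).
    apply: fin_bigcap_measurable => // i _; rewrite -[X in measurable X]setTI.
    exact: measurable_tnth.
  by apply/seteqP; split => t /= h i; [move=> _|]; have := h i;
    rewrite /= in_itv/=; [|exact].
split => //; transitivity ((uniform_prob (ab ord0) \x P)%E (`]c ord0, d ord0] `*`
    [set t | forall i, c (lift ord0 i) < tnth t i <= d (lift ord0 i)])); last first.
  rewrite product_measure1E//; last exact: (hP _ _).1.
  by rewrite big_ord_recl; congr (_ * _)%E; exact: (hP _ _).2.
rewrite /distribution /pushforward; congr (product_measure1 _ _ _).
apply/seteqP; split => -[x t] /=.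
  by move=> h; split; [have := h ord0; rewrite in_itv|move=> i; have := h (lift ord0 i); rewrite tnthS].
move=> [x0 ht] i; case: (unliftP ord0 i) => [j ->|->].
  by rewrite tnthS.
by move: x0; rewrite in_itv.
Qed.

Lemma uniform_prob_itv_le (R : realType) (a b c d : R) (ab : a < b) :
  (uniform_prob ab `]c, d] <= (Num.max 0 (d - c) / (b - a))%:E)%E.
Proof.
rewrite /uniform_prob.
apply: (@le_trans _ _ (\int[lebesgue_measure]_(x in `]c, d]) (cst (b - a)^-1%:E x))%E).
  apply: ge0_le_integral => //.
  - by move=> x _; rewrite lee_fin uniform_pdf_ge0.
  - by apply: measurable_funTS; apply: measurableT_comp => //; exact: measurable_uniform_pdf.
  - move=> x _; rewrite lee_fin /uniform_pdf; case: ifPn => // _.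
    by rewrite invr_ge0 subr_ge0 ltW.
rewrite integral_cst//= lebesgue_measure_itv/= lte_fin.
case: ltP => cd; rewrite ?mule0 -?EFinB -?EFinM lee_fin.
  by rewrite mulrC ler_pM2r ?invr_gt0 ?subr_gt0// le_max lexx orbT.
by rewrite divr_ge0 ?subr_ge0 ?(ltW ab)// le_max lexx.
Qed.

Lemma uniform_prob_itv1 (R : realType) (a b : R) (ab : a < b) :
  uniform_prob ab `]a, b] = 1%E.
Proof.
rewrite /uniform_prob (eq_integral (cst (b - a)^-1%:E)).
  rewrite integral_cst//= lebesgue_measure_itv/= lte_fin ab -EFinB -EFinM.
  by rewrite mulVf// gt_eqF// subr_gt0.
move=> x; rewrite inE/= in_itv/= => /andP[ax xb].
by rewrite /uniform_pdf (ltW ax) xb.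
Qed.

Section Volume.
Context (R : realType) (n : nat).
Local Notation Rn := 'rV[R]_n.
Local Notation mu := (@leb R n).

Lemma leb_box_le (ab : Rn * Rn) : (mu (box ab) <= (box_vol ab)%:E)%E.
Proof.
apply: ereal_inf_lbound; exists (fun k => if k == 0%N then Some ab else None).
  by move=> x xab; exists 0%N.
rewrite (nneseries_split 0%N 1%N); last first.
  by move=> k _; rewrite lee_fin; case: eqP => //= _; exact: box_vol_ge0.
by rewrite big_nat1 /= eseries0 ?adde0// => -[]//.
Qed.

(** A countable cover of a box cannot have a smaller total volume: the uniform
    probability of the box is countably subadditive, and it charges any other
    box at most its share of the volume. *)
Lemma leb_box (a b : Rn) : (forall i, a 0 i < b 0 i) ->
  mu (box (a, b)) = (\prod_(i < n) (b 0 i - a 0 i))%:E.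
Proof.
move=> ab; have vE : box_vol (a, b) = \prod_(i < n) (b 0 i - a 0 i).
  by apply: eq_bigr => i _; rewrite /= max_r// subr_ge0 ltW.
have v0 : 0 < \prod_(i < n) (b 0 i - a 0 i).
  by apply: prodr_gt0 => i _; rewrite subr_gt0.
apply/eqP; rewrite eq_le -{1}vE leb_box_le /=.
apply: le_ereal_inf_tmp => _ [F BF <-].
have [P hP] := @uniform_tuple_prob R n (fun i => a 0 i) (fun i => b 0 i) ab.
pose B (o : option (Rn * Rn)) : set (n.-tuple (measurableTypeR R)) :=
  oapp (fun cd : Rn * Rn => [set t : n.-tuple (measurableTypeR R) | forall i, cd.1 0 i < tnth t i <= cd.2 0 i]) set0 o.
have mB o : measurable (B o) by case: o => //= cd; exact: (hP _ _).1.
have PB o : (P (B o) <= (oapp (@box_vol R n) 0 o / \prod_(i < n) (b 0 i - a 0 i))%:E)%E.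
  case: o => /= [cd|]; last by rewrite measure0 mul0r.
  rewrite (hP _ _).2 /box_vol -prodf_div -prodEFin.
  suff : (0 <= \prod_(i < n) uniform_prob (ab i) `]cd.1 0%R i, cd.2 0%R i]%classic <=
     \prod_(i < n) (Num.max 0 (cd.2 0 i - cd.1 0 i) / (b 0 i - a 0 i))%R%:E)%E by case/andP.
  apply: (big_ind2 (fun x y => 0 <= x <= y)%E) => //.
  - by rewrite lee01 lexx.
  - move=> x1 y1 x2 y2 /andP[h1 h2] /andP[h3 h4].
    by rewrite mule_ge0//= lee_pmul.
  - by move=> i _; rewrite measure_ge0/=; exact: uniform_prob_itv_le.
have P1 : P (B (Some (a, b))) = 1%E.
  by rewrite (hP _ _).2 big1// => i _; rewrite uniform_prob_itv1.
have : (P (B (Some (a, b))) <= \sum_(k <oo) P (B (F k)))%E.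
  apply: measure_sigma_subadditive => //.
  move=> t tab; have [|k _ Fk] := BF (\row_i tnth t i).
    by move=> i; rewrite /= mxE; exact: tab.
  exists k => //; case: (F k) Fk => //= cd h i; have := h i.
  by rewrite mxE.
rewrite P1 => le1.
have : (1 <= \sum_(k <oo) (((\prod_(i < n) (b 0 i - a 0 i))^-1)%:E *
     (oapp (@box_vol R n) 0%R (F k))%:E))%E.
  apply: (le_trans le1); apply: lee_nneseries => [k _ _|k _]; first exact: measure_ge0.
  by rewrite -EFinM mulrC.
rewrite nneseriesZl; last first.
  by move=> k _; rewrite lee_fin; case: (F k) => //= ?; exact: box_vol_ge0.
by rewrite lee_pdivlMl// mule1.
Qed.

End Volume.

(** * Translations, cubes and null sets *)

Section Shift.
Context (R : realType) (n : nat).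
Local Notation Rn := 'rV[R]_n.
Local Notation mu := (@leb R n).

Let shift (t : Rn) : Rn -> Rn := fun x => x + t.

Let leb_shift_le (A : set Rn) t : (mu (shift t @^-1` A) <= mu A)%E.
Proof.
apply: le_ereal_inf_tmp => _ [F AF <-]; apply: ereal_inf_lbound.
exists (fun k => omap (fun ab : Rn * Rn => (ab.1 - t, ab.2 - t)) (F k)).
  move=> x /AF[k _ Fx]; exists k => //; case: (F k) Fx => //= ab xab i.
  by have := xab i; rewrite /= !mxE ltrBlDr lerBrDr.
apply: eq_eseriesr => k _; congr EFin; case: (F k) => //= ab.
by apply: eq_bigr => i _; rewrite /= !mxE; congr (Num.max 0 _); ring.
Qed.

Lemma leb_shift (A : set Rn) t : mu ((fun x => x + t) @^-1` A) = mu A.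
Proof.
apply/eqP; rewrite eq_le leb_shift_le /=.
have := leb_shift_le (shift t @^-1` A) (- t); congr (mu _ <= mu _)%E.
by apply/seteqP; split => x; rewrite /shift /= addrNK.
Qed.

Lemma measurable_shift t : measurable_fun [set: Rn] (fun x : Rn => x + t).
Proof.
move=> _ A mA; rewrite setTI.
suff : (@leb_outer R n).-caratheodory ((fun x => x + t) @^-1` A) by [].
move=> X; rewrite -!/(mu _).
have E (Y : set Rn) : mu Y = mu ((fun x => x - t) @^-1` Y) by rewrite leb_shift.
pose X' := (fun x : Rn => x - t) @^-1` X.
have : (mu X' = mu (X' `&` A) + mu (X' `&` ~` A))%E := mA X'.
rewrite -E => ->.
rewrite [X in _ = X + _]E [X in _ = _ + X]E.
by congr (mu _ + mu _)%E; apply/seteqP; split => x; rewrite /= addrNK.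
Qed.

Lemma measurable_fun_shift d (T : measurableType d) (f : Rn -> T) t :
  measurable_fun [set: Rn] f -> measurable_fun [set: Rn] (fun x => f (x + t)%R).
Proof.
by move=> mf; exact: (measurableT_comp mf (measurable_shift t)).
Qed.

Lemma ge0_integral_shift (f : Rn -> \bar R) (t : Rn) : measurable_fun [set: Rn] f ->
  (forall x, 0 <= f x)%E -> (\int[mu]_x f (x + t)%R = \int[mu]_x f x)%E.
Proof.
move=> mf f0; have mt := @measurable_shift t.
transitivity (\int[pushforward mu (fun x => (x + t)%R)]_x f x)%E.
  by rewrite (@ge0_integral_pushforward _ _ _ _ _ _ mt mu).
apply: (@eq_measure_integral _ _ _ setT mu (pushforward mu _)).
by move=> A mA _; exact: leb_shift.
Qed.

Lemma integral_shift (f : Rn -> \bar R) (t : Rn) : measurable_fun [set: Rn] f ->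
  (\int[mu]_x f (x + t)%R = \int[mu]_x f x)%E.
Proof.
move=> mf; rewrite [LHS]integralE [RHS]integralE; congr (_ - _)%E.
  rewrite -(ge0_integral_shift t (measurable_funepos mf) (fun x => funepos_ge0 f x)).
  by apply: eq_integral => x _; rewrite !funeposE.
rewrite -(ge0_integral_shift t (measurable_funeneg mf) (fun x => funeneg_ge0 f x)).
by apply: eq_integral => x _; rewrite !funenegE.
Qed.

Lemma integrable_shift (f : Rn -> \bar R) (t : Rn) :
  mu.-integrable [set: Rn] f -> mu.-integrable [set: Rn] (fun x => f (x + t)%R).
Proof.
move=> /integrableP[mf fi]; apply/integrableP; split.
  exact: measurable_fun_shift.
rewrite (@ge0_integral_shift (fun x => `|f x|%E) t (measurableT_comp _ mf) _)//.
Qed.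

End Shift.

Section Cubes.
Context (R : realType) (n : nat).
Local Notation Rn := 'rV[R]_n.
Local Notation mu := (@leb R n).

Definition cube (c : Rn) (r : R) : set Rn := [set x | `|x - c| <= r].

Lemma norm_leP (x : Rn) (r : R) : 0 <= r ->
  reflect (forall i, `|x 0 i| <= r) (`|x| <= r).
Proof.
move=> r0; rewrite [X in X <= _]/Num.norm /= mx_normrE; apply: (iffP idP).
  by move=> /bigmax_leP[_ H] i; exact: (H (0, i)).
by move=> H; apply/bigmax_leP; split=> // -[i j] _; rewrite ord1 /=; exact: H.
Qed.

Lemma coord_le_norm (x : Rn) i : `|x 0 i| <= `|x|.
Proof. by move: i; apply/norm_leP. Qed.

Lemma closed_cube c r : closed (cube c r).
Proof.
have cf : continuous (fun x : Rn => `|x - c|).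
  move=> x; apply: (@continuous_comp _ _ _ (fun x : Rn => x - c) (fun x => `|x|)).
    by apply: (@cvgB _ _ _ (nbhs x)); [exact: cvg_id|exact: cvg_cst].
  exact: norm_continuous.
apply: (@preimage_closed _ _ (fun x : Rn => `|x - c|) [set t : R | t <= r]).
  by move=> x _; exact: cf.
exact: closed_le.
Qed.

Lemma measurable_cube c r : measurable (cube c r).
Proof.
rewrite -(setCK (cube c r)); apply/measurableC/measurable_open.
exact/closed_openC/closed_cube.
Qed.

Lemma compact_cube c r : compact (cube c r).
Proof.
apply: bounded_closed_compact; last exact: closed_cube.
exists (r + `|c|); split; first exact: num_real.
move=> M rM x xc; have xB : `|x| <= `|x - c| + `|c|.
  by rewrite -[X in `|X| <= _](subrK c x) ler_normD.
by apply: (le_trans xB); apply: le_trans (ltW rM); rewrite lerD2r.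
Qed.

Lemma compact_sub_cube (K : set Rn) : compact K ->
  exists N : nat, K `<=` cube 0 N%:R.
Proof.
move=> /compact_bounded[M [_ KM]]; exists (Num.truncn `|M|).+1 => x Kx.
rewrite /cube /= subr0; apply: (KM _ _ x Kx).
by rewrite (le_lt_trans (ler_norm _))// truncnS_gt.
Qed.

Lemma box_sub_cube (c : Rn) (r : R) : 0 <= r ->
  box (\row_i (c 0 i - r), \row_i (c 0 i + r)) `<=` cube c r.
Proof.
move=> r0 x xb; apply/norm_leP => // i; rewrite !mxE ler_norml.
by have := xb i; rewrite /= !mxE => /andP[h1 h2]; apply/andP; split; lra.
Qed.

Lemma cube_sub_box (c : Rn) (r s : R) : r < s ->
  cube c r `<=` box (\row_i (c 0 i - s), \row_i (c 0 i + s)).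
Proof.
move=> rs x xc i; rewrite /= !mxE.
have := le_trans (coord_le_norm (x - c) i) xc; rewrite !mxE ler_norml => /andP[h1 h2].
by apply/andP; split; lra.
Qed.

Lemma leb_box_center (c : Rn) (r : R) : 0 < r ->
  mu (box (\row_i (c 0 i - r), \row_i (c 0 i + r))) = ((2 * r) ^+ n)%:E.
Proof.
move=> r0; rewrite leb_box; last by move=> i; rewrite !mxE; lra.
rewrite (eq_bigr (fun=> 2 * r)) ?prodr_const ?card_ord// => i _.
by rewrite !mxE; lra.
Qed.

Lemma leb_cube_ge (c : Rn) (r : R) : 0 < r -> (((2 * r) ^+ n)%:E <= mu (cube c r))%E.
Proof.
move=> r0; rewrite -(leb_box_center c r0); apply: le_measure; rewrite ?inE.
- exact: measurable_box.
- exact: measurable_cube.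
- exact/box_sub_cube/ltW.
Qed.

Lemma leb_cube_le (c : Rn) (r s : R) : 0 <= r -> r < s ->
  (mu (cube c r) <= ((2 * s) ^+ n)%:E)%E.
Proof.
move=> r0 rs; rewrite -(@leb_box_center c s); last exact: le_lt_trans rs.
apply: le_measure; rewrite ?inE; [exact: measurable_cube|exact: measurable_box|].
exact: cube_sub_box.
Qed.

Lemma leb_cube_lty c r : (mu (cube c r) < +oo)%E.
Proof.
have [r0|r0] := leP 0 r; last first.
  rewrite (_ : cube c r = set0) ?measure0//; apply/seteqP; split => // x.
  by rewrite /cube /= => /(le_trans (normr_ge0 _)); rewrite leNgt r0.
by apply: le_lt_trans (@leb_cube_le c r (r + 1) r0 _) _; rewrite ?ltrDl// ltry.
Qed.

Lemma bigcup_cube : \bigcup_(N : nat) cube 0 N%:R = [set: Rn].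
Proof.
apply/seteqP; split => // x _; exists (Num.truncn `|x|).+1 => //.
by rewrite /cube /= subr0 ltW// truncnS_gt.
Qed.

(** A hyperplane is null: inside a bounded region it lies in boxes as thin as
    desired. *)
Lemma leb_hyperplane i (c : R) : mu.-negligible [set x : Rn | x 0 i = c].
Proof.
have mH : measurable [set x : Rn | x 0 i = c].
  rewrite -(setTI [set _ | _]).
  exact: (measurable_coord i measurableT (measurable_set1 c)).
rewrite (_ : [set _ | _] =
    \bigcup_(N : nat) ([set x : Rn | x 0 i = c] `&` cube 0 N%:R)); last first.
  by rewrite -setI_bigcupr bigcup_cube setIT.
apply: negligible_bigcup => N; have mHN := measurableI _ _ mH (measurable_cube 0 N%:R).
exists ([set x : Rn | x 0 i = c] `&` cube 0 N%:R); split => //.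
apply/eqP; rewrite -measure_le0; apply/lee_addgt0Pr => e e0; rewrite add0e.
pose V := \prod_(j < n | j != i) (2 * (N%:R + 1) : R).
have V0 : 0 < V by apply: prodr_gt0 => j _; rewrite mulr_gt0// ltr_wpDl.
pose a : Rn := set_coord (\row_j - (N%:R + 1)) i (c - e / V).
pose b : Rn := set_coord (\row_j (N%:R + 1)) i c.
have sub : [set x : Rn | x 0 i = c] `&` cube 0 N%:R `<=` box (a, b).
  move=> x [/= xc xN] j; rewrite /= !mxE; case: eqP => [->|_].
    by rewrite xc lexx ltrBlDr ltrDl divr_gt0.
  have := le_trans (coord_le_norm (x - 0) j) xN; rewrite !mxE subr0 ler_norml.
  by move=> /andP[h1 h2]; apply/andP; split; lra.
apply: le_trans (le_measure _ _ _ sub) _; rewrite ?inE//; first exact: measurable_box.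
apply: le_trans (leb_box_le _) _; rewrite lee_fin /box_vol (bigD1 i)//= !mxE eqxx.
rewrite (eq_bigr (fun=> 2 * (N%:R + 1))); last first.
  by move=> j ji; rewrite !mxE (negbTE ji) max_r; [lra|rewrite subr_ge0; have := ler0n R N; lra].
rewrite -/V max_r; last by rewrite opprB addrCA subrr addr0 divr_ge0 ?ltW.
by rewrite opprB addrCA subrr addr0 divfK// gt_eqF.
Qed.

End Cubes.

(** * Approximation of measurable sets by finite unions of boxes *)

Section Approximation.
Context (R : realType) (n : nat).
Local Notation Rn := 'rV[R]_n.
Local Notation mu := (@leb R n).

Definition box_union (F : nat -> option (Rn * Rn)) (m : nat) : set Rn :=
  \bigcup_(k in `I_m) oapp (@box R n) set0 (F k).

Lemma measurable_obox (o : option (Rn * Rn)) :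
  measurable (oapp (@box R n) set0 o).
Proof. by case: o => [ab|] //=; exact: measurable_box. Qed.

Lemma measurable_box_union F m : measurable (box_union F m).
Proof. by apply: bigcup_measurable => k _; exact: measurable_obox. Qed.

Lemma box_setI (ab cd : Rn * Rn) : box ab `&` box cd =
  box (\row_i Num.max (ab.1 0 i) (cd.1 0 i), \row_i Num.min (ab.2 0 i) (cd.2 0 i)).
Proof.
apply/seteqP; split => x.
  move=> [xab xcd] i; rewrite /= !mxE gt_max le_min.
  by have /andP[-> ->] := xab i; have /andP[-> ->] := xcd i.
by move=> h; split => i; have := h i; rewrite /= !mxE gt_max le_min;
  case/andP=> /andP[h1 h2] /andP[h3 h4]; apply/andP.
Qed.

(** The measure being an infimum over covers by boxes, a nearly optimal cover,
    truncated to finitely many boxes, approximates the set; the boxes can be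
    intersected with any box known to contain the set. *)
Lemma approx_box_union (B : Rn * Rn) (E : set Rn) (e : R) :
  measurable E -> E `<=` box B -> 0 < e ->
  exists F m, [/\ box_union F m `<=` box B,
    (mu (E `\` box_union F m) < e%:E)%E & (mu (box_union F m `\` E) < e%:E)%E].
Proof.
move=> mE EB e0.
have Efin : mu E \is a fin_num.
  rewrite ge0_fin_numE//; apply: (@le_lt_trans _ _ (mu (box B))).
    by apply: le_measure; rewrite ?inE//; exact: measurable_box.
  by apply: le_lt_trans (leb_box_le _) _; rewrite ltry.
have [_ [F EF <-] Fe] := lb_ereal_inf_adherent e0 Efin.
pose G k := omap (fun ab : Rn * Rn =>
  (\row_i Num.max (ab.1 0 i) (B.1 0 i), \row_i Num.min (ab.2 0 i) (B.2 0 i)) : Rn * Rn) (F k).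
have GE k : oapp (@box R n) set0 (G k) = oapp (@box R n) set0 (F k) `&` box B.
  by rewrite /G; case: (F k) => [ab|] /=; rewrite ?set0I// box_setI.
pose V := \bigcup_k oapp (@box R n) set0 (G k).
have mV : measurable V by apply: bigcup_measurable => k _; exact: measurable_obox.
have EV : E `<=` V.
  by move=> x Ex; have [k _ Fx] := EF x Ex; exists k => //; rewrite GE; split => //; exact: EB.
have muV : (mu V < mu E + e%:E)%E.
  apply: le_lt_trans Fe.
  apply: (@le_trans _ _ (\sum_(k <oo) mu (oapp (@box R n) set0 (G k)))%E).
    by apply: measure_sigma_subadditive => // k; exact: measurable_obox.
  apply: lee_nneseries => [k _ _|k _]; first exact: measure_ge0.
  apply: (@le_trans _ _ (mu (oapp (@box R n) set0 (F k)))).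
    by apply: le_measure; rewrite ?inE; [exact: measurable_obox..|rewrite GE; exact: subIsetl].
  by case: (F k) => [ab|] /=; [exact: leb_box_le|rewrite measure0].
have Vfin : mu V \is a fin_num.
  by rewrite ge0_fin_numE//; apply: lt_trans muV _; rewrite -(fineK Efin) -EFinD ltry.
have Ucvg : mu (box_union G m) @[m --> \oo] --> mu V.
  rewrite (_ : V = \bigcup_m box_union G m).
    apply: nondecreasing_cvg_mu.
    - by move=> m; exact: measurable_box_union.
    - by apply: bigcup_measurable => m _; exact: measurable_box_union.
    - move=> m1 m2 m12; apply/subsetPset => x [k km Gx]; exists k => //.
      exact: leq_trans m12.
  apply/seteqP; split => x; first by move=> [k _ Gx]; exists k.+1 => //; exists k => /=.
  by move=> [m _ [k _ Gx]]; exists k.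
have UV m : box_union G m `<=` V by move=> x [k _ Gx]; exists k.
have : \forall m \near \oo, (mu V - e%:E < mu (box_union G m))%E.
  apply: (Ucvg [set y | mu V - e%:E < y]%E); apply: open_nbhs_nbhs; split.
    exact: open_ereal_gt_ereal.
  suff : (mu V - e%:E < mu V)%E by []. by rewrite lteBlDr// lteDl// lte_fin.
move=> [m _ /(_ m (leqnn m)) /= hm]; exists G, m.
have mU := measurable_box_union G m.
split.
- by move=> x [k _]; rewrite GE => -[].
- apply: (@le_lt_trans _ _ (mu (V `\` box_union G m))).
    apply: le_measure; rewrite ?inE; [exact: measurableD..|].
    by move=> x [Ex nU]; split => //; exact: EV.
  rewrite measureD//; last by rewrite -ge0_fin_numE.
  rewrite (_ : V `&` _ = box_union G m); last by apply/setIidPr; exact: UV.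
  have Ufin : mu (box_union G m) \is a fin_num.
    rewrite ge0_fin_numE//; apply: (@le_lt_trans _ _ (mu V)); last by rewrite -ge0_fin_numE.
    by apply: le_measure; rewrite ?inE//; exact: UV.
  by rewrite lteBlDr// addeC -lteBlDr.
- apply: (@le_lt_trans _ _ (mu (V `\` E))).
    apply: le_measure; rewrite ?inE; [exact: measurableD..|].
    by move=> x [Ux nE]; split => //; exact: (UV m).
  rewrite measureD//; last by rewrite -ge0_fin_numE.
  rewrite (_ : V `&` _ = E); last by apply/setIidPr.
  by rewrite lteBlDr// addeC.
Qed.

(** The exceptional set consists of the finitely many hyperplanes that carry the
    faces of the boxes. *)
Lemma box_union_locally_constant F m : \forall x \ae mu,
  exists2 r : R, 0 < r & forall y : Rn, `|y - x| <= r ->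
    \1_(box_union F m) y = \1_(box_union F m) x :> R.
Proof.
pose H k i := oapp (fun ab : Rn * Rn => [set x : Rn | x 0 i = ab.1 0 i] `|`
   [set x : Rn | x 0 i = ab.2 0 i]) set0 (F k).
have nH : mu.-negligible (\bigcup_k \bigcup_(j : nat)
    (if insub j is Some i then H k i else set0)).
  apply: negligible_bigcup => k; apply: negligible_bigcup => j.
  case: insubP => [i _ _|_]; last exact: negligible_set0.
  rewrite /H; case: (F k) => [ab|] /=; last exact: negligible_set0.
  by apply: negligibleU; exact: leb_hyperplane.
apply: negligibleS nH => x /= nloc; apply: contrapT => nx; apply: nloc.
have nHx k i : ~ H k i x.
  by move=> Hx; apply: nx; exists k => //; exists (val i) => //; rewrite valK.
have loc k : \forall r \near 0^'+, forall y : Rn, `|y - x| <= r ->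
    oapp (@box R n) set0 (F k) y <-> oapp (@box R n) set0 (F k) x.
  have := nHx k; rewrite /H; case: (F k) => [ab|] /=; last by move=> _; near=> r.
  move=> nab.
  have : \forall r \near 0^'+, forall i, r < `|x 0 i - ab.1 0 i| /\ r < `|x 0 i - ab.2 0 i|.
    apply: filter_forall => i.
    have /not_orP[h1 h2] := nab i.
    have g1 : 0 < `|x 0 i - ab.1 0 i| by rewrite normr_gt0 subr_eq0; apply/eqP.
    have g2 : 0 < `|x 0 i - ab.2 0 i| by rewrite normr_gt0 subr_eq0; apply/eqP.
    by near=> r; split; near: r; exact: nbhs_right_lt.
  apply: filterS => r hr y yx.
  have key i : (ab.1 0 i < y 0 i <= ab.2 0 i) = (ab.1 0 i < x 0 i <= ab.2 0 i).
    have [h1 h2] := hr i.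
    have := le_trans (coord_le_norm (y - x) i) yx; rewrite !mxE => h3.
    have {}h1 := le_lt_trans h3 h1; have {}h2 := le_lt_trans h3 h2.
    have E1 : (ab.1 0 i < y 0 i) = (ab.1 0 i < x 0 i).
      move: h1; rewrite !ltr_norml.
      case: (ltP (ab.1 0 i) (x 0 i)) => c1.
        by rewrite (gtr0_norm (_ : 0 < x 0 i - _)) ?subr_gt0// => /andP[? ?]; apply/idP; lra.
      rewrite (ler0_norm (_ : x 0 i - _ <= 0)) ?subr_le0// => /andP[? ?]; apply/negbTE; rewrite -leNgt; lra.
    have E2 : (y 0 i <= ab.2 0 i) = (x 0 i <= ab.2 0 i).
      move: h2; rewrite !ltr_norml.
      case: (leP (x 0 i) (ab.2 0 i)) => c1.
        by rewrite (ler0_norm (_ : x 0 i - _ <= 0)) ?subr_le0// => /andP[? ?]; apply/idP; lra.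
      rewrite (gtr0_norm (_ : 0 < x 0 i - _)) ?subr_gt0// => /andP[? ?]; apply/negbTE; rewrite -ltNge; lra.
    by rewrite E1 E2.
  by split => h i; [rewrite -key|rewrite key]; exact: h.
have : \forall r \near 0^'+, forall k : 'I_m, forall y : Rn, `|y - x| <= r ->
    oapp (@box R n) set0 (F k) y <-> oapp (@box R n) set0 (F k) x.
  by apply: filter_forall => k; exact: loc.
move=> Hr; near (0 : R)^'+ => r; exists r => //.
have hr : forall k : 'I_m, forall y : Rn, `|y - x| <= r ->
    oapp (@box R n) set0 (F k) y <-> oapp (@box R n) set0 (F k) x by near: r.
move=> y yx; rewrite !indicE; congr (_%:R); congr (nat_of_bool _).
apply/idP/idP; rewrite !inE => -[k km h]; exists k => //.
  by rewrite -(hr (Ordinal km) y yx).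
by rewrite (hr (Ordinal km) y yx).
Unshelve. all: by end_near. Qed.

End Approximation.

(** * Test functions and convolution *)

Section Analysis.
Context (R : realType) (n : nat).
Local Notation Rn := 'rV[R]_n.
Local Notation mu := (@leb R n).
Local Notation dir i := (delta_mx 0 i : Rn).
Implicit Types (u v e f g : Rn -> R) (s : seq 'I_n).

(** Iterated derivatives are indexed by words in the directions, which record
    the order of differentiation. *)
Definition wderiv s f : Rn -> R := foldr (@partial R n) f s.

Lemma wderiv_cat s1 s2 f : wderiv (s1 ++ s2) f = wderiv s1 (wderiv s2 f).
Proof. exact: foldr_cat. Qed.

Lemma smooth_wderiv s f : smooth f -> smooth (wderiv s f).
Proof. by move=> sf s'; rewrite -!/(wderiv _ _) -wderiv_cat; exact: sf. Qed.

Lemma smooth_partial i f : smooth f -> smooth (partial i f).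
Proof. exact: (@smooth_wderiv [:: i]). Qed.

Lemma smooth_continuous f : smooth f -> continuous f.
Proof. by move=> /(_ [::])[]. Qed.

Lemma smooth_derivable f i x : smooth f -> derivable f x (dir i).
Proof. by move=> /(_ [::])[_]. Qed.

(** Sequences suffice to test continuity; dominated convergence applies to them. *)
Lemma seq_continuous f x :
  (forall y : nat -> Rn, (forall k, `|y k - x| <= k.+1%:R^-1) ->
     f (y k) @[k --> \oo] --> f x) -> {for x, continuous f}.
Proof.
move=> H; apply: (@cvgrPdist_lt _ _ _ (nbhs x) _ f (f x)).2 => e e0; apply: contrapT => nH.
have [y hy] : {y : nat -> Rn & forall k, `|y k - x| <= k.+1%:R^-1 /\ e <= `|f x - f (y k)|}.
  apply: (@choice _ _ (fun k z => `|z - x| <= k.+1%:R^-1 /\ e <= `|f x - f z|)) => k.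
  apply: contrapT => nk; apply: nH; apply/nbhs_ballP; exists k.+1%:R^-1 => /=; first by rewrite invr_gt0.
  move=> z; rewrite -ball_normE /= distrC => zx; rewrite ltNge; apply/negP => ez; apply: nk.
  by exists z; split => //; exact: ltW.
have /cvgrPdist_lt/(_ e e0)[k _ /(_ k (leqnn k))] := H y (fun k => (hy k).1).
by rewrite /= ltNge (hy k).2.
Qed.

Lemma dist_inv_cvg (x : Rn) (y : nat -> Rn) :
  (forall k, `|y k - x| <= k.+1%:R^-1) -> y k @[k --> \oo] --> x.
Proof.
move=> hy; apply/cvgrPdist_le => e e0.
near=> k; rewrite distrC; apply: le_trans (hy k) _; apply: ltW.
by near: k; exact: (near_infty_natSinv_lt (PosNum e0)).
Unshelve. all: by end_near. Qed.

Lemma is_derive_line f (v z : Rn) (t : R) : derivable f (z + t *: v) v ->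
  is_derive t 1 (fun r => f (z + r *: v)) ('D_v f (z + t *: v)).
Proof.
move=> df.
have E : (fun h : R => h^-1 *: (f (z + (h *: 1 + t) *: v) - f (z + t *: v))) =
    (fun h => h^-1 *: (f (h *: v + (z + t *: v)) - f (z + t *: v))).
  apply/funext => h; congr (_ *: (f _ - _)).
  by rewrite scalerDl addrCA -[h *: 1]/(h * 1) mulr1.
apply: DeriveDef; rewrite /derivable /derive /=; first by rewrite E.
by rewrite E.
Qed.

Lemma is_derive_line_opp f (v z : Rn) (t : R) : derivable f (z - t *: v) v ->
  is_derive t 1 (fun r => f (z - r *: v)) (- 'D_v f (z - t *: v)).
Proof.
rewrite -scaleNr => df; have h1 := is_derive_line df.
have h2 : is_derive t 1 (fun r : R => - r) (- 1).
  exact: (@is_deriveN _ _ _ id t 1 1).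
have := is_derive1_comp h1 h2; rewrite mulrN1 /comp.
by under [X in is_derive _ _ X _ -> _]eq_fun do rewrite scaleNr.
Qed.

Lemma wderiv_translate s f c x :
  wderiv s (fun y => f (y - c)) x = wderiv s f (x - c).
Proof.
elim: s x => //= i s IH x; rewrite -!/(wderiv _ _).
have E : (fun h : R => h^-1 *: (wderiv s (fun y => f (y - c)) (h *: dir i + x) -
      wderiv s (fun y => f (y - c)) x)) =
    (fun h => h^-1 *: (wderiv s f (h *: dir i + (x - c)) - wderiv s f (x - c))).
  by apply/funext => h; rewrite !IH addrA.
by rewrite /partial /derive /= E.
Qed.

Lemma smooth_translate f c : smooth f -> smooth (fun y => f (y - c)).
Proof.
move=> sf s; have [cs ds] := sf s.
have -> : foldr (@partial R n) (fun y => f (y - c)) s = fun y => wderiv s f (y - c).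
  by apply/funext => x; exact: wderiv_translate.
split=> /= [x|i x].
  apply: (@continuous_comp _ _ _ (fun y => y - c) (wderiv s f)); last exact: cs.
  by apply: (@cvgB _ _ _ (nbhs x)); [exact: cvg_id|exact: cvg_cst].
have := ds i (x - c); rewrite /derivable /=.
by under [X in cvg (X @ _) -> _]eq_fun do rewrite addrA.
Qed.

(** The radius of the support is kept explicit, because it measures the scale of a
    mollifier. *)
Definition test_fun (rho : R) f := smooth f /\ forall x, rho < `|x| -> f x = 0.

Lemma wderiv_support s f rho : (forall x, rho < `|x| -> f x = 0) ->
  forall x, rho < `|x| -> wderiv s f x = 0.
Proof.
move=> f0; elim: s => //= i s IH x xr; rewrite /partial.
have nx : nbhs x (~` cube 0 rho).
  apply: open_nbhs_nbhs; split; first exact/closed_openC/closed_cube.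
  by rewrite /cube /= subr0; apply/negP; rewrite -ltNge.
rewrite (@near_eq_derive _ _ _ _ (cst 0)) ?derive_cst//.
apply: filterS nx => y /= /negP; rewrite /cube /= subr0 -ltNge; exact: IH.
Qed.

Lemma test_wderiv s f rho : test_fun rho f -> test_fun rho (wderiv s f).
Proof. by move=> [sf f0]; split; [exact: smooth_wderiv|exact: wderiv_support]. Qed.

Lemma test_Cc_infty f rho : test_fun rho f -> Cc_infty f.
Proof.
move=> [sf f0]; split => //.
apply: (@subclosed_compact _ _ (cube 0 rho)); [exact: closed_closure|exact: compact_cube|].
have -> : cube 0 rho = closure (cube (0 : Rn) rho) by apply/closure_id; exact: closed_cube.
apply: closure_subset => x /= /eqP fx.
by rewrite /cube /= subr0 leNgt; apply/negP => /f0.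
Qed.

Lemma Cc_infty_test f : Cc_infty f -> exists2 rho, 0 <= rho & test_fun rho f.
Proof.
move=> [sf /compact_sub_cube[N hN]]; exists N%:R => //; split=> // x xN.
apply: contrapT => /eqP fx.
have : cube 0 N%:R x by apply: hN; exact: subset_closure.
by rewrite /cube /= subr0 leNgt xN.
Qed.

Lemma test_bounded f rho : test_fun rho f -> exists2 M, 0 <= M & forall x, `|f x| <= M.
Proof.
move=> [sf f0].
have /compact_bounded[M [_ hM]] : compact (f @` cube 0 rho).
  apply: continuous_compact; last exact: compact_cube.
  exact/continuous_subspaceT/smooth_continuous.
exists (`|M| + 1); first by rewrite addr_ge0.
move=> x; have [xr|xr] := leP `|x| rho; last by rewrite f0// normr0 addr_ge0.
apply: (hM (`|M| + 1)); first by rewrite (le_lt_trans (ler_norm M))// ltrDl.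
by exists x => //; rewrite /cube /= subr0.
Qed.

Lemma test_measurable f rho : test_fun rho f -> measurable_fun [set: Rn] f.
Proof. by move=> [/smooth_continuous cf _]; exact: continuous_measurable. Qed.

Lemma loc_integrable_cube u c r : loc_integrable u ->
  mu.-integrable (cube c r) (EFin \o u).
Proof. by move=> [_]; apply; exact: compact_cube. Qed.

Lemma integrable_loc_mul u g c r M : loc_integrable u ->
  measurable_fun [set: Rn] g -> (forall x, `|g x| <= M) ->
  (forall x, ~ cube c r x -> g x = 0) ->
  mu.-integrable [set: Rn] (fun x => (u x * g x)%:E).
Proof.
move=> lu mg gM g0; have mC := measurable_cube c r.
have := (integrable_mkcond (fun x => (u x * g x)%:E) mC).1.
rewrite (_ : _ \_ _ = fun x => (u x * g x)%:E); last first.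
  apply/funext => x; rewrite patchE; case: ifPn => // /negP; rewrite inE => /g0 ->.
  by rewrite mulr0.
apply.
have := @integrableMl _ _ _ mu _ mC _ g (loc_integrable_cube c r lu); apply.
  exact: measurable_funTS.
exists M; split; first exact: num_real.
by move=> M' MM' x _ /=; rewrite (le_trans (gM x))// ltW.
Qed.

Lemma dominated_Rcvg d (T : measurableType d) (m : {measure set T -> \bar R})
    (f_ : nat -> T -> R) (f g : T -> R) :
  (forall k, measurable_fun [set: T] (f_ k)) -> measurable_fun [set: T] f ->
  (\forall x \ae m, f_ k x @[k --> \oo] --> f x) ->
  m.-integrable [set: T] (EFin \o g) ->
  (forall k, \forall x \ae m, `|f_ k x| <= g x) ->
  \int[m]_x f_ k x @[k --> \oo] --> \int[m]_x f x.
Proof.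
move=> mf_ mf f_f ig fg.
have fE : \forall x \ae m, setT x -> (f_ k x)%:E @[k --> \oo] --> (f x)%:E.
  by apply: filterS f_f => x fx _; apply: cvg_EFin => //; exact: nearW.
have gE : \forall x \ae m, forall k, setT x -> (`|(f_ k x)%:E| <= (g x)%:E)%E.
  by apply: filterS (ae_foralln fg) => x gx k _; rewrite lee_fin.
have mfE k : measurable_fun setT (EFin \o f_ k) by exact/measurable_EFinP.
have mE : measurable_fun setT (EFin \o f) by exact/measurable_EFinP.
have [intf _ H] := dominated_convergence measurableT mfE mE fE ig gE.
apply: fine_cvg; rewrite fineK; first exact: H.
exact: integrable_fin_num.
Qed.

End Analysis.

Section Convolution.
Context (R : realType) (n : nat).
Local Notation Rn := 'rV[R]_n.
Local Notation mu := (@leb R n).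
Local Notation dir i := (delta_mx 0 i : Rn).
Implicit Types (u v e f g : Rn -> R) (s : seq 'I_n).

(** Convolution with the reflection of [e]; for the even mollifiers used below
    this is the usual convolution, and it avoids reflecting the measure. *)
Definition convol u e : Rn -> R := fun x => \int[mu]_y (u y * e (y - x)).

Lemma norm_dir_le1 i : `|dir i| <= 1.
Proof. by apply/norm_leP => // j; rewrite mxE; case: (_ && _); rewrite ?normr1 ?normr0. Qed.

Lemma test_translate_outside e rho (x y : Rn) : test_fun rho e ->
  ~ cube x rho y -> e (y - x) = 0.
Proof. by move=> [_ e0] /negP; rewrite -ltNge => /e0. Qed.

Lemma measurable_translate d (T : measurableType d) (f : Rn -> T) (x : Rn) :
  measurable_fun [set: Rn] f -> measurable_fun [set: Rn] (fun y => f (y - x)).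
Proof. exact: measurable_fun_shift. Qed.

Lemma convol_integrable u e rho x : loc_integrable u -> test_fun rho e ->
  mu.-integrable [set: Rn] (fun y => (u y * e (y - x))%:E).
Proof.
move=> lu te; have [M _ eM] := test_bounded te.
have me := measurable_translate x (test_measurable te).
exact: (integrable_loc_mul lu me (fun y => eM (y - x)) (fun y => @test_translate_outside e rho x y te)).
Qed.

(** Dominates [u] times the translates, by bounded vectors, of a test function
    that is bounded by [M]. *)
Let hat u (c : Rn) (r M : R) := fun y => `|u y| * (M * \1_(cube c r) y).

Let integrable_hat u c r M : loc_integrable u ->
  mu.-integrable [set: Rn] (EFin \o hat u c r M).
Proof.
move=> lu; have mI : measurable_fun [set: Rn] (\1_(cube c r) : Rn -> R).
  exact/measurable_indic/measurable_cube.
have := @integrable_loc_mul _ _ (fun y => `|u y|) (fun y => M * \1_(cube c r) y) c r `|M|.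
apply.
- split; first by apply: measurableT_comp => //; exact: lu.1.
  by move=> K cK; have := integrable_norm (lu.2 K cK).
- exact: measurable_funM.
- by move=> y; rewrite normrM ler_piMr// indicE normr_nat lern1 leq_b1.
- by move=> y nc; rewrite indicE memNset// mulr0.
Qed.

Let hat_ge u e (c x y : Rn) (r rho M : R) : test_fun rho e ->
  (forall z, `|e z| <= M) -> `|x - c| <= r ->
  `|u y * e (y - x)| <= hat u c (rho + r) M y.
Proof.
move=> te eM xc; rewrite normrM ler_wpM2l// indicE.
case: (boolP (y \in cube c (rho + r))) => [_|]; first by rewrite mulr1.
rewrite notin_setE => ny; rewrite (test_translate_outside te) ?normr0 ?mulr0// => yx.
apply: ny; rewrite /cube /=.
have -> : y - c = (y - x) + (x - c) by rewrite addrA subrK.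
by rewrite (le_trans (ler_normD _ _))// lerD.
Qed.

Lemma convol_continuous u e rho : loc_integrable u -> test_fun rho e ->
  continuous (convol u e).
Proof.
move=> lu te x; have [M _ eM] := test_bounded te.
apply: seq_continuous => y hy.
apply: (@dominated_Rcvg _ _ _ mu _ _ (hat u x (rho + 1) M)).
- move=> k; apply: measurable_funM; first exact: lu.1.
  exact/measurable_translate/(test_measurable te).
- apply: measurable_funM; first exact: lu.1.
  exact/measurable_translate/(test_measurable te).
- apply: aeW => z; apply: cvgM; first exact: cvg_cst.
  have ce : {for (z - x), continuous e} by apply: smooth_continuous; exact: te.1.
  apply: (@cvg_comp _ _ _ (fun k => z - y k) e _ (nbhs (z - x))); last exact: ce.
  by apply: cvgB; [exact: cvg_cst|exact: dist_inv_cvg].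
- exact: integrable_hat.
- move=> k; apply: aeW => z; apply: hat_ge => //.
  by rewrite (le_trans (hy k))// invf_le1// ler1n.
Qed.

(** Differentiation under the integral sign: along a segment of length 2 the
    derivatives of the integrand have a common integrable majorant. *)
Lemma is_derive_convol u e rho (i : 'I_n) (x : Rn) : loc_integrable u -> test_fun rho e ->
  is_derive x (dir i) (convol u e) (- convol u (partial i e) x).
Proof.
move=> lu te; have tpe := @test_wderiv _ _ [:: i] _ _ te.
have [M M0 eM] := test_bounded tpe.
pose f (t : R) y := u y * e ((y - x) - t *: dir i).
have dfy (t : R) (y : Rn) : is_derive t (1 : R) (fun r => f r y)
    (u y * - partial i e ((y - x) - t *: dir i)).
  have := is_derive_line_opp (@smooth_derivable _ _ e i ((y - x) - t *: dir i) te.1).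
  exact: (@is_deriveZ _ _ _ _ (u y)).
have cf (t : R) : (fun y => f t y) = (fun y => u y * e (y - (x + t *: dir i))).
  by apply/funext => y; rewrite /f opprD addrA.
have i0 : `](-1 : R), 1[%classic 0 by rewrite /= in_itv/= ltr01 oppr_lt0 ltr01.
have intf t : `](-1 : R), 1[%classic t -> mu.-integrable setT (EFin \o f t).
  move=> _; have := convol_integrable (x + t *: dir i) lu te.
  by congr (integrable _ _ _); apply/funext => y; rewrite /= /f opprD addrA.
have dff t y : `](-1 : R), 1[%classic t -> setT y -> derivable (f^~ y) t 1.
  by move=> _ _; case: (dfy t y).
have Gge t y : `](-1 : R), 1[%classic t -> setT y ->
    `|partial1of2 f t y| <= hat u x (rho + 1) M y.
  rewrite /= in_itv/= => /andP[t1 t2] _; rewrite partial1of2E (@derive_val _ _ _ _ _ _ _ (dfy t y)).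
  rewrite mulrN normrN -addrA -opprD.
  apply: (@hat_ge u (partial i e)) => //.
  rewrite addrAC subrr add0r normrZ (le_trans (_ : _ <= `|t| * 1))//.
    by rewrite ler_wpM2l// norm_dir_le1.
  by rewrite mulr1 ler_norml !ltW.
have G0 y : 0 <= hat u x (rho + 1) M y by rewrite /hat !mulr_ge0// indicE ler0n.
have D := @cvg_differentiation_under_integral R _ _ mu f setT measurableT 0 (-1) 1
  i0 intf dff _ G0 (integrable_hat x (rho + 1) M lu) Gge.
have E : (fun h : R => h^-1 *: (convol u e (h *: dir i + x) - convol u e x)) =
    (fun h : R => h^-1 *: (\int[mu]_(y in setT) f (h + 0) y - \int[mu]_(y in setT) f 0 y)).
  have fc (t : R) : \int[mu]_(y in setT) f t y = convol u e (x + t *: dir i).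
    by rewrite /convol cf.
  by apply/funext => h; rewrite !fc scale0r !addr0 (addrC x (h *: _)).
have L : \int[mu]_(y in setT) partial1of2 f 0 y = - convol u (partial i e) x.
  rewrite /convol -mulN1r -RintegralZl//; last exact: (convol_integrable x lu tpe).
  apply: eq_Rintegral => y _.
  by rewrite partial1of2E (@derive_val _ _ _ _ _ _ _ (dfy 0 y)) scale0r subr0 mulrN mulN1r.
rewrite L -E in D. apply: DeriveDef; first by apply/cvg_ex; exists (- convol u (partial i e) x).
exact: cvg_lim.
Qed.

Lemma wderiv_convol u e rho s : loc_integrable u -> test_fun rho e ->
  wderiv s (convol u e) = fun x => (-1) ^+ size s * convol u (wderiv s e) x.
Proof.
move=> lu te; elim: s => [|i s IH]; first by apply/funext => x; rewrite mul1r.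
apply/funext => x; rewrite /= -!/(wderiv _ _) {}IH.
have te' := test_wderiv s te.
have H := @is_derive_convol u (wderiv s e) rho i x lu te'.
have := @is_deriveZ _ _ _ _ ((-1) ^+ size s) x (dir i) _ H => H2.
by rewrite /partial (@derive_val _ _ _ _ _ _ _ H2) exprS scalerN mulN1r mulNr.
Qed.

Lemma smooth_convol u e rho : loc_integrable u -> test_fun rho e -> smooth (convol u e).
Proof.
move=> lu te s; rewrite -/(wderiv s _) (wderiv_convol s lu te) /=.
have te' := test_wderiv s te; split.
  move=> x; apply: (@continuousM _ _ (cst ((-1) ^+ size s)) (convol u (wderiv s e)) x).
    exact: cst_continuous.
  exact: (convol_continuous lu te').
move=> i x; have H := @is_derive_convol u (wderiv s e) rho i x lu te'.
by have [] := @is_deriveZ _ _ _ _ ((-1) ^+ size s) x (dir i) _ H.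
Qed.

Lemma eq_convol u v e rho x : test_fun rho e ->
  (forall y, cube x rho y -> u y = v y) -> convol u e x = convol v e x.
Proof.
move=> te uv; apply: eq_Rintegral => y _.
have [cy|ncy] := pselect (cube x rho y); first by rewrite uv.
by rewrite (test_translate_outside te ncy) !mulr0.
Qed.

Lemma convolB u v e rho x : loc_integrable u -> loc_integrable v -> test_fun rho e ->
  convol (fun y => u y - v y) e x = convol u e x - convol v e x.
Proof.
move=> lu lv te; rewrite /convol -RintegralB//; [|exact: (convol_integrable x lu te)|exact: (convol_integrable x lv te)].
by apply: eq_Rintegral => y _; rewrite mulrBl.
Qed.

Lemma convolZ (k : R) u e rho x : loc_integrable u -> test_fun rho e ->
  convol (fun y => k * u y) e x = k * convol u e x.
Proof.
move=> lu te; rewrite /convol -RintegralZl//; last exact: (convol_integrable x lu te).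
by apply: eq_Rintegral => y _; rewrite mulrA.
Qed.

Lemma measurable_compact (K : set Rn) : compact K -> measurable K.
Proof.
move=> cK; rewrite -(setCK K); apply/measurableC/measurable_open/closed_openC.
exact: compact_closed (@norm_hausdorff _ _) cK.
Qed.

Lemma leb_compact_lty (K : set Rn) : compact K -> (mu K < +oo)%E.
Proof.
move=> cK; have [N KN] := compact_sub_cube cK.
apply: le_lt_trans (leb_cube_lty (0 : Rn) N%:R).
by apply: le_measure; rewrite ?inE//; [exact: measurable_compact|exact: measurable_cube].
Qed.

Lemma bounded_loc_integrable u M : measurable_fun [set: Rn] u ->
  (forall x, `|u x| <= M) -> loc_integrable u.
Proof.
move=> mu_ uM; split => // K cK; apply: measurable_bounded_integrable.
- exact: measurable_compact.
- exact: leb_compact_lty.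
- exact: measurable_funTS.
- exists M; split; first exact: num_real.
  by move=> M' MM' x _ /=; rewrite (le_trans (uM x))// ltW.
Qed.

Lemma test_integrable e rho : test_fun rho e ->
  mu.-integrable [set: Rn] (EFin \o e).
Proof.
move=> te; have l1 : loc_integrable (fun _ : Rn => 1 : R).
  by apply: (@bounded_loc_integrable _ 1) => // x; rewrite normr1.
have := convol_integrable 0 l1 te.
by congr (integrable _ _ _); apply/funext => x /=; rewrite mul1r subr0.
Qed.

Lemma Rintegral_shift f (t : Rn) : measurable_fun [set: Rn] f ->
  \int[mu]_x f (x + t) = \int[mu]_x f x.
Proof.
move=> mf; rewrite /Rintegral; congr fine.
apply: (@integral_shift _ _ (fun y => (f y)%:E)).
exact/measurable_EFinP.
Qed.

Lemma convol_cst (k : R) e rho x : test_fun rho e ->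
  convol (fun=> k) e x = k * \int[mu]_y e y.
Proof.
move=> te; rewrite /convol RintegralZl//.
  congr (_ * _); apply: Rintegral_shift; exact: test_measurable te.
exact: (integrable_shift (- x) (test_integrable te)).
Qed.

Lemma convol_le u e rho x C : loc_integrable u -> test_fun rho e ->
  (forall y, cube x rho y -> `|u y| <= C) -> (forall y, 0 <= e y) -> 0 <= C ->
  `|convol u e x| <= C * \int[mu]_y e y.
Proof.
move=> lu te uC e0 C0; have iu := convol_integrable x lu te.
apply: le_trans (le_normr_Rintegral _ _) _ => //.
rewrite -(convol_cst C x te); apply: le_Rintegral => //.
- exact: integrable_norm iu.
- apply: (@convol_integrable (fun=> C) e rho x) => //.
  by apply: (@bounded_loc_integrable _ `|C|).
- move=> y _; rewrite normrM (ger0_norm (e0 _)).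
  have [cy|ncy] := pselect (cube x rho y); first by rewrite ler_wpM2r// uC.
  by rewrite (test_translate_outside te ncy) !mulr0.
Qed.

End Convolution.

(** * A mollifier *)

Section Bump.
Context (R : realType).
Implicit Types (P Q : {poly R}) (t x m : R).

(** The functions P(1/t) exp(-1/t), extended by 0 to the negative half-line,
    form a class that is closed under differentiation. *)
Definition expinv P t : R := if 0 < t then P.[t^-1] * expR (- t^-1) else 0.

(** The chain rule: with s = 1/t, the derivative of P(s) exp(-s) in s is
    (P' - P)(s) exp(-s), and that of 1/t is - s^2. *)
Definition expinv_deriv P : {poly R} := (P - P^`()) * 'X^2.

(** The exponential beats every polynomial, which gives all these functions the
    derivative 0 at the origin. *)
Lemma horner_expR_bound P k : exists2 C, 0 <= C &
  forall x, 0 <= x -> `|P.[x]| * x ^+ k <= C * expR x.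
Proof.
have powb j : exists2 C : R, 0 <= C & forall x, 0 <= x -> x ^+ j <= C * expR x.
  case: j => [|j]; first by exists 1 => // x x0; rewrite expr0 mul1r -expR0 ler_expR.
  exists j.+1`!%:R => // x x0; have := expR_ge1Dxn j x0.
  rewrite -ler_pdivrMl ?ltr0n ?fact_gt0// mulrC.
  by apply: le_trans; rewrite lerDr.
elim/poly_ind: P k => [|P r IH] k; first by exists 0 => // x _; rewrite horner0 normr0 !mul0r.
have [C C0 hC] := IH k.+1; have [D D0 hD] := powb k.
exists (C + `|r| * D); first by rewrite addr_ge0// mulr_ge0.
move=> x x0; rewrite !hornerE mulrDl.
apply: le_trans (ler_wpM2r _ (ler_normD _ _)) _; first exact: exprn_ge0.
rewrite mulrDl lerD//; first by rewrite normrM (ger0_norm x0) -mulrA -exprS; exact: hC.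
by rewrite -mulrA ler_wpM2l// hD.
Qed.

Lemma is_derive_expinv P t : is_derive t 1 (expinv P) (expinv (expinv_deriv P) t).
Proof.
have [t0|t0|<-] := ltgtP 0 t.
- apply: (@near_eq_is_derive _ _ _ (fun s => (horner P \o GRing.inv) s * (expR \o (fun s => - s^-1)) s)).
    by near=> s; rewrite /expinv ifT//=; near: s; exact: lt_nbhsr.
  have tn0 : t != 0 by rewrite gt_eqF.
  have dV : is_derive t 1 (GRing.inv : R -> R) (- t ^- 2).
    by have := is_deriveV tn0 (is_derive_id t (1 : R)); rewrite -[_ *: 1]/(_ * 1) mulr1.
  have dP : is_derive (t^-1) 1 (horner P) (P^`()).[t^-1].
    by rewrite derivE derive1E; apply: DeriveDef => //; exact: derivable_horner.
  have d1 := is_derive1_comp dP dV.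
  have d2 : is_derive t 1 (expR \o (fun s => - s^-1)) (expR (- t^-1) * - (- t ^- 2)).
    apply: is_derive1_comp; exact: is_deriveN.
  apply: (is_derive_eq (is_deriveM d1 d2)).
  rewrite /expinv t0 /expinv_deriv !hornerE /= /GRing.scale /= -exprVn.
  by ring.
- apply: (@near_eq_is_derive _ _ _ (cst 0)).
    near=> s; rewrite /expinv ifF//=; apply/negbTE; rewrite -leNgt ltW//.
    by near: s; exact: lt_nbhsl.
  by rewrite /expinv ifF; [exact: is_derive_cst|rewrite lt_gtF].
- have [C C0 hC] := horner_expR_bound P 2.
  rewrite /expinv /= ltxx.
  have lim0 : h^-1 *: (expinv P (h *: 1 + 0) - expinv P 0) @[h --> 0^'] --> 0.
    apply/cvgrPdist_le => e e0; near=> h.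
    rewrite sub0r normrN addr0 /expinv ltxx subr0 -[h *: 1]/(h * 1) mulr1.
    case: ifPn => [h0|_]; last by rewrite scaler0 normr0 ltW.
    have hV0 : 0 <= h^-1 by rewrite invr_ge0 ltW.
    rewrite -[_ *: _]/(_ * _) !normrM (ger0_norm hV0) (ger0_norm (expR_ge0 _)).
    have hb := hC _ hV0.
    apply: (@le_trans _ _ (C * h)).
      rewrite expRN mulrA ler_pdivrMr ?expR_gt0// mulrAC -ler_pdivrMr// mulrC.
      by rewrite [leLHS](_ : _ = `|P.[h^-1]| * h^-1 ^+ 2)//; ring.
    have hh : h <= e / (C + 1).
      rewrite (le_trans (ler_norm _))//; near: h.
      apply: dnbhs0_le; rewrite divr_gt0// ltr_wpDl//.
    apply: le_trans (ler_wpM2l C0 hh) _.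
    by rewrite mulrCA ler_piMr ?(ltW e0)// ler_pdivrMr ?mul1r ?lerDl// ltr_wpDl.
  apply: DeriveDef; first by apply/cvg_ex; exists 0.
  exact: cvg_lim.
Unshelve. all: by end_near. Qed.

Lemma expinvN P t : expinv (- P) t = - expinv P t.
Proof. by rewrite /expinv; case: ifP; rewrite ?oppr0// hornerN mulNr. Qed.

Lemma expinvZ (k : R) P t : expinv (k *: P) t = k * expinv P t.
Proof. by rewrite /expinv; case: ifP; rewrite ?mulr0// hornerZ mulrA. Qed.

(** Sums of products of two such functions, one for each end of the interval
    [-1/m, 1/m]: a class that contains the bump and all its derivatives. *)
Definition bump_sum m (l : seq ({poly R} * {poly R})) t : R :=
  \sum_(p <- l) expinv p.1 (1 + m * t) * expinv p.2 (1 - m * t).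

Definition bump_sum_deriv m (l : seq ({poly R} * {poly R})) :=
  flatten [seq [:: (m *: expinv_deriv p.1, p.2); (p.1, - (m *: expinv_deriv p.2))] | p <- l].

Lemma is_derive_bump_sum m l t :
  is_derive t 1 (bump_sum m l) (bump_sum m (bump_sum_deriv m l) t).
Proof.
elim: l => [|[P Q] l IH].
  rewrite (_ : bump_sum m [::] = cst 0); last by apply/funext => s; rewrite /bump_sum big_nil.
  by rewrite /= ; exact: is_derive_cst.
rewrite (_ : bump_sum m _ = (fun s => (expinv P \o (fun s => 1 + m * s)) s *
   (expinv Q \o (fun s => 1 - m * s)) s) + bump_sum m l); last first.
  by apply/funext => s; rewrite /bump_sum big_cons.
have dm : is_derive t 1 (fun s => m * s) m.
  by have := is_deriveZ m (is_derive_id t (1 : R)); rewrite -[m *: 1]/(m * 1) mulr1.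
have dp : is_derive t 1 (fun s => 1 + m * s) m.
  by have := is_deriveD (is_derive_cst (1 : R) t (1 : R)) dm; rewrite add0r.
have dn : is_derive t 1 (fun s => 1 - m * s) (- m).
  by have := is_deriveB (is_derive_cst (1 : R) t (1 : R)) dm; rewrite sub0r.
have d1 := @is_derive1_comp _ _ (fun s => 1 + m * s) _ _ _ (is_derive_expinv P _) dp.
have d2 := @is_derive1_comp _ _ (fun s => 1 - m * s) _ _ _ (is_derive_expinv Q _) dn.
apply: (is_derive_eq (is_deriveD (is_deriveM d1 d2) IH)).
rewrite /= [in RHS]/bump_sum /bump_sum_deriv /= !big_cons -/(bump_sum_deriv m l) -/(bump_sum m _ t).
rewrite /= expinvN !expinvZ /GRing.scale /=.
by ring.
Qed.

Definition bump_fun m : R -> R := bump_sum m [:: (1, 1)].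

Definition bump_deriv m k : R -> R :=
  bump_sum m (iter k (bump_sum_deriv m) [:: (1, 1)]).

Lemma is_derive_bump m k t : is_derive t 1 (bump_deriv m k) (bump_deriv m k.+1 t).
Proof. exact: is_derive_bump_sum. Qed.

Lemma bump_funE m t : bump_fun m t = expinv 1 (1 + m * t) * expinv 1 (1 - m * t).
Proof. by rewrite /bump_fun /bump_sum big_seq1. Qed.

Lemma expinv1_ge0 t : 0 <= expinv 1 t.
Proof. by rewrite /expinv; case: ifP => // _; rewrite hornerC mul1r expR_ge0. Qed.

Lemma expinv1_le1 t : expinv 1 t <= 1.
Proof.
rewrite /expinv; case: ifP => // t0; rewrite hornerC mul1r -expR0 ler_expR.
by rewrite oppr_le0 invr_ge0 ltW.
Qed.

Lemma bump_ge0 m t : 0 <= bump_fun m t.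
Proof. by rewrite bump_funE mulr_ge0// expinv1_ge0. Qed.

Lemma bump_le1 m t : bump_fun m t <= 1.
Proof. by rewrite bump_funE mulr_ile1// ?expinv1_ge0// expinv1_le1. Qed.

Lemma bump_out m t : 0 < m -> m^-1 <= `|t| -> bump_fun m t = 0.
Proof.
move=> m0; rewrite -[leLHS]mulr1 ler_pdivrMl// => h; rewrite bump_funE /expinv.
have [t0|t0] := leP 0 t.
  rewrite [X in _ * X]ifF ?mulr0//; apply/negbTE; rewrite -leNgt subr_le0.
  by rewrite (ger0_norm t0) in h.
rewrite ifF ?mul0r//; apply/negbTE; rewrite -leNgt.
by rewrite (ltr0_norm t0) mulrN in h; lra.
Qed.

Lemma bump_ge m t : 0 < m -> `|t| <= (2 * m)^-1 -> expR (- 4) <= bump_fun m t.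
Proof.
move=> m0 h; have : `|m * t| <= 2^-1.
  rewrite normrM (gtr0_norm m0); apply: le_trans (ler_wpM2l (ltW m0) h) _.
  by rewrite invfM mulrCA divff ?mulr1// gt_eqF.
rewrite ler_norml => /andP[h1 h2].
have key s : 2^-1 <= s -> expR (- 2) <= expinv 1 s.
  move=> hs; have s0 : 0 < s by apply: lt_le_trans hs; rewrite invr_gt0.
  rewrite /expinv s0 hornerC mul1r ler_expR lerN2.
  by rewrite -[leRHS]invrK lef_pV2 ?posrE ?invr_gt0.
rewrite bump_funE (_ : - 4 = - 2 + - 2) ?expRD; last by ring.
by rewrite ler_pM ?expR_ge0// key//; lra.
Qed.

End Bump.

Lemma integrable_indic_lty d (T : measurableType d) (R : realType)
    (m : {measure set T -> \bar R}) (A : set T) :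
  measurable A -> (m A < +oo)%E -> m.-integrable setT (EFin \o (\1_A : T -> R)).
Proof.
move=> mA Aoo; apply/integrableP; split; first exact/measurable_EFinP/measurable_indic.
under eq_integral => x _ do rewrite /= ger0_norm//.
by rewrite integral_indic// setIT.
Qed.

Section Mollifier.
Context (R : realType) (n : nat).
Local Notation Rn := 'rV[R]_n.
Local Notation mu := (@leb R n).
Local Notation dir i := (delta_mx 0 i : Rn).
Implicit Types (G : 'I_n -> R -> R) (s : seq 'I_n) (m : R) (x : Rn).

Definition tensor G : Rn -> R := fun x => \prod_(i < n) G i (x 0 i).

Lemma is_derive_tensor G (i : 'I_n) (x : Rn) (d : R) : is_derive (x 0 i) 1 (G i) d ->
  is_derive x (dir i) (tensor G) (d * \prod_(j < n | j != i) G j (x 0 j)).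
Proof.
move=> dG; set c := \prod_(j < n | j != i) _.
have E : (fun h : R => h^-1 *: (tensor G (h *: dir i + x) - tensor G x)) =
    (fun h : R => c * (h^-1 *: (G i (h *: 1 + x 0 i) - G i (x 0 i)))).
  apply/funext => h; rewrite /tensor (bigD1 i)//= [X in _ - X](bigD1 i)//= -/c.
  rewrite (eq_bigr (fun j => G j (x 0 j))) -/c; last first.
    by move=> j ji; rewrite !mxE (negbTE ji) mulr0 add0r.
  by rewrite !mxE !eqxx -mulrBl -scalerAr mulrC.
have lim : h^-1 *: (tensor G (h *: dir i + x) - tensor G x) @[h --> 0^'] --> d * c.
  rewrite E mulrC; apply: (@cvgM _ _ (0^')); first exact: cvg_cst.
  by have [H <-] := dG; exact: H.
by apply: DeriveDef; [apply/cvg_ex; exists (d * c)|exact: cvg_lim].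
Qed.

Lemma continuous_tensor G : (forall i, continuous (G i)) -> continuous (tensor G).
Proof.
move=> cG; rewrite /tensor; elim: (index_enum _) => [|i r IH] x.
  have -> : (fun x : Rn => \prod_(i <- [::]) G i (x 0 i)) = cst 1.
    by apply/funext => y; rewrite big_nil.
  exact: cst_continuous.
have -> : (fun x : Rn => \prod_(j <- i :: r) G j (x 0 j)) =
    (fun x : Rn => G i (x 0 i)) \* (fun x : Rn => \prod_(j <- r) G j (x 0 j)).
  by apply/funext => y; rewrite big_cons.
apply: continuousM; last exact: IH.
apply: (@continuous_comp _ _ _ (fun x : Rn => x 0 i) (G i)); last exact: cG.
exact: coord_continuous.
Qed.

Definition bump_kernel m : Rn -> R := tensor (fun=> bump_fun m).

Lemma wderiv_bump_kernel m s :
  wderiv s (bump_kernel m) = tensor (fun i => bump_deriv m (count_mem i s)).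
Proof.
elim: s => //= i s IH; rewrite -/(wderiv s _) IH; apply/funext => x.
have := @is_derive_tensor (fun i => bump_deriv m (count_mem i s)) i x _
  (is_derive_bump m (count_mem i s) (x 0 i)).
move=> H; rewrite /partial (@derive_val _ _ _ _ _ _ _ H) /tensor [in RHS](bigD1 i)//=.
rewrite eqxx add1n; congr (_ * _); apply: eq_bigr => j ji.
by rewrite eq_sym (negbTE ji).
Qed.

Lemma smooth_bump_kernel m : smooth (bump_kernel m).
Proof.
move=> s; rewrite -/(wderiv s _) wderiv_bump_kernel /=; split.
  apply: continuous_tensor => i t.
  by apply: differentiable_continuous; apply/derivable1_diffP; have [] := is_derive_bump m (count_mem i s) t.
move=> i x; have [] // := @is_derive_tensor (fun i => bump_deriv m (count_mem i s)) i x _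
  (is_derive_bump m (count_mem i s) (x 0 i)).
Qed.

Lemma test_bump_kernel m : 0 < m -> test_fun m^-1 (bump_kernel m).
Proof.
move=> m0; have mV0 : 0 <= m^-1 by rewrite invr_ge0 ltW.
split; first exact: smooth_bump_kernel.
move=> x xm; have /existsNP[i /negP] : ~ forall i, `|x 0 i| <= m^-1.
  by move=> /(norm_leP x mV0); rewrite leNgt xm.
rewrite -ltNge => /ltW xi; rewrite /bump_kernel /tensor (bigD1 i)//= bump_out//.
by rewrite mul0r.
Qed.

Lemma bump_kernel_ge0 m x : 0 <= bump_kernel m x.
Proof. by apply: prodr_ge0 => i _; exact: bump_ge0. Qed.

Lemma bump_kernel_le1 m x : bump_kernel m x <= 1.
Proof. by apply: prodr_ile1 => i _; rewrite bump_ge0 bump_le1. Qed.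

(** On the cube of half the size every factor is at least exp(-4), and that cube
    has volume m^-n. *)
Lemma bump_kernel_integral_ge m : 0 < m ->
  (expR 4 * m) ^- n <= \int[mu]_x bump_kernel m x.
Proof.
move=> m0; have m2 : 0 < (2 * m)^-1 by rewrite invr_gt0 mulr_gt0.
have mC := measurable_cube (0 : Rn) (2 * m)^-1.
have finC : mu (cube (0 : Rn) (2 * m)^-1) \is a fin_num.
  by rewrite ge0_fin_numE// leb_cube_lty.
apply: (@le_trans _ _ (\int[mu]_x (expR (- 4) ^+ n * \1_(cube 0 (2 * m)^-1) x))).
  rewrite RintegralZl//; last exact: integrable_indic_lty (leb_cube_lty _ _).
  rewrite /Rintegral integral_indic// setIT exprMn invfM -exprVn expRN.
  rewrite ler_wpM2l ?exprn_ge0 ?invr_ge0 ?expR_ge0//.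
  rewrite -lee_fin fineK//; apply: le_trans (leb_cube_ge 0 m2).
  by rewrite lee_fin invfM mulrA divff// mul1r exprVn.
apply: le_Rintegral => //.
- exact: (integrableZl measurableT _ (integrable_indic_lty mC (leb_cube_lty _ _))).
- exact: (test_integrable (test_bump_kernel m0)).
- move=> x _; rewrite indicE; case: (boolP (x \in _)) => [|_].
    rewrite inE /cube /= subr0 mulr1 => /norm_leP-/(_ (ltW m2)) xm.
    rewrite /bump_kernel /tensor -[n in _ ^+ n]card_ord -prodr_const.
    by apply: ler_prod => i _; rewrite expR_ge0/= bump_ge.
  by rewrite mulr0 bump_kernel_ge0.
Qed.

Lemma bump_kernel_integral_gt0 m : 0 < m -> 0 < \int[mu]_x bump_kernel m x.
Proof.
move=> m0; apply: lt_le_trans (bump_kernel_integral_ge m0).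
by rewrite invr_gt0 exprn_gt0// mulr_gt0// expR_gt0.
Qed.

Definition mollifier m : Rn -> R :=
  fun x => (\int[mu]_y bump_kernel m y)^-1 * bump_kernel m x.

Lemma wderiv_scale (c : R) f s : smooth f ->
  wderiv s (fun x => c * f x) = fun x : Rn => c * wderiv s f x.
Proof.
move=> sf; elim: s => //= i s IH; rewrite -!/(wderiv s _) IH; apply/funext => x.
have d := @smooth_derivable _ _ _ i x (smooth_wderiv s sf).
by rewrite /partial (deriveZ c d).
Qed.

Lemma smooth_scale (c : R) f : smooth f -> smooth (fun x : Rn => c * f x).
Proof.
move=> sf s; rewrite -/(wderiv s _) wderiv_scale//= ; split.
  move=> x; apply: (@continuousM _ _ (cst c) (wderiv s f) x); first exact: cst_continuous.
  exact/smooth_continuous/smooth_wderiv.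
move=> i x; have d := @smooth_derivable _ _ _ i x (smooth_wderiv s sf).
by have := @derivableZ _ _ _ (wderiv s f) c x (dir i) d.
Qed.

Lemma test_mollifier m : 0 < m -> test_fun m^-1 (mollifier m).
Proof.
move=> m0; have [sk k0] := test_bump_kernel m0; split; first exact: smooth_scale.
by move=> x xm; rewrite /mollifier k0// mulr0.
Qed.

Lemma mollifier_ge0 m x : 0 < m -> 0 <= mollifier m x.
Proof.
move=> m0; rewrite mulr_ge0 ?bump_kernel_ge0// invr_ge0 ltW//.
exact: bump_kernel_integral_gt0.
Qed.

(** The order m^n is, up to a constant, the inverse of the volume of the support, so
    that mollification is dominated by averaging over cubes of radius 1/m. *)
Lemma mollifier_le m x : 0 < m -> mollifier m x <= (expR 4 * m) ^+ n.
Proof.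
move=> m0; have i0 := bump_kernel_integral_gt0 m0.
rewrite /mollifier -[leRHS]mulr1 ler_pM ?bump_kernel_ge0 ?bump_kernel_le1//.
  by rewrite invr_ge0 ltW.
have e0 : 0 < (expR 4 * m) ^+ n by rewrite exprn_gt0// mulr_gt0// expR_gt0.
rewrite -[leRHS]invrK lef_pV2 ?posrE ?invr_gt0//.
exact: bump_kernel_integral_ge.
Qed.

Lemma mollifier_integral m : 0 < m -> \int[mu]_x mollifier m x = 1.
Proof.
move=> m0; rewrite /mollifier RintegralZl//.
  by rewrite mulVf// gt_eqF// bump_kernel_integral_gt0.
exact: (test_integrable (test_bump_kernel m0)).
Qed.

(** Being a product of functions of one variable, the mollifier has partial
    derivatives that commute. *)
Lemma wderiv_mollifier_count m s1 s2 : (forall i, count_mem i s1 = count_mem i s2) ->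
  wderiv s1 (mollifier m) = wderiv s2 (mollifier m).
Proof.
move=> H; rewrite !wderiv_scale; try exact: smooth_bump_kernel.
rewrite !wderiv_bump_kernel (_ : (fun i => _) = (fun i => bump_deriv m (count_mem i s2)))//.
by apply/funext => i; rewrite H.
Qed.

End Mollifier.

(** * Weak derivatives *)

Section WeakDerivatives.
Context (R : realType) (n : nat).
Local Notation Rn := 'rV[R]_n.
Local Notation mu := (@leb R n).
Local Notation dir i := (delta_mx 0 i : Rn).
Implicit Types (u v f g eta : Rn -> R) (a : 'I_n -> nat) (s : seq 'I_n).

Definition word a : seq 'I_n := flatten [seq nseq (a i) i | i <- enum 'I_n].

Lemma pderivE a f : pderiv a f = wderiv (word a) f.
Proof.
rewrite /pderiv /word; elim: (enum _) => //= i r ->.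
by rewrite wderiv_cat; elim: (a i) => //= k ->.
Qed.

Lemma size_word a : size (word a) = morder a.
Proof.
rewrite /word /morder size_flatten /shape -map_comp sumnE big_map big_enum /=.
by apply: eq_bigr => i _; rewrite size_nseq.
Qed.

Lemma count_word a i : count_mem i (word a) = a i.
Proof.
rewrite /word count_flatten -map_comp sumnE big_map big_enum /= (bigD1 i)//=.
rewrite count_nseq /= eqxx mul1n big1 ?addn0// => j ji.
by rewrite count_nseq /= (negbTE ji).
Qed.

Lemma size_count s : size s = (\sum_(i < n) count_mem i s)%N.
Proof.
elim: s => [|j s IH] /=; first by rewrite big1.
rewrite big_split /= -IH (bigD1 j)//= eqxx big1 ?addn0// => i ij.
by rewrite eq_sym (negbTE ij).
Qed.

(** The Leibniz rule over words. The term in which the first factor is not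
    differentiated is kept apart, because it is the one that survives when that
    factor is a cutoff that converges to 1. *)
Fixpoint leibniz s : seq (seq 'I_n * seq 'I_n) :=
  if s is i :: s' then ([:: i], s') ::
    [seq (i :: p.1, p.2) | p <- leibniz s'] ++ [seq (p.1, i :: p.2) | p <- leibniz s']
  else [::].

Lemma leibniz_neq0 s p : p \in leibniz s -> p.1 != [::].
Proof.
elim: s p => //= i s IH p; rewrite inE mem_cat => /or3P[/eqP->//|/mapP[q _ ->]//|/mapP[q qs ->]].
exact: (IH q).
Qed.

Lemma leibniz_size s p : p \in leibniz s -> (size p.2 <= size s)%N.
Proof.
elim: s p => //= i s IH p; rewrite inE mem_cat => /or3P[/eqP->//|/mapP[q qs ->]|/mapP[q qs ->]] /=.
  by rewrite (leq_trans (IH _ qs)).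
by rewrite ltnS IH.
Qed.

Let leibniz_sum s f g x :=
  f x * wderiv s g x + \sum_(p <- leibniz s) wderiv p.1 f x * wderiv p.2 g x.

Let is_derive_mul i f g x : smooth f -> smooth g ->
  is_derive x (dir i) (fun y => f y * g y) (f x * partial i g x + partial i f x * g x).
Proof.
move=> sf sg; have df := derivableP (@smooth_derivable _ _ _ i x sf).
have dg := derivableP (@smooth_derivable _ _ _ i x sg).
apply: (is_derive_eq (is_deriveM df dg)).
by rewrite /partial -!/(_ * _) /GRing.scale /= (mulrC (g x)).
Qed.

Let is_derive_leibniz_sum s f g i x : smooth f -> smooth g ->
  is_derive x (dir i) (leibniz_sum s f g) (leibniz_sum (i :: s) f g x).
Proof.
move=> sf sg.
have dl : is_derive x (dir i) (fun y => \sum_(p <- leibniz s) wderiv p.1 f y * wderiv p.2 g y)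
   (\sum_(p <- leibniz s) (wderiv p.1 f x * partial i (wderiv p.2 g) x +
      partial i (wderiv p.1 f) x * wderiv p.2 g x)).
  elim: (leibniz s) => [|p r IH].
    rewrite big_nil (_ : (fun _ => _) = cst 0); first exact: is_derive_cst.
    by apply/funext => y; rewrite big_nil.
  rewrite big_cons (_ : (fun _ => _) = (fun y => wderiv p.1 f y * wderiv p.2 g y) +
     (fun y => \sum_(p <- r) wderiv p.1 f y * wderiv p.2 g y)).
    by apply: is_deriveD; apply: is_derive_mul; exact: smooth_wderiv.
  by apply/funext => y; rewrite big_cons.
have := is_deriveD (is_derive_mul i x sf (smooth_wderiv s sg)) dl.
move=> H; apply: (is_derive_eq H).
rewrite /leibniz_sum /= big_cons big_cat /= !big_map big_split /=.
by rewrite -!/(wderiv _ _) /wderiv /=; ring.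
Qed.

Lemma wderiv_mul s f g : smooth f -> smooth g ->
  wderiv s (fun x => f x * g x) = fun x =>
  f x * wderiv s g x + \sum_(p <- leibniz s) wderiv p.1 f x * wderiv p.2 g x.
Proof.
move=> sf sg; rewrite -/(leibniz_sum s f g).
elim: s => [|i s IH]; first by apply/funext => x; rewrite /leibniz_sum /= big_nil addr0.
rewrite [LHS]/= -!/(wderiv _ _) IH; apply/funext => x.
exact: (@derive_val _ _ _ _ _ _ _ (is_derive_leibniz_sum s i x sf sg)).
Qed.

Lemma smooth_mul f g : smooth f -> smooth g -> smooth (fun x => f x * g x).
Proof.
move=> sf sg s; rewrite -/(wderiv s _) wderiv_mul// -/(leibniz_sum s f g) /=; split.
  have cm p q : continuous (fun x => wderiv p f x * wderiv q g x).
    move=> x; apply: (@continuousM _ _ (wderiv p f) (wderiv q g) x);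
      exact/smooth_continuous/smooth_wderiv.
  move=> x; apply: (@continuousD _ _ _ (fun x => f x * wderiv s g x)
    (fun x => \sum_(p <- leibniz s) wderiv p.1 f x * wderiv p.2 g x)).
    exact: (cm [::]).
  elim: (leibniz s) => [|p r IH].
    rewrite (_ : (fun _ => _) = cst 0); first exact: cst_continuous.
    by apply/funext => y; rewrite big_nil.
  rewrite (_ : (fun _ => _) = (fun y => wderiv p.1 f y * wderiv p.2 g y) +
     (fun y => \sum_(p <- r) wderiv p.1 f y * wderiv p.2 g y)).
    by apply: continuousD => //; exact: cm.
  by apply/funext => y; rewrite big_cons.
by move=> i x; have [] := is_derive_leibniz_sum s i x sf sg.
Qed.

(** The convolution of a constant is constant, so its derivative, which is the
    integral of the derivative of the kernel, vanishes. *)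
Lemma integral_partial i f rho : test_fun rho f -> \int[mu]_x partial i f x = 0.
Proof.
move=> tf; have l1 : loc_integrable (fun _ : Rn => 1 : R).
  by apply: (@bounded_loc_integrable _ _ _ 1) => // x; rewrite normr1.
have H := is_derive_convol i 0 l1 tf.
have C : convol (fun=> 1) f = cst (\int[mu]_x f x).
  by apply/funext => x; rewrite (convol_cst 1 x tf) mul1r.
have := @derive_val _ _ _ _ _ _ _ H; rewrite C derive_cst.
by rewrite (convol_cst 1 0 (@test_wderiv _ _ [:: i] _ _ tf)) mul1r => /eqP; rewrite eq_sym oppr_eq0 => /eqP.
Qed.

Lemma test_mul f g rho : smooth f -> test_fun rho g ->
  test_fun rho (fun x => f x * g x).
Proof.
move=> sf [sg g0]; split; first exact: smooth_mul.
by move=> x xr; rewrite g0// mulr0.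
Qed.

Lemma smooth_loc_integrable f : smooth f -> loc_integrable f.
Proof.
move=> /smooth_continuous cf; split; first exact: continuous_measurable.
move=> K cK; apply: measurable_bounded_integrable.
- exact: measurable_compact.
- exact: leb_compact_lty.
- exact/measurable_funTS/continuous_measurable.
- have /compact_bounded[M [Mr hM]] : compact (f @` K).
    by apply: continuous_compact => //; exact: continuous_subspaceT.
  by exists M; split => // M' MM' x Kx; apply: hM MM' _ _; exists x.
Qed.

Lemma integrable_mul_test u f rho : loc_integrable u -> test_fun rho f ->
  mu.-integrable [set: Rn] (fun x => (u x * f x)%:E).
Proof.
move=> lu tf; have := convol_integrable 0 lu tf.
by congr (integrable _ _ _); apply/funext => x; rewrite subr0.
Qed.

Lemma integral_by_parts i f eta rho : smooth f -> test_fun rho eta ->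
  \int[mu]_x (f x * partial i eta x) = - \int[mu]_x (partial i f x * eta x).
Proof.
move=> sf te; have tpe := @test_wderiv _ _ [:: i] _ _ te.
apply/eqP; rewrite -addr_eq0 -RintegralD//; last 2 first.
- exact: (integrable_mul_test (smooth_loc_integrable sf) tpe).
- exact: (integrable_mul_test (smooth_loc_integrable (smooth_partial i sf)) te).
rewrite -(integral_partial i (test_mul sf te)); apply/eqP; apply: eq_Rintegral => x _.
exact/esym/(@derive_val _ _ _ _ _ _ _ (is_derive_mul i x sf te.1)).
Qed.

Lemma integral_wderiv s f eta rho : smooth f -> test_fun rho eta ->
  \int[mu]_x (f x * wderiv s eta x) =
  (-1) ^+ size s * \int[mu]_x (wderiv (rev s) f x * eta x).
Proof.
elim: s f => [|i s IH] f sf te; first by rewrite mul1r.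
rewrite /= -/(wderiv s eta) (integral_by_parts i sf (test_wderiv s te)).
rewrite (IH _ (smooth_partial i sf) te) rev_cons -cats1 wderiv_cat.
by rewrite exprS mulN1r mulNr.
Qed.

(** Integration by parts removes the derivatives from the test function one at a
    time and thereby reverses the word. *)
Lemma weak_derivative_smooth a f : smooth f ->
  weak_derivative a f (wderiv (rev (word a)) f).
Proof.
move=> sf; split; [exact: smooth_loc_integrable| |].
  exact/smooth_loc_integrable/smooth_wderiv.
move=> eta /Cc_infty_test[rho _ te]; rewrite pderivE -size_word.
exact: integral_wderiv te.
Qed.

Lemma loc_integrableB u v : loc_integrable u -> loc_integrable v ->
  loc_integrable (fun x => u x - v x).
Proof.
move=> [mu_ iu] [mv iv]; split; first exact: measurable_funB.
move=> K cK; have := integrableB (measurable_compact cK) (iu K cK) (iv K cK).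
by congr (integrable _ _ _).
Qed.

Lemma loc_integrableZ (c : R) u : loc_integrable u -> loc_integrable (fun x => c * u x).
Proof.
move=> [mu_ iu]; split; first exact: measurable_funM (measurable_cst c) mu_.
by move=> K cK; apply: (integrableZl _ c (iu K cK)); exact: measurable_compact.
Qed.

Lemma loc_integrableD u v : loc_integrable u -> loc_integrable v ->
  loc_integrable (fun x => u x + v x).
Proof.
move=> lu lv; rewrite (_ : (fun x => _) = (fun x => u x - (-1) * v x)).
  exact/loc_integrableB/loc_integrableZ.
by apply/funext => x; rewrite mulN1r opprK.
Qed.

Lemma weak_derivativeB a u v u' v' : weak_derivative a u v ->
  weak_derivative a u' v' ->
  weak_derivative a (fun x => u x - u' x) (fun x => v x - v' x).
Proof.
move=> [lu lv uv] [lu' lv' uv']; split; [exact: loc_integrableB..|].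
move=> eta Ce; have [rho _ te] := Cc_infty_test Ce; rewrite pderivE.
have tpe := test_wderiv (word a) te.
under eq_Rintegral do rewrite mulrBl.
rewrite RintegralB//; [|exact: (integrable_mul_test lu tpe)|exact: (integrable_mul_test lu' tpe)].
under [in RHS]eq_Rintegral do rewrite mulrBl.
rewrite RintegralB//; [|exact: (integrable_mul_test lv te)|exact: (integrable_mul_test lv' te)].
by rewrite mulrBr -uv// -uv'// pderivE.
Qed.

(** The derivatives of the convolution fall on the translate of the mollifier,
    which is a test function; that the order of its derivatives is irrelevant
    matches the word [s] with the canonical order of the weak derivative. *)
Lemma wderiv_convol_mollifier a u v m s : 0 < m -> weak_derivative a u v ->
  (forall i, count_mem i s = a i) ->
  wderiv s (convol u (mollifier m)) = convol v (mollifier m).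
Proof.
move=> m0 [lu lv uv] sa; have tm := @test_mollifier R n m m0.
have ss : size s = morder a by rewrite size_count; apply: eq_bigr => i _; rewrite sa.
rewrite (wderiv_convol s lu tm) ss; apply/funext => x.
have sm : smooth (fun y => mollifier m (y - x)) by apply: smooth_translate; exact: tm.1.
have Cm : Cc_infty (fun y => mollifier m (y - x)).
  apply: (@test_Cc_infty _ _ _ (m^-1 + `|x|)); split => // y hy; apply: tm.2.
  by rewrite -ltrBDr in hy; apply: lt_le_trans hy _; exact: lerB_dist.
rewrite /convol; have := uv _ Cm; rewrite pderivE.
under eq_Rintegral do rewrite wderiv_translate.
rewrite (@wderiv_mollifier_count _ _ _ (word a) s); last by move=> i; rewrite sa count_word.
by move=> ->; rewrite mulrA -exprMn mulrNN mulr1 expr1n mul1r.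
Qed.

End WeakDerivatives.

Section Uniqueness.
Context (R : realType) (n : nat).
Local Notation Rn := 'rV[R]_n.
Local Notation mu := (@leb R n).
Implicit Types (u v f g : Rn -> R) (a : 'I_n -> nat).

Lemma convol_locally_constant u m (x : Rn) : 0 < m ->
  (forall y, `|y - x| <= m^-1 -> u y = u x) -> convol u (mollifier m) x = u x.
Proof.
move=> m0 ux; have tm := @test_mollifier R n m m0.
rewrite (@eq_convol _ _ u (fun=> u x) _ _ x tm); last by move=> y; exact: ux.
by rewrite (convol_cst _ _ tm) mollifier_integral// mulr1.
Qed.

Lemma indic_loc_integrable (U : set Rn) : measurable U -> loc_integrable (\1_U : Rn -> R).
Proof.
move=> mU; apply: (@bounded_loc_integrable _ _ _ 1) => [|x].
  exact: measurable_indic.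
by rewrite indicE normr_nat lern1 leq_b1.
Qed.

Lemma convol_mollifier_le g (m : R) (x : Rn) (B : set Rn) : loc_integrable g ->
  0 < m -> measurable B -> cube x m^-1 `<=` B ->
  (`|convol g (mollifier m) x|%:E <=
   ((expR 4 * m) ^+ n)%:E * \int[mu]_(y in B) `|g y|%:E)%E.
Proof.
move=> lg m0 mB xB; have tm := @test_mollifier R n m m0.
have ci := convol_integrable x lg tm.
have mgE : measurable_fun setT (fun y => `|g y|%:E).
  by apply/measurable_EFinP; apply: measurableT_comp => //; exact: lg.1.
have E0 : 0 <= (expR 4 * m) ^+ n by rewrite exprn_ge0// mulr_ge0 ?expR_ge0 ?ltW.
rewrite /convol (EFin_normr_Rintegral measurableT ci).
have mci := measurable_int mu ci.
apply: le_trans (le_abse_integral mu measurableT mci) _.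
rewrite -(ge0_integralZl_EFin mu mB _ (measurable_funTS mgE) E0); last first.
  by move=> y _; rewrite lee_fin.
rewrite [leRHS]integral_mkcond.
apply: (@ge0_le_integral _ _ _ _ setT measurableT).
- by move=> y _; exact: abse_ge0.
- exact: measurableT_comp mci.
- apply: (measurable_restrictT _ mB).1; apply: measurable_funTS.
  exact: measurable_funeM.
move=> y _; rewrite patchE abse_EFin; have [yB|yB] := boolP (y \in B).
  rewrite -EFinM lee_fin normrM mulrC ler_wpM2r//.
  by rewrite ger0_norm ?mollifier_ge0// mollifier_le.
rewrite (tm.2 (y - x)) ?mulr0 ?normr0//.
rewrite ltNge; apply: contra yB => yx; rewrite inE; apply: xB.
by rewrite /cube /=.
Qed.

Lemma convol_indic_cvg (U : set Rn) (x : Rn) (r : R) : 0 < r ->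
  (forall y : Rn, `|y - x| <= r -> \1_U y = \1_U x :> R) ->
  convol (\1_U) (mollifier k.+1%:R) x @[k --> \oo] --> (\1_U x : R).
Proof.
move=> r0 hr; apply: cvg_near_cst; near=> k.
apply: convol_locally_constant => // y yx; apply: hr; apply: le_trans yx _.
by apply: ltW; near: k; exact: (near_infty_natSinv_lt (PosNum r0)).
Unshelve. all: by end_near. Qed.

Lemma convol_indic_le1 (U : set Rn) m (x : Rn) : 0 < m -> measurable U ->
  `|convol (\1_U) (mollifier m) x| <= 1.
Proof.
move=> m0 mU; have tm := @test_mollifier R n m m0.
have := @convol_le _ _ (\1_U) (mollifier m) m^-1 x 1 (indic_loc_integrable mU) tm.
rewrite mollifier_integral// mulr1; apply => // y; last exact: mollifier_ge0.
by move=> _; rewrite indicE normr_nat lern1 leq_b1.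
Qed.

Lemma test_convol_indic (U : set Rn) N m : 1 <= m -> measurable U ->
  U `<=` cube 0 N -> test_fun (N + 1) (convol (\1_U) (mollifier m)).
Proof.
move=> m1 mU UN; have m0 : 0 < m by apply: lt_le_trans m1.
have tm := @test_mollifier R n m m0; split.
  exact: (smooth_convol (indic_loc_integrable mU) tm).
move=> x xN; rewrite (@eq_convol _ _ _ (fun=> 0) _ _ x tm) ?(convol_cst 0 x tm) ?mul0r//.
move=> y yx; rewrite indicE memNset// => /UN; rewrite /cube /= subr0 => yN.
have : `|x| <= `|y| + `|y - x|.
  by rewrite -[X in `|X| <= _](subKr y x) (le_trans (ler_normB _ _)).
have := le_trans yx (_ : m^-1 <= 1); rewrite invf_le1// => /(_ m1).
by move=> h1 h2; lra.
Qed.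

Lemma Rintegral_indic (E : set Rn) f : measurable E ->
  \int[mu]_(x in E) f x = \int[mu]_x (f x * \1_E x).
Proof.
move=> mE; rewrite /Rintegral integral_mkcond; congr fine; apply: eq_integral => x _.
by rewrite patchE indicE; case: ifPn; rewrite ?mulr1 ?mulr0.
Qed.

(** Absolute continuity of the integral of a locally integrable function. *)
Lemma loc_integrable_small v (N e : R) : loc_integrable v -> 0 < e ->
  exists2 d : R, 0 < d &
  forall B, measurable B -> B `<=` cube 0 N -> (mu B < d%:E)%E ->
  (\int[mu]_(x in B) `|v x|%:E <= e%:E)%E.
Proof.
move=> lv e0; have mC : measurable (cube (0 : Rn) N) by exact: measurable_cube.
have iw : mu.-integrable setT (EFin \o (v \_ (cube 0 N))).
  by rewrite -restrict_EFin; apply/(integrable_mkcond _ mC); exact: loc_integrable_cube.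
have [d [d0 hd]] := integral_normr_continuous iw e0.
exists d => // B mB BC Bd.
have iB : mu.-integrable B (EFin \o (fun x => `|(v \_ (cube 0 N)) x|)).
  by apply: (integrableS measurableT mB) => //; exact: integrable_abse iw.
have -> : (\int[mu]_(x in B) `|v x|%:E = \int[mu]_(x in B) `|(v \_ (cube 0 N)) x|%:E)%E.
  by apply: eq_integral => x /set_mem/BC xC; rewrite patchE mem_set.
by rewrite -(fineK (integrable_fin_num mB iB)) lee_fin; apply: ltW; exact: hd.
Qed.

(** Approximating a bounded measurable set by a finite union of boxes makes the
    symmetric difference so small that the integral over it is small too. *)
Lemma approx_box_union_integral v (E : set Rn) (M e : R) : loc_integrable v ->
  measurable E -> E `<=` cube 0 M -> 0 < e ->
  exists F m, box_union F m `<=` cube 0 (`|M| + 1) /\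
  (\int[mu]_(x in (E `\` box_union F m) `|` (box_union F m `\` E)) `|v x|%:E <= e%:E)%E.
Proof.
move=> lv mE EM e0; have [d d0 hd] := loc_integrable_small (`|M| + 1) lv e0.
pose B : Rn * Rn := (\row_i ((0 : Rn) 0 i - (`|M| + 1)), \row_i ((0 : Rn) 0 i + (`|M| + 1))).
have EB : E `<=` box B.
  apply: (subset_trans EM); apply: cube_sub_box.
  by rewrite (le_lt_trans (ler_norm M))// ltrDl.
have BM : box B `<=` cube 0 (`|M| + 1) by apply: box_sub_cube; rewrite addr_ge0.
have d2 : 0 < d / 2 by rewrite divr_gt0.
have [F [m [UB EU UE]]] := approx_box_union mE EB d2.
have mU := measurable_box_union F m.
exists F, m; split; first exact: subset_trans UB BM.
apply: hd.
- by apply: measurableU; exact: measurableD.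
- by move=> x [[Ex _]|[Ux _]]; apply: BM; [exact: EB|exact: UB].
- apply: (@le_lt_trans _ _ (mu (E `\` box_union F m) + mu (box_union F m `\` E))%E).
    exact: measureU2 (measurableD mE mU) (measurableD mU mE).
  by rewrite (splitr d) EFinD lteD.
Qed.

(** A locally integrable function that is orthogonal to all test functions has
    zero integral over finite unions of boxes, whose indicators are limits of
    test functions, and then over all bounded measurable sets. *)
Lemma ae_eq0_test v : loc_integrable v ->
  (forall rho eta, test_fun rho eta -> \int[mu]_x (v x * eta x) = 0) ->
  \forall x \ae mu, v x = 0.
Proof.
move=> lv v0.
have mv := lv.1.
have int_box_union F m N : box_union F m `<=` cube 0 N ->
    \int[mu]_x (v x * \1_(box_union F m) x) = 0.
  set U := box_union F m => UN; have mU : measurable U := measurable_box_union F m.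
  have lim : \int[mu]_x (v x * convol (\1_U) (mollifier k.+1%:R) x) @[k --> \oo] -->
      \int[mu]_x (v x * \1_U x).
    apply: (@dominated_Rcvg _ _ _ mu _ _ (fun x => `|v x| * \1_(cube 0 (N + 1)) x)).
    - move=> k; apply: (measurable_funM mv); apply: (test_measurable (rho := N + 1)).
      by apply: (test_convol_indic _ mU UN); rewrite ler1n.
    - by apply: measurable_funM => //; exact: measurable_indic.
    - apply: filterS (@box_union_locally_constant R n F m) => x [r r0 hr].
      apply: (@cvgM _ _ \oo); first exact: cvg_cst.
      exact: (convol_indic_cvg r0 hr).
    - have mC := measurable_cube (0 : Rn) (N + 1).
      apply: (@integrable_loc_mul _ _ (fun x => `|v x|) (\1_(cube 0 (N + 1))) 0 (N + 1) 1).
      + split; first exact: measurableT_comp.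
        by move=> K cK; exact: integrable_norm (lv.2 K cK).
      + exact: measurable_indic.
      + by move=> x; rewrite indicE normr_nat lern1 leq_b1.
      + by move=> x nx; rewrite indicE memNset.
    - move=> k; apply: aeW => x; rewrite normrM ler_wpM2l// indicE.
      case: (boolP (x \in _)) => [_|]; first by apply: convol_indic_le1.
      rewrite notin_setE /cube /= subr0 => /negP; rewrite -ltNge => xN.
      by rewrite (@test_convol_indic U N _ _ mU UN).2 ?normr0// ler1n.
  have E0 : (fun k => \int[mu]_x (v x * convol (\1_U) (mollifier k.+1%:R) x)) = cst 0.
    apply/funext => k; apply: (@v0 (N + 1)).
    by apply: test_convol_indic => //; rewrite ler1n.
  rewrite E0 in lim; have <- := cvg_lim (@Rhausdorff R) lim.
  by rewrite lim_cst.
have key (N : nat) : ae_eq mu (cube 0 N%:R) (EFin \o v) (cst 0%E).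
  apply: integral_ae_eq => //; first exact: measurable_cube.
    exact: loc_integrable_cube.
  move=> E EN mE; rewrite integral0.
  have intE : mu.-integrable E (EFin \o v).
    by apply: integrableS (loc_integrable_cube 0 N%:R lv) => //; exact: measurable_cube.
  rewrite -(fineK (integrable_fin_num mE intE)) -/(Rintegral mu E v); congr EFin.
  have iA (A : set Rn) : measurable A -> A `<=` cube 0 (`|N%:R| + 1) ->
      mu.-integrable setT (fun x => (v x * \1_A x)%:E).
    move=> mA AC; apply: (@integrable_loc_mul _ _ v (\1_A) 0 (`|N%:R| + 1) 1) => //.
    + by move=> x; rewrite indicE normr_nat lern1 leq_b1.
    + by move=> x nx; rewrite indicE memNset// => /AC.
  have EC : E `<=` cube 0 (`|N%:R| + 1).
    by move=> x /EN xN; rewrite /cube /= (le_trans xN)// normr_nat lerDl.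
  rewrite Rintegral_indic//.
  apply/eqP; rewrite -normr_le0; apply/ler_addgt0Pr => e e0; rewrite add0r.
  have [F [m [UC hS]]] := approx_box_union_integral lv mE EN e0.
  have mU := measurable_box_union F m; set U := box_union F m in UC hS mU.
  have mS : measurable ((E `\` U) `|` (U `\` E)) by apply: measurableU; exact: measurableD.
  have iEU := integrableB measurableT (iA _ mE EC) (iA _ mU UC).
  rewrite -[X in `|X|]subr0 -(int_box_union F m _ UC) -RintegralB//; [|exact: iA..].
  apply: le_trans (le_normr_Rintegral measurableT iEU) _.
  rewrite -lee_fin (le_trans _ hS)// /Rintegral (_ : (\int[mu]_x _)%E =
    (\int[mu]_(x in (E `\` U) `|` (U `\` E)) `|v x|%:E)%E).
    rewrite fineK// ge0_fin_numE; first exact: le_lt_trans hS (ltry _).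
    by apply: integral_ge0 => x _; rewrite lee_fin.
  rewrite [RHS]integral_mkcond; apply: eq_integral => x _.
  rewrite patchE in_setU !in_setD !indicE.
  by case: (x \in E); case: (x \in U); rewrite /= ?mulr1 ?mulr0 ?subrr ?subr0 ?sub0r ?normrN ?normr0.
have : \forall x \ae mu, forall N : nat, cube 0 N%:R x -> (v x)%:E = 0%E.
  by apply: ae_foralln => N; exact: key.
apply: filterS => x xN.
have : [set: Rn] x by []. rewrite -bigcup_cube => -[N _ /xN].
by case.
Qed.

Lemma weak_derivative_unique a u v v' :
  weak_derivative a u v -> weak_derivative a u v' -> \forall x \ae mu, v x = v' x.
Proof.
move=> [lu lv uv] [_ lv' uv'].
have : \forall x \ae mu, v x - v' x = 0.
  apply: (ae_eq0_test (loc_integrableB lv lv')) => rho eta te.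
  under eq_Rintegral do rewrite mulrBl.
  rewrite RintegralB//; [|exact: (integrable_mul_test lv te)|exact: (integrable_mul_test lv' te)].
  have := uv eta (test_Cc_infty te); rewrite (uv' eta (test_Cc_infty te)).
  move=> /(congr1 ( *%R ((-1) ^+ morder a))).
  by rewrite !mulrA -exprMn mulrNN mulr1 expr1n !mul1r => ->; rewrite subrr.
by apply: filterS => x /eqP; rewrite subr_eq0 => /eqP.
Qed.

Lemma weak_derivative_weakD a u v : weak_derivative a u v -> weak_derivative a u (weakD a u).
Proof. by move=> uv; apply: (xgetPex (cst 0)); exists v. Qed.

Lemma weakD_ae a u v : weak_derivative a u v -> \forall x \ae mu, weakD a u x = v x.
Proof. by move=> uv; apply: (weak_derivative_unique (weak_derivative_weakD uv) uv). Qed.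

End Uniqueness.

(** * Modulars of doubling functions *)

(** The properties of [phi] on which the limiting arguments rest. These are carried
    out on the modular; doubling makes convergence in modular imply convergence in
    the Luxemburg norm. *)
Record doubling_Phi (R : realType) (n : nat) (Phi : 'rV[R]_n -> R -> \bar R) : Prop :=
  DoublingPhi {
  dPhi_meas : forall f : 'rV[R]_n -> R, measurable_fun [set: 'rV[R]_n] f ->
    measurable_fun [set: 'rV[R]_n] (fun x => Phi x `|f x|) ;
  dPhi_ge0 : forall x (t : R), 0 <= t -> (0 <= Phi x t)%E ;
  dPhi_incr : \forall x \ae @leb R n, forall s t : R, 0 <= s -> s <= t ->
    (Phi x s <= Phi x t)%E ;
  dPhi_at0 : \forall x \ae @leb R n, Phi x 0 = 0%E ;
  dPhi_aInc : exists2 L : R, 1 <= L & \forall x \ae @leb R n, forall s t : R,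
    0 < s -> s <= t -> (Phi x s <= (L * (s / t))%:E * Phi x t)%E ;
  dPhi_dbl : forall l : R, 1 <= l -> exists2 D : R, 1 <= D &
    \forall x \ae @leb R n, forall t : R, 0 <= t -> (Phi x (l * t)%R <= D%:E * Phi x t)%E ;
  dPhi_bdd : forall T : R, 0 <= T -> exists2 K : R, 0 <= K &
    \forall x \ae @leb R n, (Phi x T <= K%:E)%E }.

Lemma cvge0_le (R : realType) (u : nat -> \bar R) (eta : R) :
  u k @[k --> \oo] --> 0%E -> 0 < eta ->
  exists m0 : nat, forall k, (m0 <= k)%N -> (u k <= eta%:E)%E.
Proof.
move=> u0 eta0.
have [m0 _ h] : \forall k \near \oo, (u k <= eta%:E)%E.
  apply: (u0 [set y | (y <= eta%:E)%E]).
  have : \forall r \near (0 : R), r <= eta by exact: (@cvgr_le _ _ (nbhs (0 : R)) _ id 0 cvg_id eta eta0).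
  by apply: filterS => r; rewrite /= lee_fin.
by exists m0 => k; exact: h.
Qed.

Section Modular.
Context (R : realType) (n : nat).
Local Notation Rn := 'rV[R]_n.
Local Notation mu := (@leb R n).
Variables (Phi : Rn -> R -> \bar R) (w : Rn -> R).
Hypotheses (dP : doubling_Phi Phi) (hw : is_weight w).
Implicit Types f g : Rn -> R.

(** The absolute value of the weight agrees with the weight almost everywhere and
    makes the integrand nonnegative everywhere. *)
Definition phiw f (x : Rn) : \bar R := (Phi x `|f x|%R * `|w x|%:E)%E.

Definition modular f : \bar R := (\int[mu]_x phiw f x)%E.

Let mw : measurable_fun [set: Rn] w := hw.1.1.

Lemma measurable_phiw f : measurable_fun [set: Rn] f ->
  measurable_fun [set: Rn] (phiw f).
Proof.
move=> mf; apply: emeasurable_funM; first exact: dPhi_meas.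
by apply/measurable_EFinP; exact: measurableT_comp.
Qed.

Lemma phiw_ge0 f x : (0 <= phiw f x)%E.
Proof. by rewrite mule_ge0 ?lee_fin// dPhi_ge0. Qed.

Lemma modular_ge0 f : (0 <= modular f)%E.
Proof. by apply: integral_ge0 => x _; exact: phiw_ge0. Qed.

Lemma modularE f : measurable_fun [set: Rn] f ->
  (\int[mu]_x (Phi x `|f x|%R * (w x)%:E) = modular f)%E.
Proof.
move=> mf; apply: (ae_eq_integral _ _ measurableT).
- apply: emeasurable_funM; first exact: dPhi_meas.
  exact/measurable_EFinP.
- exact: measurable_phiw.
- by rewrite /phiw; apply: filterS hw.2 => x wx _; rewrite (gtr0_norm wx).
Qed.

Lemma modular_le (c : R) f g : measurable_fun [set: Rn] f ->
  measurable_fun [set: Rn] g -> 0 <= c ->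
  (\forall x \ae mu, (Phi x `|f x|%R <= c%:E * Phi x `|g x|%R)%E) ->
  (modular f <= c%:E * modular g)%E.
Proof.
move=> mf mg c0 fg; have mfw := measurable_phiw mf; have mgw := measurable_phiw mg.
rewrite /modular -(ge0_integralZl_EFin mu measurableT (fun x _ => phiw_ge0 g x) mgw c0).
apply: (ae_ge0_le_integral measurableT (fun x _ => phiw_ge0 f x) mfw).
- by move=> x _; rewrite mule_ge0 ?phiw_ge0.
- exact: measurable_funeM.
- by apply: filterS fg => x fgx _; rewrite /phiw muleA lee_wpmul2r// lee_fin.
Qed.

Lemma modular_mono f g : measurable_fun [set: Rn] f ->
  measurable_fun [set: Rn] g -> (\forall x \ae mu, `|f x| <= `|g x|) ->
  (modular f <= modular g)%E.
Proof.
move=> mf mg fg; rewrite -[leRHS]mul1e; apply: (modular_le mf mg ler01).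
near=> x; rewrite mul1e.
have : forall s t : R, 0 <= s -> s <= t -> (Phi x s <= Phi x t)%E.
  by near: x; exact: dPhi_incr dP.
by apply => //; near: x.
Unshelve. all: by end_near. Qed.

Lemma modular_ae f g : measurable_fun [set: Rn] f ->
  measurable_fun [set: Rn] g -> (\forall x \ae mu, f x = g x) ->
  modular f = modular g.
Proof.
move=> mf mg fg; apply/eqP; rewrite eq_le; apply/andP; split.
  by apply: (modular_mono mf mg); apply: filterS fg => x ->.
by apply: (modular_mono mg mf); apply: filterS fg => x ->.
Qed.

Lemma modular_dilate (l : R) : 1 <= l -> exists2 D : R, 1 <= D &
  forall f, measurable_fun [set: Rn] f ->
  (modular (fun x => (l * f x)%R) <= D%:E * modular f)%E.
Proof.
move=> l1; have [D D1 hD] := dPhi_dbl dP l1; exists D => // f mf.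
have l0 : 0 <= l by apply: le_trans l1.
have mlf : measurable_fun setT (fun x => l * f x) by exact: measurable_funM.
apply: (modular_le mlf mf (le_trans ler01 D1)).
by apply: filterS hD => x hx; rewrite normrM (ger0_norm l0); exact: hx.
Qed.

Lemma modular_shrink : exists2 L : R, 1 <= L & forall (K : R) f, 1 <= K ->
  measurable_fun [set: Rn] f ->
  (modular (fun x => (K^-1 * f x)%R) <= (L / K)%:E * modular f)%E.
Proof.
have [L L1 hL] := dPhi_aInc dP; exists L => // K f K1 mf.
have K0 : 0 < K by apply: lt_le_trans K1.
have LK : 0 <= L / K by rewrite divr_ge0 ?(le_trans _ L1) ?ltW.
have mKf : measurable_fun setT (fun x => K^-1 * f x) by exact: measurable_funM.
apply: (modular_le mKf mf LK).
near=> x.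
have [->|fx0] := eqVneq (f x) 0.
  rewrite mulr0 normr0 (_ : Phi x 0 = 0%E) ?mule0//; near: x; exact: dPhi_at0 dP.
have fx : 0 < `|f x| by rewrite normr_gt0.
have hx : forall s t : R, 0 < s -> s <= t -> (Phi x s <= (L * (s / t))%:E * Phi x t)%E by near: x.
have Kf : 0 < `|K^-1 * f x| by rewrite normr_gt0 mulf_neq0// invr_neq0// gt_eqF.
have := hx _ _ Kf (_ : _ <= `|f x|); rewrite normrM (ger0_norm (_ : 0 <= K^-1)) ?invr_ge0 ?(ltW K0)//.
rewrite mulfK ?gt_eqF//; apply.
by rewrite ler_piMl// invf_le1.
Unshelve. all: by end_near. Qed.

Lemma modularD : exists2 D : R, 1 <= D & forall f g,
  measurable_fun [set: Rn] f -> measurable_fun [set: Rn] g ->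
  (modular (fun x => (f x + g x)%R) <= D%:E * (modular f + modular g))%E.
Proof.
have [D D1 hD] := dPhi_dbl dP (ler1n R 2); exists D => // f g mf mg.
have D0 : 0 <= D by apply: le_trans D1.
have mfw := measurable_phiw mf; have mgw := measurable_phiw mg.
have s0 x : (0 <= phiw f x + phiw g x)%E by rewrite adde_ge0// phiw_ge0.
rewrite /modular -(ge0_integralD mu measurableT (fun x _ => phiw_ge0 f x) mfw (fun x _ => phiw_ge0 g x) mgw).
have msw := emeasurable_funD mfw mgw.
rewrite -(ge0_integralZl_EFin mu measurableT (fun x _ => s0 x) msw D0).
apply: (ae_ge0_le_integral measurableT (fun x _ => phiw_ge0 _ x)).
- by apply: measurable_phiw; exact: measurable_funD.
- by move=> x _; rewrite mule_ge0 ?lee_fin.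
- exact: measurable_funeM.
near=> x => _; rewrite /phiw.
have inc : forall s t : R, 0 <= s -> s <= t -> (Phi x s <= Phi x t)%E.
  by near: x; exact: dPhi_incr dP.
have dbl : forall t : R, 0 <= t -> (Phi x (2 * t)%R <= D%:E * Phi x t)%E by near: x.
rewrite -ge0_muleDl ?dPhi_ge0// muleA lee_wpmul2r ?lee_fin//.
have fg : `|f x + g x| <= 2 * Num.max `|f x| `|g x|.
  apply: le_trans (ler_normD _ _) _; rewrite mulrDl mul1r lerD//.
    by rewrite le_max lexx.
  by rewrite le_max lexx orbT.
apply: le_trans (inc _ _ (normr_ge0 _) fg) _.
apply: le_trans (dbl _ _) _; first by rewrite le_max normr_ge0.
rewrite lee_wpmul2l ?lee_fin// /Num.max; case: ifPn => _.
  by rewrite leeDr// dPhi_ge0.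
by rewrite leeDl// dPhi_ge0.
Unshelve. all: by end_near. Qed.

(** Dominated convergence. Below 1 the values of [Phi] are at most linear in the
    argument, so pointwise convergence to 0 passes to the integrands. *)
Lemma modular_cvg0 (f_ : nat -> Rn -> R) g :
  (forall k, measurable_fun [set: Rn] (f_ k)) -> measurable_fun [set: Rn] g ->
  (modular g < +oo)%E ->
  (\forall x \ae mu, f_ k x @[k --> \oo] --> 0) ->
  (forall k, \forall x \ae mu, `|f_ k x| <= `|g x|) ->
  modular (f_ k) @[k --> \oo] --> 0%E.
Proof.
move=> mf mg goo f0 fg.
have [L L1 hL] := dPhi_aInc dP.
have [K K0 hK] := dPhi_bdd dP ler01.
have lim0 : \forall x \ae mu, setT x -> phiw (f_ k) x @[k --> \oo] --> cst 0%E x.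
  near=> x => _; rewrite /phiw /=.
  have at0 : Phi x 0 = 0%E by near: x; exact: dPhi_at0 dP.
  have fx : f_ k x @[k --> \oo] --> 0 by near: x.
  have hx : forall s t : R, 0 < s -> s <= t -> (Phi x s <= (L * (s / t))%:E * Phi x t)%E by near: x.
  have Kx : (Phi x 1 <= K%:E)%E by near: x.
  have bound k : `|f_ k x| <= 1 ->
      (Phi x `|f_ k x|%R * `|w x|%:E <= (L * K * `|w x| * `|f_ k x|)%:E)%E.
    move=> f1; have [->|fn0] := eqVneq (f_ k x) 0; first by rewrite normr0 at0 mul0e mulr0.
    have h : (Phi x `|f_ k x|%R <= (L * (`|f_ k x| / 1))%:E * Phi x 1)%E.
      by apply: hx => //; rewrite normr_gt0.
    have c0 : (0 <= (L * (`|f_ k x| / 1))%:E)%E.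
      by rewrite lee_fin mulr_ge0 ?divr_ge0// (le_trans _ L1).
    have w0 : (0 <= `|w x|%:E)%E by rewrite lee_fin.
    apply: le_trans (lee_wpmul2r w0 (le_trans h (lee_wpmul2l c0 Kx))) _.
    rewrite divr1 -!EFinM lee_fin.
    by rewrite [leLHS](_ : _ = L * K * `|w x| * `|f_ k x|)//; ring.
  apply: (@squeeze_cvge _ _ _ _ (cst 0%E) _ (fun k => (L * K * `|w x| * `|f_ k x|)%:E)).
  + near=> k; rewrite /= -/(phiw (f_ k) x) phiw_ge0/=; apply: bound; near: k.
    apply: filterS ((@cvgrPdist_le _ _ _ (nbhs \oo) _ (fun k => f_ k x) 0).1 fx 1 ltr01) => k.
    by rewrite sub0r normrN.
  + exact: cvg_cst.
  + apply: cvg_EFin; first exact: nearW.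
    rewrite -(mulr0 (L * K * `|w x|)); apply: (@cvgM _ _ \oo); first exact: cvg_cst.
    rewrite -[X in _ --> X](@normr0 _ R).
    exact: (cvg_norm fx).
have intg : mu.-integrable setT (phiw g).
  apply/integrableP; split; first exact: measurable_phiw.
  by under eq_integral => x _ do rewrite gee0_abs ?phiw_ge0//.
have dom : \forall x \ae mu, forall k, setT x -> (`|phiw (f_ k) x| <= phiw g x)%E.
  near=> x => k _; rewrite gee0_abs ?phiw_ge0// /phiw lee_wpmul2r ?lee_fin//.
  have inc : forall s t : R, 0 <= s -> s <= t -> (Phi x s <= Phi x t)%E.
    by near: x; exact: dPhi_incr dP.
  by apply: inc => //; move: k; near: x; exact: ae_foralln.
have [_ _] := dominated_convergence measurableT (fun k => measurable_phiw (mf k))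
  (measurable_cst _) lim0 intg dom.
by rewrite integral0; apply.
Unshelve. all: by end_near. Qed.

(** Indicators, test functions and errors supported in a small set are all measured
    by the weight of a set, because [Phi] is bounded at the fixed argument [T]. *)
Lemma modular_indic (T : R) : 0 <= T -> exists2 K : R, 0 <= K &
  forall (A : set Rn) f, measurable A -> measurable_fun [set: Rn] f ->
  (forall x, `|f x| <= T * \1_A x) ->
  (modular f <= K%:E * \int[mu]_(x in A) `|w x|%:E)%E.
Proof.
move=> T0; have [K K0 hK] := dPhi_bdd dP T0; exists K => // A f mA mf fA.
have mwE : measurable_fun [set: Rn] (fun x => `|w x|%:E).
  by apply/measurable_EFinP; exact: measurableT_comp.
have w0 x : (0 <= `|w x|%:E)%E by rewrite lee_fin.
rewrite -(ge0_integralZl_EFin mu mA (fun x _ => w0 x) (measurable_funTS mwE) K0).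
rewrite [leRHS]integral_mkcond.
apply: (ae_ge0_le_integral measurableT (fun x _ => phiw_ge0 f x) (measurable_phiw mf)).
- by move=> x _; rewrite patchE; case: ifP => // _; rewrite mule_ge0 ?lee_fin.
- apply: (measurable_restrictT _ mA).1; apply: measurable_funTS.
  exact: measurable_funeM.
near=> x => _; rewrite /phiw.
have inc : forall s t : R, 0 <= s -> s <= t -> (Phi x s <= Phi x t)%E.
  by near: x; exact: dPhi_incr dP.
have Kx : (Phi x T <= K%:E)%E by near: x.
have := fA x; rewrite patchE indicE; case: (boolP (x \in A)) => [_|_].
  rewrite mulr1 => fT; rewrite lee_wpmul2r ?lee_fin//.
  exact: le_trans (inc _ _ _ fT) Kx.
rewrite mulr0 normr_le0 => /eqP ->; rewrite normr0.
by rewrite (_ : Phi x 0 = 0%E) ?mul0e//; near: x; exact: dPhi_at0 dP.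
Unshelve. all: by end_near. Qed.

(** Dividing a function by [eps] multiplies its modular by a doubling constant, so
    a small modular forces a small norm. *)
Lemma lux_norm_lt (eps : R) : 0 < eps -> exists2 d : R, 0 < d &
  forall f, measurable_fun [set: Rn] f -> (modular f <= d%:E)%E ->
  (lux_norm Phi w f < eps%:E)%E.
Proof.
move=> e0; pose l := 1 + (eps / 2)^-1.
have e2 : 0 < eps / 2 by rewrite divr_gt0.
have l1 : 1 <= l by rewrite lerDl invr_ge0 ltW.
have [D D1 hD] := modular_dilate l1; have D0 : 0 < D by apply: lt_le_trans D1.
exists D^-1; first by rewrite invr_gt0.
move=> f mf fd; apply: (@le_lt_trans _ _ (eps / 2)%:E); last first.
  by rewrite lte_fin ltr_pdivrMr// mulr_natr mulr2n ltrDl.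
apply: ereal_inf_lbound; exists (eps / 2) => //; split => //.
have E : (fun x => `|f x| / (eps / 2)) = (fun x => `|(eps / 2)^-1 * f x|).
  by apply/funext => x; rewrite normrM (ger0_norm (_ : 0 <= _^-1)) ?invr_ge0 ?(ltW e2)// mulrC.
have mf2 : measurable_fun setT (fun x => (eps / 2)^-1 * f x) by exact: measurable_funM.
under eq_integral => x _ do rewrite (congr1 (@^~ x) E).
rewrite (modularE mf2).
apply: (@le_trans _ _ (modular (fun x => (l * f x)%R))).
  have mlf : measurable_fun setT (fun x => l * f x) by exact: measurable_funM.
  apply: (modular_mono mf2 mlf); apply: aeW => x; rewrite !normrM ler_wpM2r//.
  have l0 : 0 <= l by apply: le_trans l1.
  by rewrite (ger0_norm l0) ger0_norm ?invr_ge0 ?(ltW e2)// /l lerDr.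
apply: le_trans (hD _ mf) _.
apply: le_trans (lee_wpmul2l _ fd) _; first by rewrite lee_fin ltW.
by rewrite -EFinM divff// gt_eqF.
Qed.

Lemma LphiP f : measurable_fun [set: Rn] f ->
  (lux_norm Phi w f < +oo)%E <-> (modular f < +oo)%E.
Proof.
move=> mf.
have norm_scale (l : R) : 0 < l ->
    (\int[mu]_x (Phi x (`|f x| / l)%R * (w x)%:E))%E = modular (fun x => (l^-1 * f x)%R).
  move=> l0; rewrite -modularE; last exact: measurable_funM.
  apply: eq_integral => x _; congr (Phi x _ * _)%E.
  by rewrite normrM mulrC ger0_norm// invr_ge0 ltW.
split.
- move=> /ereal_inf_lt[_ [l [l0 hl] <-] _]; rewrite norm_scale// in hl.
  have l1 : 1 <= 1 + l by rewrite lerDl ltW.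
  have [D D1 hD] := modular_dilate l1.
  have mlf : measurable_fun setT (fun x => l^-1 * f x) by exact: measurable_funM.
  apply: (@le_lt_trans _ _ (D%:E * modular (fun x => (l^-1 * f x)%R))%E).
    apply: le_trans (hD _ mlf); apply: (modular_mono mf); first exact: measurable_funM.
    apply: aeW => x; rewrite mulrA normrM ler_peMl// ger0_norm; last by rewrite divr_ge0 ?ltW// ltr_wpDl.
    by rewrite ler_pdivlMr// mul1r lerDr.
  apply: (@le_lt_trans _ _ (D%:E * 1)%E); last by rewrite mule1 ltry.
  by rewrite lee_wpmul2l// lee_fin (le_trans _ D1).
- move=> foo; have [L L1 hL] := modular_shrink.
  have fin : modular f \is a fin_num by rewrite ge0_fin_numE// modular_ge0.
  have f0 : 0 <= fine (modular f) by rewrite fine_ge0// modular_ge0.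
  have L0 : 0 <= L by apply: le_trans L1.
  pose K := 1 + L * fine (modular f).
  have K1 : 1 <= K by rewrite lerDl mulr_ge0.
  have K0 : 0 < K by apply: lt_le_trans K1.
  apply: (@le_lt_trans _ _ K%:E); last exact: ltry.
  apply: ereal_inf_lbound; exists K => //; split=> //; rewrite norm_scale//.
  apply: le_trans (hL K f K1 mf) _.
  by rewrite -(fineK fin) -EFinM lee_fin mulrAC ler_pdivrMr// mul1r lerDr.
Qed.

Lemma weight_bounded_fin (A : set Rn) (M : R) : measurable A -> A `<=` cube 0 M ->
  (\int[mu]_(x in A) `|w x|%:E < +oo)%E.
Proof.
move=> mA AM.
have iw := loc_integrable_cube 0 M hw.1.
have := integrableS (measurable_cube 0 M) mA AM iw.
by move=> /integrableP[_].
Qed.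

Lemma measurable_sum_seq (I : eqType) (s : seq I) (h : I -> Rn -> R) :
  (forall i, i \in s -> measurable_fun [set: Rn] (h i)) ->
  measurable_fun [set: Rn] (fun x => \sum_(i <- s) h i x).
Proof.
move=> mh.
rewrite (_ : (fun x => _) = (fun x => \sum_(i <- s) (if i \in s then h i x else 0))).
  apply: measurable_sum => i; have [si|_] := boolP (i \in s); first exact: mh.
  exact: measurable_cst.
by apply/funext => x; rewrite [LHS]big_seq [RHS]big_seq; apply: eq_bigr => i ->.
Qed.

Lemma modular_sum_near (I : eqType) (s : seq I)
    (h : I -> nat -> Rn -> R) :
  (forall i r, i \in s -> measurable_fun [set: Rn] (h i r)) ->
  (forall i, i \in s -> forall eta : R, 0 < eta ->
    \forall r \near \oo, (modular (h i r) <= eta%:E)%E) ->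
  forall eta : R, 0 < eta ->
    \forall r \near \oo, (modular (fun x => (\sum_(i <- s) h i r x)%R) <= eta%:E)%E.
Proof.
elim: s => [_ _|i s IH mh hh] eta eta0.
  apply: nearW => r; apply: (@le_trans _ _ 0%E); last by rewrite lee_fin ltW.
  have [K K0 hK] := modular_indic (lexx 0 : 0 <= 0 :> R).
  under eq_fun do rewrite big_nil.
  apply: le_trans (hK set0 _ measurable0 (measurable_cst _) _) _.
    by move=> x; rewrite normr0 mul0r.
  by rewrite integral_set0 mule0.
have [D D1 hD] := modularD; have D0 : 0 < D by apply: lt_le_trans D1.
have e0 : 0 < eta / (2 * D) by rewrite divr_gt0// mulr_gt0.
have ms j r : j \in s -> measurable_fun [set: Rn] (h j r).
  by move=> js; apply: mh; rewrite inE js orbT.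
have hs j : j \in s -> forall eta : R, 0 < eta ->
    \forall r \near \oo, (modular (h j r) <= eta%:E)%E.
  by move=> js; apply: hh; rewrite inE js orbT.
apply: filterS2 (hh i (mem_head i s) _ e0) (IH ms hs _ e0) => r h1 h2.
under eq_fun do rewrite big_cons.
have msum := measurable_sum_seq (fun j => ms j r).
apply: le_trans (hD _ _ (mh i r (mem_head i s)) msum) _.
apply: (@le_trans _ _ (D%:E * ((eta / (2 * D))%:E + (eta / (2 * D))%:E))%E).
  by apply: lee_wpmul2l; [rewrite lee_fin ltW|exact: leeD].
rewrite -EFinD -EFinM lee_fin (_ : D * _ = eta)//.
by field; rewrite gt_eqF.
Qed.

End Modular.

(** * Balls, tilings and cutoffs *)

Section Balls.
Context (R : realType) (n : nat).
Local Notation Rn := 'rV[R]_n.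
Local Notation mu := (@leb R n).

Lemma enorm_ge0 (x : Rn) : 0 <= enorm x.
Proof. exact: sqrtr_ge0. Qed.

Lemma norm_le_enorm (x : Rn) : `|x| <= enorm x.
Proof.
apply/norm_leP => [|i]; first exact: enorm_ge0.
rewrite -sqrtr_sqr ler_wsqrtr// (bigD1 i)//= lerDl.
by apply: sumr_ge0 => j _; exact: sqr_ge0.
Qed.

Lemma enorm_le_norm (x : Rn) : enorm x <= n%:R * `|x|.
Proof.
have n0 : 0 <= n%:R * `|x| by rewrite mulr_ge0.
rewrite -(ger0_norm n0) -sqrtr_sqr ler_wsqrtr//.
apply: (@le_trans _ _ (\sum_(i < n) `|x| ^+ 2)).
  apply: ler_sum => i _; rewrite -(real_normK (num_real (x 0 i))).
  by rewrite ler_pXn2r ?nnegrE// coord_le_norm.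
rewrite sumr_const card_ord exprMn -[leLHS]mulr_natl ler_wpM2r ?exprn_ge0//.
rewrite -natrX ler_nat; case: (n) => // k; exact: leq_pmull.
Qed.

Lemma eball_sub_cube (c : Rn) r : eball c r `<=` cube c r.
Proof. by move=> x /ltW xr; exact: le_trans (norm_le_enorm _) xr. Qed.

Lemma cube_sub_eball (c : Rn) r s : 0 <= s -> n%:R * s < r -> cube c s `<=` eball c r.
Proof.
move=> s0 nsr x xs; apply: le_lt_trans (enorm_le_norm _) _; apply: le_lt_trans nsr.
by rewrite ler_wpM2l.
Qed.

Lemma measurable_eball (c : Rn) r : measurable (eball c r).
Proof.
have [r0|r0] := leP r 0.
  rewrite (_ : eball c r = set0)//; apply/seteqP; split => // x.
  by rewrite /eball /= => /lt_le_trans/(_ r0); rewrite ltNge enorm_ge0.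
have ms : measurable_fun [set: Rn] (fun x : Rn => \sum_(i < n) (x 0 i - c 0 i) ^+ 2).
  apply: measurable_sum => i; apply: measurable_funX; apply: measurable_funB.
    exact: measurable_coord.
  exact: measurable_cst.
rewrite (_ : eball c r = [set: Rn] `&`
    (fun x : Rn => \sum_(i < n) (x 0 i - c 0 i) ^+ 2) @^-1` `]-oo, r ^+ 2[).
  exact: ms measurableT _ (measurable_itv _).
rewrite setTI; apply/seteqP; split => x; rewrite /eball /enorm /= in_itv/=.
  rewrite -{1}(ger0_norm (ltW r0)) -(sqrtr_sqr r) ltr_sqrt ?exprn_gt0//.
  by congr (_ < _); apply: eq_bigr => i _; rewrite !mxE.
move=> h; rewrite -(ger0_norm (ltW r0)) -(sqrtr_sqr r) ltr_sqrt ?exprn_gt0//.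
by move: h; congr (_ < _); apply: eq_bigr => i _; rewrite !mxE.
Qed.

Lemma leb_eball_le (c : Rn) r : 0 < r -> (mu (eball c r) <= ((4 * r) ^+ n)%:E)%E.
Proof.
move=> r0; apply: (@le_trans _ _ (mu (cube c r))).
  apply: le_measure; rewrite ?inE; [exact: measurable_eball|exact: measurable_cube|].
  exact: eball_sub_cube.
have r2 : r < 2 * r by rewrite ltr_pMl// ltr1n.
apply: le_trans (leb_cube_le c (ltW r0) r2) _.
by rewrite lee_fin mulrA -natrM.
Qed.

Lemma leb_eball_ge (c : Rn) r : (0 < n)%N -> 0 < r ->
  (((r / n%:R) ^+ n)%:E <= mu (eball c r))%E.
Proof.
move=> n0 r0; have nR : (0 : R) < n%:R by rewrite ltr0n.
have s0 : 0 < r / n%:R / 2 by rewrite !divr_gt0.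
apply: (@le_trans _ _ (mu (cube c (r / n%:R / 2)))).
  have := leb_cube_ge c s0; by rewrite mulrCA divff// mulr1.
apply: le_measure; rewrite ?inE; [exact: measurable_cube|exact: measurable_eball|].
apply: cube_sub_eball; first exact: ltW.
rewrite mulrA mulrCA divff ?gt_eqF// mulr1 ltr_pdivrMr// mulr_natr mulr2n ltrDl//.
Qed.

Lemma leb_eball_fin (c : Rn) r : mu (eball c r) \is a fin_num.
Proof.
rewrite ge0_fin_numE//; apply: le_lt_trans (leb_cube_lty c r).
apply: le_measure; rewrite ?inE; [exact: measurable_eball|exact: measurable_cube|].
exact: eball_sub_cube.
Qed.

Lemma measurable_powR_exp d (T : measurableType d) (f q : T -> R) :
  measurable_fun setT f -> measurable_fun setT q ->
  measurable_fun setT (fun x => f x `^ q x).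
Proof.
move=> mf mq; rewrite (_ : (fun x => _) = (fun x => if f x == 0 then (q x == 0)%:R
   else expR (q x * ln (f x)))); last by apply/funext => x; rewrite /powR.
apply: measurable_fun_if => //.
- exact: measurable_fun_eqr.
- apply: measurable_funTS; rewrite (_ : (fun x => _) = \1_(q @^-1` [set 0])).
    by apply: measurable_indic; rewrite -[X in measurable X]setTI; exact: mq.
  apply/funext => x; rewrite indicE; congr (nat_of_bool _)%:R.
  by apply/eqP/idP; rewrite inE.
- apply: measurable_funTS; apply: measurableT_comp => //; apply: measurable_funM => //.
  exact: measurableT_comp.
Qed.

Lemma powR_invl (a q : R) : 0 <= a -> a^-1 `^ q = a `^ (- q).
Proof. by move=> a0; rewrite -powR_inv1// -powRrM mulN1r. Qed.

Lemma measurable_fun_inv d (T : measurableType d) (f : T -> R) :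
  measurable_fun setT f -> measurable_fun setT (fun x => (f x)^-1).
Proof.
move=> mf; rewrite (_ : (fun x => _) = (fun x => f x * (f x ^+ 2) `^ (- 1))).
  apply: (measurable_funM mf); apply: measurable_powR_exp; last exact: measurable_cst.
  exact: measurable_funX.
apply/funext => x; rewrite powR_inv1 ?sqr_ge0//.
have [->|fx] := eqVneq (f x) 0; first by rewrite invr0 mul0r.
by rewrite expr2 invfM mulrA divff// mul1r.
Qed.

(** A Luxemburg norm that vanishes would bound the modular of the function by
    arbitrarily small numbers. *)
Lemma lp_norm_gt0 (q v f : Rn -> R) : measurable_fun setT q ->
  measurable_fun setT v -> measurable_fun setT f ->
  (\forall x \ae mu, 1 <= q x) -> (\forall x \ae mu, 0 < v x) ->
  ~ (\forall x \ae mu, f x = 0) -> (0 < lp_norm q v f)%E.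
Proof.
move=> mq mv mf q1 v0 f0.
have lp0 : (0 <= lp_norm q v f)%E.
  by apply: le_ereal_inf_tmp => _ [l [l0 _] <-]; rewrite lee_fin ltW.
rewrite lt_neqAle lp0 andbT; apply/negP => /eqP lpE; apply: f0.
pose h x := (`|f x| `^ q x * `|v x|)%:E : \bar R.
have h0 x : (0 <= h x)%E by rewrite lee_fin mulr_ge0// powR_ge0.
have mnf : measurable_fun setT (fun x => `|f x|) by exact: measurableT_comp.
have mnv : measurable_fun setT (fun x => `|v x|) by exact: measurableT_comp.
have mh : measurable_fun setT h.
  apply/measurable_EFinP; apply: (measurable_funM _ mnv).
  exact: (measurable_powR_exp mnf mq).
have int0 : (\int[mu]_x h x = 0)%E.
  apply/eqP; rewrite eq_le integral_ge0 ?andbT//.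
  apply/lee_addgt0Pr => e e0; rewrite add0e.
  have lt1 : (lp_norm q v f < (Num.min e 1)%:E)%E by rewrite -lpE lte_fin lt_min e0 ltr01.
  have [_ [l [l0 hl] <-]] := ereal_inf_lt lt1.
  rewrite lte_fin lt_min => /andP[le l1].
  have ml : measurable_fun setT (fun x => (`|f x| / l) `^ q x).
    exact: (measurable_powR_exp (measurable_funM mnf (measurable_cst l^-1)) mq).
  have mlv : measurable_fun setT (fun x => ((`|f x| / l) `^ q x * `|v x|)%:E).
    by apply/measurable_EFinP; exact: (measurable_funM ml mnv).
  have mlv0 x : (0 <= ((`|f x| / l) `^ q x * `|v x|)%:E)%E.
    by rewrite lee_fin mulr_ge0 ?powR_ge0.
  apply: (@le_trans _ _ (\int[mu]_x (l%:E * (((`|f x| / l) `^ q x) * `|v x|)%:E))%E).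
    apply: (ae_ge0_le_integral measurableT (fun x _ => h0 x) mh).
    - by move=> x _; apply: mule_ge0; [rewrite lee_fin ltW|exact: mlv0].
    - exact: measurable_funeM.
    near=> x => _; rewrite -EFinM lee_fin mulrA ler_wpM2r//.
    have qx : 1 <= q x by near: x.
    have lV : 0 <= l^-1 by rewrite invr_ge0 ltW.
    rewrite powRM// mulrCA ler_peMr ?powR_ge0//.
    rewrite -[leLHS](divff (lt0r_neq0 l0)) ler_wpM2l ?(ltW l0)//.
    rewrite -[leLHS]powRr1//; apply: ler_powR => //.
    by rewrite invf_ge1// ltW.
  rewrite (ge0_integralZl_EFin mu measurableT (fun x _ => mlv0 x) mlv (ltW l0)).
  apply: (@le_trans _ _ l%:E); last by rewrite lee_fin ltW.
  rewrite -[leRHS]mule1 lee_wpmul2l ?lee_fin ?(ltW l0)//.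
  apply: le_trans hl; rewrite le_eqVlt; apply/orP; left; apply/eqP.
  apply: (ae_eq_integral _ _ measurableT).
  - exact: mlv.
  - by apply: emeasurable_funM; apply/measurable_EFinP; [exact: ml|exact: mv].
  - by apply: filterS v0 => x vx _; rewrite EFinM (gtr0_norm vx).
have H : ae_eq mu setT h (cst 0%E).
  apply/(ae_eq_integral_abs mu measurableT mh); rewrite -[RHS]int0.
  by apply: eq_integral => x _; rewrite gee0_abs.
near=> x.
have qx : 1 <= q x by near: x.
have vx : 0 < v x by near: x.
have : h x = 0%E by near: x; apply: filterS H => x; apply.
move=> /eqP; rewrite eqe mulf_eq0 normr_eq0 (gt_eqF vx) orbF powR_eq0 normr_eq0.
by case/andP=> /eqP.
Unshelve. all: by end_near. Qed.

Lemma young (a b q : R) : 0 <= a -> 0 <= b -> 1 < q ->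
  a * b <= a `^ q + b `^ (q / (q - 1)).
Proof.
move=> a0 b0 q1; have q0 : 0 < q by apply: lt_trans q1.
have qm : 0 < q - 1 by rewrite subr_gt0.
have q'0 : 0 < q / (q - 1) by rewrite divr_gt0.
apply: le_trans (conjugate_powR a0 b0 q0 q'0 _) _.
  by field; rewrite !gt_eqF.
rewrite lerD// ler_piMr ?powR_ge0// invf_le1//.
  exact: ltW.
by rewrite ler_pdivlMr// mul1r lerBlDr lerDl.
Qed.

End Balls.

Lemma count_near (R : realType) (t : R) (K M : nat) :
  (\sum_(j < M) ((`|t - j%:R| <= K%:R)%R : bool) <= (2 * K).+1)%N.
Proof.
pose u := Num.max 0 (t - K%:R); pose a := Num.truncn u.
have u0 : 0 <= u by rewrite le_max lexx.
have /andP[au ua] := truncn_itv u0.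
have tu : t - K%:R <= u by rewrite le_max lexx orbT.
pose P j := `|t - j%:R| <= K%:R.
have near_iota j : P j -> (j \in iota a (2 * K).+1).
  rewrite /P mem_iota ler_distl => /andP[h1 h2].
  have uj : u <= j%:R by rewrite ge_max ler0n /=; lra.
  rewrite -(ler_nat R) (le_trans au uj) /= -(ltr_nat R).
  by rewrite addnS -addSn natrD natrM; rewrite -/a in ua; lra.
rewrite -(big_mkord xpredT (fun j => P j : nat)) /index_iota subn0.
rewrite -(big_map (fun j => P j : nat) xpredT id) -sumnE sumn_count.
rewrite -size_filter -[leqRHS](size_iota a); apply: uniq_leq_size.
  exact/filter_uniq/iota_uniq.
by move=> j; rewrite mem_filter => /andP[/near_iota].
Qed.

Section Grid.
Context (R : realType) (n : nat).
Local Notation Rn := 'rV[R]_n.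
Local Notation mu := (@leb R n).
Hypothesis n_gt0 : (0 < n)%N.
Variables (N m : nat).
Hypothesis m_gt0 : (0 < m)%N.

Let m0 : (0 : R) < m%:R. Proof. by rewrite ltr0n. Qed.

Let index := {ffun 'I_n -> 'I_(2 * N * m)}.

Definition tile_corner (z : index) : Rn := \row_i (- N%:R + (z i).+1%:R / m%:R).

Definition tile (z : index) : set Rn :=
  box (\row_i (- N%:R + (z i)%:R / m%:R), tile_corner z).

(** Large enough for the ball to contain the cubes of radius 1/m centred in its
    tile, which are the supports of the mollifiers at these points. *)
Definition tile_radius : R := 3 * n%:R / m%:R.

Definition tile_ball (z : index) : set Rn := eball (tile_corner z) tile_radius.

Definition region : set Rn := box (\row__ - N%:R, \row__ N%:R).

Lemma region_cover x : region x -> exists z, tile z x.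
Proof.
move=> xN; pose t i := m%:R * (x 0 i + N%:R).
have t0 i : 0 < t i.
  by have /andP[h _] := xN i; rewrite mulr_gt0//; move: h; rewrite !mxE; lra.
have tM i : t i <= (2 * N * m)%:R.
  have /andP[_ h] := xN i; move: h; rewrite !mxE => h.
  by rewrite natrM mulrC ler_pM2l// natrM; lra.
have lt i : (`|Num.ceil (t i)|.-1 < 2 * N * m)%N.
  have c0 : 0 < Num.ceil (t i) by rewrite ceil_gt_int.
  rewrite prednK ?absz_gt0 ?gt_eqF//.
  by rewrite -lez_nat (gez0_abs (ltW c0)) ceil_le_int.
exists [ffun i => Ordinal (lt i)] => i; rewrite /= !mxE ffunE /=.
have c0 : 0 < Num.ceil (t i) by rewrite ceil_gt_int.
have cE : (`|Num.ceil (t i)|.-1.+1%:R : R) = (Num.ceil (t i))%:~R.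
  rewrite prednK ?absz_gt0 ?gt_eqF//.
  by rewrite -[LHS]/((`|Num.ceil (t i)|%N : int)%:~R) gez0_abs// ltW.
have cE' : (`|Num.ceil (t i)|.-1%:R : R) = (Num.ceil (t i) - 1)%:~R.
  by rewrite intrB -cE -natr1 addrK.
rewrite cE cE'; have := ceil_itv (t i) => /andP[h1 h2].
rewrite -!(addrC _ (- N%:R)) ltrBlDr lerBrDr ltr_pdivrMr// ler_pdivlMr//.
by rewrite !(mulrC _ m%:R) h1.
Qed.

Lemma cube_sub_tile_ball z x : tile z x -> cube x m%:R^-1 `<=` tile_ball z.
Proof.
move=> xz; apply: (subset_trans _ (@cube_sub_eball _ _ _ tile_radius (2 / m%:R) _ _)).
- move=> y yx; rewrite /cube /=.
  have xc : `|x - tile_corner z| <= m%:R^-1.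
    apply/norm_leP => [|i]; first by rewrite invr_ge0 ltW.
    have /andP[] := xz i; rewrite /= !mxE -natr1 mulrDl mul1r ler_norml => h1 h2.
    by apply/andP; split; lra.
  have -> : y - tile_corner z = (y - x) + (x - tile_corner z) by rewrite addrA subrK.
  rewrite (le_trans (ler_normD _ _))// (_ : 2 / m%:R = m%:R^-1 + m%:R^-1); last by ring.
  exact: lerD.
- by rewrite divr_ge0// ltW.
- rewrite /tile_radius mulrA ltr_pM2r ?invr_gt0// mulrC ltr_pM2r ?ltr0n//.
  by rewrite ltr_nat.
Qed.

Lemma tile_sub_ball z : tile z `<=` tile_ball z.
Proof.
move=> x xz; apply: (cube_sub_tile_ball xz).
by rewrite /cube /= subrr normr0 invr_ge0 ltW.
Qed.

Lemma tile_ball_overlap (y : Rn) :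
  (\sum_(z : index) (y \in tile_ball z) <= ((2 * (3 * n)).+1) ^ n)%N.
Proof.
pose t i := m%:R * (y 0 i + N%:R) - 1.
apply: (@leq_trans (\sum_(z : index) \prod_(i < n) ((`|t i - (z i)%:R| <= (3 * n)%:R)%R : nat))%N).
  apply: leq_sum => z _; case: (boolP (y \in tile_ball z)) => //=.
  rewrite inE => /eball_sub_cube yz; rewrite big1// => i _.
  suff -> : `|t i - (z i)%:R| <= (3 * n)%:R by [].
  have := le_trans (coord_le_norm (y - tile_corner z) i) yz.
  rewrite /tile_radius ler_pdivlMr// -[X in _ * X](gtr0_norm m0) -normrM !mxE natrM.
  congr (_ <= _); congr (`|_|); rewrite /t -natr1.
  by field; rewrite gt_eqF.
rewrite -(bigA_distr_bigA (fun (i : 'I_n) (j : 'I_(2 * N * m)) => ((`|t i - (j : nat)%:R| <= (3 * n)%:R)%R : nat))).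
rewrite -[n in (_ ^ n)%N]card_ord -prod_nat_const.
by apply: leq_prod => i _; exact: count_near.
Qed.

Lemma card_index : #|{: index}| = ((2 * N * m) ^ n)%N.
Proof. by rewrite card_ffun !card_ord. Qed.

Lemma tile_ball_sub z : 3 * n%:R <= m%:R :> R -> tile_ball z `<=` cube 0 (N%:R + 1).
Proof.
move=> nm x /eball_sub_cube xz; rewrite /cube /= subr0.
have r1 : tile_radius <= 1 by rewrite /tile_radius ler_pdivrMr// mul1r.
have cN : `|tile_corner z| <= N%:R.
  apply/norm_leP => // i; rewrite !mxE ler_norml.
  have z0 : 0 <= (z i).+1%:R / m%:R :> R by rewrite divr_ge0// ltW.
  have zN : (z i).+1%:R / m%:R <= 2 * N%:R :> R.
    by rewrite ler_pdivrMr// -!natrM ler_nat ltn_ord.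
  by apply/andP; split; lra.
rewrite -(subrK (tile_corner z) x) (le_trans (ler_normD _ _))// addrC lerD//.
exact: le_trans xz r1.
Qed.

(** A point lies in no more balls than there are lattice points in a cube whose
    side is a fixed multiple of the mesh. *)
Lemma tile_ball_sum (f : Rn -> \bar R) : measurable_fun setT f ->
  (forall x, 0 <= f x)%E ->
  (\sum_(z : index) \int[mu]_(x in tile_ball z) f x <=
   (((2 * (3 * n)).+1) ^ n)%:R%:E * \int[mu]_x f x)%E.
Proof.
move=> mf f0; have mB z : measurable (tile_ball z) by exact: measurable_eball.
have mfB z : measurable_fun setT (f \_ (tile_ball z)).
  by apply: (measurable_restrictT _ (mB z)).1; exact: measurable_funTS.
have fB0 z x : (0 <= (f \_ (tile_ball z)) x)%E by rewrite patchE; case: ifP.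
under eq_bigr => z _ do rewrite integral_mkcond.
rewrite -(ge0_integral_sum mu measurableT mfB (fun z x _ => fB0 z x)).
rewrite -(ge0_integralZl_EFin mu measurableT (fun x _ => f0 x) mf); last first.
  by rewrite ler0n.
have sf0 x : (0 <= \sum_(z : index) (f \_ (tile_ball z)) x)%E.
  by apply: sume_ge0 => z _; exact: fB0.
have mfK := measurable_funeM (((2 * (3 * n)).+1 ^ n)%:R%:E) mf.
have msf := emeasurable_sum (index_enum index) mfB.
apply: (@ge0_le_integral _ _ _ _ setT measurableT _ _ (fun x _ => sf0 x)) => //.
move=> x _; apply: (@le_trans _ _ (\sum_(z : index) (x \in tile_ball z)%:R%:E * f x)%E).
  apply: lee_sum => z _; rewrite patchE.
  by case: (x \in tile_ball z); rewrite ?mul1e ?mul0e.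
rewrite -ge0_sume_distrl; last by move=> z _; rewrite lee_fin.
rewrite lee_wpmul2r// sumEFin lee_fin -natr_sum ler_nat.
exact: tile_ball_overlap.
Qed.

Lemma region_tile_sum (f : Rn -> \bar R) : measurable_fun setT f ->
  (forall x, 0 <= f x)%E ->
  (\int[mu]_(x in region) f x <= \sum_(z : index) \int[mu]_(x in tile z) f x)%E.
Proof.
move=> mf f0; have mT z : measurable (tile z) by exact: measurable_box.
have mfT z : measurable_fun setT (f \_ (tile z)).
  by apply: (measurable_restrictT _ (mT z)).1; exact: measurable_funTS.
have fT0 z x : (0 <= (f \_ (tile z)) x)%E by rewrite patchE; case: ifP.
under eq_bigr => z _ do rewrite integral_mkcond.
rewrite -(ge0_integral_sum mu measurableT mfT (fun z x _ => fT0 z x)) [leLHS]integral_mkcond.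
have sf0 x : (0 <= \sum_(z : index) (f \_ (tile z)) x)%E.
  by apply: sume_ge0 => z _; exact: fT0.
have f0r x : (0 <= (f \_ region) x)%E by rewrite patchE; case: ifP.
have mfr : measurable_fun setT (f \_ region).
  apply: (measurable_restrictT _ (measurable_box _)).1; exact: measurable_funTS.
have msf := emeasurable_sum (index_enum index) mfT.
apply: (@ge0_le_integral _ _ _ _ setT measurableT _ _ (fun x _ => f0r x)) => //.
move=> x _; rewrite [leLHS]patchE; case: ifPn => [|_]; last exact: sume_ge0.
rewrite inE => /region_cover[z xz]; rewrite (bigD1 z)//=.
by rewrite [in leRHS]patchE mem_set// leeDl// sume_ge0.
Qed.

End Grid.

Section Cutoff.
Context (R : realType) (n : nat).
Local Notation Rn := 'rV[R]_n.
Local Notation mu := (@leb R n).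

Definition cutoff (r : nat) : Rn -> R := convol (\1_(region r)) (mollifier 1).

Let t1 := @test_mollifier R n 1 ltr01.

Let m_region r : measurable (@region R n r).
Proof. exact: measurable_box. Qed.

Let region_sub r : @region R n r `<=` cube 0 r%:R.
Proof.
move=> x xN; apply: box_sub_cube => // i; have := xN i.
by rewrite /= !mxE sub0r add0r.
Qed.

Lemma test_cutoff r : test_fun (r%:R + 1) (cutoff r).
Proof. exact: test_convol_indic. Qed.

Let lreg r := @indic_loc_integrable R n _ (m_region r).

(** The derivatives fall on the kernel, which does not depend on [r]. *)
Lemma wderiv_cutoff_le (s : seq 'I_n) : exists2 C : R, 0 <= C &
  forall r x, `|wderiv s (cutoff r) x| <= C.
Proof.
have ts := test_wderiv s t1.
have its := test_integrable ts.
have iabs : mu.-integrable setT (EFin \o (fun y => `|wderiv s (mollifier 1) y|)).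
  exact: (integrable_abse its).
exists (\int[mu]_y `|wderiv s (mollifier 1) y|).
  by apply: Rintegral_ge0.
move=> r x; rewrite /cutoff (wderiv_convol s (lreg r) t1) normrM normrX normrN1 expr1n mul1r.
have ci := convol_integrable x (lreg r) ts.
apply: le_trans (le_normr_Rintegral measurableT ci) _.
have mts : measurable_fun [set: Rn] (fun y => `|wderiv s (mollifier 1) y|).
  exact: (measurableT_comp _ (test_measurable ts)).
rewrite -(@Rintegral_shift _ _ _ (- x) mts).
apply: le_Rintegral => //.
- exact: (integrable_abse ci).
- exact: (integrable_shift (- x) iabs).
move=> y _; rewrite normrM ler_piMl// indicE normr_nat lern1 leq_b1//.
Qed.

Lemma partial_cst (i : 'I_n) (c : R) : partial i (fun=> c) = (fun=> 0) :> (Rn -> R).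
Proof.
by apply/funext => x; exact: (@derive_val _ _ _ _ _ _ _ (is_derive_cst c x _)).
Qed.

Lemma wderiv_cst (s : seq 'I_n) (c : R) :
  wderiv s (fun=> c) = (fun=> if s is [::] then c else 0) :> (Rn -> R).
Proof.
elim: s => //= i s; rewrite /wderiv /= => ->.
by case: s => *; rewrite partial_cst.
Qed.

(** Around a given point and for large [r], the cutoff is the mollification of the
    constant 1. *)
Lemma wderiv_cutoff_near (s : seq 'I_n) x : \forall r \near \oo,
  wderiv s (cutoff r) x = (s == [::])%:R.
Proof.
near=> r.
have xr : cube x 1 `<=` @region R n r.
  have hr : `|x| + 2 < r%:R by near: r; exact: nbhs_infty_gtr.
  move=> y yx i; rewrite /= !mxE.
  have yr : `|y| < r%:R.
    rewrite -(subrK x y); apply: le_lt_trans (ler_normD _ _) _.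
    by move: yx; rewrite /cube /= => yx; apply: le_lt_trans hr; lra.
  have := le_lt_trans (coord_le_norm y i) yr; rewrite ltr_norml => /andP[-> /ltW ->//].
have ts := test_wderiv s t1.
have l1 : loc_integrable (fun _ : Rn => 1 : R).
  by apply: (@bounded_loc_integrable _ _ _ 1) => // x0; rewrite normr1.
rewrite /cutoff (wderiv_convol s (lreg r) t1).
rewrite (@eq_convol _ _ _ (fun=> 1) _ _ x ts); last first.
  move=> y; rewrite invr1 => /xr yr; rewrite indicE mem_set//.
rewrite -[LHS]/((fun x => (-1) ^+ size s * convol (fun=> 1) (wderiv s (mollifier 1)) x) x).
rewrite -(wderiv_convol s l1 t1).
rewrite (_ : convol (fun=> 1) (mollifier 1) = (fun=> 1)); last first.
  by apply/funext => y; rewrite (convol_cst 1 y t1) mollifier_integral// mulr1.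
by rewrite wderiv_cst; case: s {ts}.
Unshelve. all: by end_near. Qed.

End Cutoff.

(** * Consequences of the structural hypotheses *)

Section Main.
Context (R : realType) (n : nat).
Local Notation Rn := 'rV[R]_n.
Local Notation mu := (@leb R n).
Implicit Types u v f g : Rn -> R.
Variables (phi : Rn -> R -> \bar R) (w p : Rn -> R).
Hypothesis n_gt0 : (0 < n)%N.
Hypotheses (hw : is_weight w) (hphi : weak_Phi phi) (hH : condH phi w p).
Hypothesis hA : muckenhoupt p w.
Hypothesis hq : exists2 q : R, 1 <= q & aDec q (psi phi p).

Lemma exponent_bounds : exponent p -> exists2 P : R, 1 <= P &
  \forall x \ae mu, 1 < p x <= P.
Proof.
move=> [_ p1 pP]; have [M hM] := ess_supr_bounded pP.
exists (Num.max 1 M); first by rewrite le_max lexx.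
near=> x; apply/andP; split.
  rewrite -lte_fin; apply: lt_le_trans p1 _.
  by near: x; exact: ess_inf_le.
by rewrite le_max; apply/orP; right; near: x.
Unshelve. all: by end_near. Qed.

Lemma phi_psi x (t : R) : 0 < p x -> (0 <= phi x t)%E ->
  phi x t = (psi phi p x t `^ p x)%E.
Proof.
move=> px h; rewrite /psi -poweRrM mulVf ?gt_eqF// poweRe1//.
Qed.

Lemma gen_inv_gt (Phi : Rn -> R -> \bar R) x (s t : R) : 0 <= t ->
  (t%:E < gen_inv Phi x s)%E -> (Phi x t < s%:E)%E.
Proof.
move=> t0 h; rewrite ltNge; apply/negP => st; move: h; rewrite ltNge => /negP; apply.
by apply: ereal_inf_lbound; exists t.
Qed.

(** The condition (aDec) on [psi], raised to the bounded power [p x]. *)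
Lemma doubling_phi (l : R) : 1 <= l -> exists2 D : R, 1 <= D &
  \forall x \ae mu, forall t : R, 0 <= t -> (phi x (l * t)%R <= D%:E * phi x t)%E.
Proof.
move=> l1; have [q q1 [C C1 hC]] := hq.
have [P P1 hP] := exponent_bounds (condH_log hH).1.
have c1 : 1 <= C * l `^ q.
  rewrite mulr_ege1// -(powRr0 l); apply: ler_powR => //; exact: le_trans q1.
have c0 : 0 <= C * l `^ q by apply: le_trans c1.
exists ((C * l `^ q) `^ P).
  by rewrite -(powRr0 (C * l `^ q)); apply: ler_powR => //; exact: le_trans P1.
near=> x => t t0.
have /andP[p1 pP] : 1 < p x <= P by near: x.
have p0 : 0 < p x by apply: lt_trans p1.
have hx : forall l t : R, 1 <= l -> 0 <= t ->
   (psi phi p x (l * t)%R <= (C * l `^ q)%R%:E * psi phi p x t)%E by near: x.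
have phi0 s : 0 <= s -> (0 <= phi x s)%E by move=> s0; exact: (weak_Phi_ge0 hphi).
have lt0 : 0 <= l * t by rewrite mulr_ge0// (le_trans _ l1).
rewrite (phi_psi p0 (phi0 _ lt0)) (phi_psi p0 (phi0 _ t0)).
have psi0 s : (0 <= psi phi p x s)%E by exact: poweR_ge0.
apply: (@le_trans _ _ (((C * l `^ q)%:E * psi phi p x t) `^ p x)%E).
  apply: gt0_ler_poweR; [exact: ltW| | |exact: hx].
    by rewrite in_itv/= leey andbT.
  by rewrite in_itv/= leey andbT mule_ge0// lee_fin.
rewrite poweRM ?lee_fin// lee_wpmul2r ?poweR_ge0// poweR_EFin lee_fin.
exact: ler_powR.
Unshelve. all: by end_near. Qed.

(** By (A0), [psi] is at most 1 at a fixed positive argument, and doubling reaches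
    every other argument from there. *)
Lemma phi_bounded (T : R) : 0 <= T -> exists2 K : R, 0 <= K &
  \forall x \ae mu, (phi x T <= K%:E)%E.
Proof.
move=> T0; have [b /andP[b0 b1] hb] := condH_A0 hH.
have [P P1 hP] := exponent_bounds (condH_log hH).1.
pose l := 1 + T / (b / 2).
have b2 : 0 < b / 2 by rewrite divr_gt0.
have l1 : 1 <= l by rewrite lerDl divr_ge0// ltW.
have [D D1 hD] := doubling_phi l1.
exists D; first exact: le_trans D1.
near=> x.
have /andP[p1 pP] : 1 < p x <= P by near: x.
have p0 : 0 < p x by apply: lt_trans p1.
have inc : forall s t : R, 0 <= s -> s <= t -> (phi x s <= phi x t)%E.
  by near: x; exact: weak_Phi_incr hphi.
have dx : forall t : R, 0 <= t -> (phi x (l * t)%R <= D%:E * phi x t)%E by near: x.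
have /andP[bx _] : (b%:E <= gen_inv (psi phi p) x 1 <= b^-1%R%:E)%E by near: x.
have psi1 : (psi phi p x (b / 2) < 1%:E)%E.
  apply: gen_inv_gt; first exact: ltW.
  by apply: lt_le_trans bx; rewrite lte_fin ltr_pdivrMr// mulr_natr mulr2n ltrDl.
have phi0 s : 0 <= s -> (0 <= phi x s)%E by move=> s0; exact: (weak_Phi_ge0 hphi).
apply: (@le_trans _ _ (phi x (l * (b / 2)))).
  apply: inc => //; rewrite /l mulrDl mul1r divfK ?gt_eqF//.
  by rewrite lerDr ltW.
apply: le_trans (dx _ (ltW b2)) _; rewrite -[leRHS]mule1 lee_wpmul2l ?lee_fin ?(le_trans _ D1)//.
rewrite (phi_psi p0 (phi0 _ (ltW b2))) -(poweR1r (p x)).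
apply: gt0_ler_poweR; [exact: ltW| | |exact: ltW].
  by rewrite in_itv/= leey andbT poweR_ge0.
by rewrite in_itv/= leey andbT lee01.
Unshelve. all: by end_near. Qed.

Lemma aInc1_mul (Phi : Rn -> R -> \bar R) x (L s t : R) : 0 < L ->
  0 < s -> s < t -> (Phi x s / s%:E <= L%:E * (Phi x t / t%:E))%E ->
  (Phi x s <= (L * (s / t))%:E * Phi x t)%E.
Proof.
move=> L0 s0 st; have t0 := lt_trans s0 st.
rewrite !inver !gt_eqF// -[leLHS]/(Phi x s * s^-1%:E)%E lee_pdivrMr//.
move=> /le_trans; apply; rewrite (muleC (Phi x t)) muleA -EFinM muleAC -EFinM.
by rewrite -mulrA (mulrC t^-1).
Qed.

Lemma doubling_Phi_phi : doubling_Phi phi.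
Proof.
split.
- exact: weak_Phi_meas hphi.
- exact: weak_Phi_ge0 hphi.
- exact: weak_Phi_incr hphi.
- exact: weak_Phi_at0 hphi.
- have [L L1 hL] := weak_Phi_aInc1 hphi; exists L => //.
  apply: filterS hL => x hx s t s0.
  rewrite le_eqVlt => /orP[/eqP <-|st].
    rewrite divff ?gt_eqF// mulr1 -[leLHS]mul1e lee_wpmul2r ?lee_fin//.
    exact/(weak_Phi_ge0 hphi)/ltW.
  by apply: aInc1_mul => //; [exact: lt_le_trans L1|exact: hx].
- exact: doubling_phi.
- exact: phi_bounded.
Qed.

Let dP : doubling_Phi phi := doubling_Phi_phi.

Let mw : measurable_fun setT w := hw.1.1.
Let mp : measurable_fun setT p.
Proof. by case: (condH_log hH).1. Qed.


(** * The estimate on a ball *)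

(** Log-Hoelder continuity makes the exponent essentially constant on a ball for
    powers of numbers between the volume of the ball and 1. The exponent of the
    centre is replaced by its maximum with 1, since [p] is only controlled
    almost everywhere. *)
Lemma log_hoelder_power : exists2 K : R, 1 <= K & forall (c x : Rn) (r T : R),
  0 < r -> r <= 1 -> eball c r x -> 1 <= p x -> (r / n%:R) ^+ n <= T -> T <= 1 ->
  K^-1 * T <= T `^ (p x / Num.max (p c) 1) <= K * T.
Proof.
have [_ [C [_ [C0 hC _]]]] := condH_log hH.
have n1 : 1 <= n%:R :> R by rewrite ler1n.
have n0 : 0 < n%:R :> R by rewrite ltr0n.
have lnn : 0 <= ln (n%:R : R) by rewrite ln_ge0.
pose k := C * (n%:R * (ln (n%:R : R) + 1)).
have k0 : 0 <= k by rewrite mulr_ge0 ?(ltW C0)// mulr_ge0// addr_ge0.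
exists (expR k); first by rewrite -expR0 ler_expR.
move=> c x r T r0 r1 xr px rT T1.
have rn0 : 0 < r / n%:R by rewrite divr_gt0.
have T0 : 0 < T by apply: lt_le_trans rT; rewrite exprn_gt0.
set p0 := Num.max (p c) 1.
have p01 : 1 <= p0 by rewrite le_max lexx orbT.
have p0p : 0 < p0 by apply: lt_le_trans p01.
pose L := ln (expR 1 + r^-1).
have er : 0 < expR 1 + r^-1 by rewrite addr_gt0 ?expR_gt0 ?invr_gt0.
have L1 : 1 <= L.
  by rewrite -[leLHS](@expRK R 1) ler_ln ?posrE ?expR_gt0// lerDl invr_ge0 ltW.
have L0 : 0 < L by apply: lt_le_trans L1.
have pxc : `|p x - p c| <= C / L.
  have [->|xc] := eqVneq x c; first by rewrite subrr normr0 divr_ge0// ltW.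
  apply: le_trans (hC _ _ xc) _; rewrite ler_wpM2l ?(ltW C0)//.
  have xc0 : 0 < enorm (x - c).
    by apply: lt_le_trans (norm_le_enorm _); rewrite normr_gt0 subr_eq0.
  have e0 : 0 < expR 1 + (enorm (x - c))^-1 by rewrite addr_gt0 ?expR_gt0 ?invr_gt0.
  have LL : L <= ln (expR 1 + (enorm (x - c))^-1).
    by rewrite ler_ln ?posrE// lerD2l lef_pV2 ?posrE// ltW.
  by rewrite lef_pV2 ?posrE//; exact: lt_le_trans LL.
have dpx : `|p x / p0 - 1| <= C / L.
  apply: le_trans pxc.
  have -> : p x / p0 - 1 = (p x - p0) / p0 by rewrite mulrBl divff ?gt_eqF.
  rewrite normrM normfV (gtr0_norm p0p) ler_pdivrMr//.
  apply: (@le_trans _ _ `|p x - p c|); last by rewrite ler_peMr.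
  rewrite /p0 /Num.max; case: ifPn => // pc1.
  rewrite ger0_norm ?subr_ge0// (le_trans _ (ler_norm _))//.
  by rewrite lerD2l lerN2 ltW.
have lnT : - ln T <= n%:R * (ln n%:R + 1) * L.
  have : ln ((r / n%:R) ^+ n) <= ln T by rewrite ler_ln ?posrE// exprn_gt0.
  rewrite lnXn// lnM ?posrE ?invr_gt0// !lnV ?posrE// -[X in X <= _]mulr_natl => h.
  have lr : - ln r <= L.
    by rewrite -lnV ?posrE// /L ler_ln ?posrE ?invr_gt0// lerDr expR_ge0.
  have h2 : - ln T <= n%:R * (ln n%:R - ln r).
    by rewrite lerNl; apply: le_trans h; rewrite -mulrN opprB.
  apply: le_trans h2 _; rewrite -mulrA ler_wpM2l// mulrDl mul1r lerD//.
  by rewrite ler_peMr.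
have lnT0 : 0 <= - ln T by rewrite oppr_ge0 -ln1 ler_ln ?posrE.
have key : `|(p x / p0 - 1) * ln T| <= k.
  rewrite normrM -(normrN (ln T)) (ger0_norm lnT0).
  apply: le_trans (ler_pM _ _ dpx lnT) _ => //.
  rewrite /k (_ : C / L * _ = C * (n%:R * (ln n%:R + 1)))//.
  by field; rewrite gt_eqF.
have -> : T `^ (p x / p0) = T * expR ((p x / p0 - 1) * ln T).
  rewrite -{1}(subrK 1 (p x / p0)) addrC powRD; last by rewrite (gt_eqF T0) implybT.
  by rewrite powRr1 ?(ltW T0)// /powR gt_eqF.
move: key; rewrite ler_norml => /andP[h1 h2].
by rewrite (mulrC _ T) (mulrC _ T) !ler_pM2l// -expRN !ler_expR h1 h2.
Qed.

(** (A0) bounds the generalized inverse of [psi] from below, the growth of [psi]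
    makes it finite, and the almost monotonicity of [psi x t / t] bounds an
    argument beyond it by the value of [psi] at that argument. *)
Lemma gen_inv_bound : exists2 L : R, 1 <= L & \forall y \ae mu,
  forall s : R, 1 <= s -> exists tau : R, [/\ 0 < tau,
    gen_inv (psi phi p) y s = tau%:E &
    forall t : R, 0 <= t ->
      (t%:E <= (2 * L * tau)%:E * (1 + psi phi p y t * s^-1%:E))%E].
Proof.
have [L L1 hL] := weak_Phi_aInc1 (condH_psi hH); exists L => //.
have [b /andP[b0 b1] hb] := condH_A0 hH.
have L0 : 0 < L by apply: lt_le_trans L1.
near=> y => s s1; have s0 : 0 < s by apply: lt_le_trans s1.
have /andP[by1 _] : (b%:E <= gen_inv (psi phi p) y 1 <= b^-1%R%:E)%E by near: y.
have at0 : psi phi p y 0 = 0%E by near: y; exact: weak_Phi_at0 (condH_psi hH).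
have cvy : psi phi p y t @[t --> +oo] --> +oo%E by near: y; exact: weak_Phi_cvgy (condH_psi hH).
have aIncy : forall s t : R, 0 < s -> s < t ->
  (psi phi p y s / s%:E <= L%:E * (psi phi p y t / t%:E))%E by near: y.
set G := gen_inv (psi phi p) y s.
have Gb : (b%:E <= G)%E.
  apply: le_trans by1 _; apply: le_ereal_inf_tmp => _ [t [t0 st] <-].
  apply: ereal_inf_lbound; exists t => //; split=> //; apply: le_trans st.
  by rewrite lee_fin.
have Goo : (G < +oo)%E.
  have : \forall t \near +oo, 0 <= t /\ (s%:E <= psi phi p y t)%E.
    near=> t; split; first by near: t; exact: nbhs_pinfty_ge.
    near: t; apply: (cvy [set z | s%:E <= z]%E).
    by exists s; split; [exact: num_real|move=> z /= /ltW].
  move=> /filter_ex[t [t0 st]]; apply: (@le_lt_trans _ _ t%:E); last exact: ltry.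
  by apply: ereal_inf_lbound; exists t.
have Gfin : G \is a fin_num.
  by rewrite fin_numE -ltNye -ltey Goo (lt_le_trans _ Gb)// ltNyr.
have tau0 : 0 < fine G by rewrite -lte_fin fineK// (lt_le_trans _ Gb)// lte_fin.
exists (fine G); split => //; first by rewrite fineK.
move=> t t0; have psi0 t' : (0 <= psi phi p y t')%E by exact: poweR_ge0.
have c0 : 0 <= 2 * L * fine G by rewrite !mulr_ge0 ?ltW.
have r0 : (0 <= psi phi p y t * s^-1%:E)%E by rewrite mule_ge0// lee_fin invr_ge0 ltW.
rewrite ge0_muleDr//.
rewrite mule1; have [tG|Gt] := leP t (fine G).
  apply: (@le_trans _ _ (2 * L * fine G)%:E); last by rewrite leeDl// mule_ge0.
  rewrite lee_fin; apply: le_trans tG _; rewrite ler_peMl ?(ltW tau0)//.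
  by rewrite mulr_ege1// ler1n.
apply: (@le_trans _ _ ((2 * L * fine G)%:E * (psi phi p y t * s^-1%:E))%E); last first.
  by rewrite leeDr.
have Gmin : (G < (Num.min t (2 * fine G))%:E)%E.
  by rewrite -(fineK Gfin) lte_fin lt_min Gt mulr_natl mulr2n ltrDl.
have [_ [t' [t'0 st'] <-]] := ereal_inf_lt Gmin.
rewrite lte_fin lt_min => /andP[t't t'G].
have t'p : 0 < t'.
  rewrite lt_neqAle t'0 andbT; apply/eqP => t'E; move: st'.
  by rewrite -t'E at0 lee_fin leNgt s0.
have tp := lt_trans t'p t't.
have h := aInc1_mul L0 t'p t't (aIncy _ _ t'p t't).
have h2 := le_trans st' h.
have ts0 : (0 <= (t / s)%:E)%E by rewrite lee_fin divr_ge0// ltW.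
have := lee_wpmul2l ts0 h2.
rewrite -EFinM divfK ?gt_eqF// muleA -EFinM => /le_trans; apply.
rewrite (muleC _ s^-1%:E) muleA -EFinM lee_wpmul2r// lee_fin.
have -> : t / s * (L * (t' / t)) = s^-1 * (L * t') by field; rewrite !gt_eqF.
have -> : s^-1 * (L * t') = t' * (L * s^-1) by ring.
have -> : 2 * L * fine G * s^-1 = (2 * fine G) * (L * s^-1) by ring.
by rewrite ler_wpM2r ?(ltW t'G)// mulr_ge0 ?invr_ge0 ?ltW.
Unshelve. all: by end_near. Qed.

Let measurable_psi (g : Rn -> R) : measurable_fun setT g ->
  measurable_fun setT (fun y => psi phi p y `|g y|).
Proof. exact: weak_Phi_meas (condH_psi hH) g. Qed.

Let leb_eball_gt0 (c : Rn) r : 0 < r -> (0 < mu (eball c r))%E.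
Proof.
move=> r0; apply: lt_le_trans (leb_eball_ge c n_gt0 r0).
by rewrite lte_fin exprn_gt0// divr_gt0// ltr0n.
Qed.

(** The Jensen type inequality. At a level [s] in the range of the condition
    (A1) the generalized inverse is comparable on the ball, so the arguments are
    bounded by the inverse at one point times an affine function of the values
    of [psi]; averaging bounds the mean argument by the mean value. *)
Lemma jensen_ball : exists2 L1 : R, 0 < L1 &
  forall (c : Rn) (r s M : R) (g : Rn -> R), 0 < r ->
  (lp_norm p w \1_(eball c r) <= 1)%E -> 1 <= s ->
  (s%:E <= (lp_norm p w \1_(eball c r))^-1)%E ->
  measurable_fun setT g -> 0 <= M ->
  (\int[mu]_(y in eball c r) psi phi p y `|g y|%R <= (M * s)%:E * mu (eball c r))%E ->
  \forall x \ae mu, eball c r x -> forall a : R, 0 <= a ->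
    ((L1 * (1 + M) * a)%:E * mu (eball c r) <=
       \int[mu]_(y in eball c r) `|g y|%:E)%E ->
    (phi x a <= (s `^ p x)%:E)%E.
Proof.
have [L L1 hL] := gen_inv_bound.
have [b /andP[b0 b1] hb] := condH_A1 hH.
have [P P1 hP] := exponent_bounds (condH_log hH).1.
have L0 : 0 < L by apply: lt_le_trans L1.
exists (4 * L / b); first by rewrite !mulr_gt0 ?invr_gt0.
move=> c r s M g r0 lp1 s1 slp mg M0 psiM.
set B := eball c r in lp1 slp psiM *.
have mB : measurable B := measurable_eball c r.
have Bfin : mu B \is a fin_num := leb_eball_fin c r.
have B0 : (0 < mu B)%E := leb_eball_gt0 c r0.
have s0 : 0 < s by apply: lt_le_trans s1.
have mpsi := measurable_psi mg.
have psi0 y t : (0 <= psi phi p y t)%E by exact: poweR_ge0.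
near=> x => Bx a a0 ha.
have [tau [tau0 tauE _]] : exists tau : R, [/\ 0 < tau,
    gen_inv (psi phi p) x s = tau%:E &
    forall t : R, 0 <= t ->
      (t%:E <= (2 * L * tau)%:E * (1 + psi phi p x t * s^-1%:E))%E].
  by move: s s1 {slp psiM s0}; near: x.
have A1x : \forall y \ae mu, B x -> B y -> forall s : R, 1 <= s ->
    (s%:E <= (lp_norm p w \1_B)^-1)%E ->
    (b%:E * gen_inv (psi phi p) y s <= gen_inv (psi phi p) x s)%E.
  by near: x; exact: hb r0 lp1.
have gB : \forall y \ae mu, B y -> (`|g y|%:E <=
    (2 * L / b * tau)%:E * (1 + psi phi p y `|g y|%R * s^-1%:E))%E.
  near=> y => By.
  have [tauy [tauy0 tauyE /(_ `|g y| (normr_ge0 _)) hy]] : exists tau : R, [/\ 0 < tau,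
      gen_inv (psi phi p) y s = tau%:E &
      forall t : R, 0 <= t ->
      (t%:E <= (2 * L * tau)%:E * (1 + psi phi p y t * s^-1%:E))%E].
    by move: s s1 {slp psiM s0 tauE ha}; near: y.
  have A1y : B x -> B y -> forall s : R, 1 <= s ->
    (s%:E <= (lp_norm p w \1_B)^-1)%E ->
    (b%:E * gen_inv (psi phi p) y s <= gen_inv (psi phi p) x s)%E by near: y.
  have := A1y Bx By s s1 slp; rewrite tauE tauyE -EFinM lee_fin => btau.
  apply: le_trans hy _; rewrite lee_wpmul2r//.
    by rewrite adde_ge0// mule_ge0// lee_fin invr_ge0 ltW.
  rewrite lee_fin -!mulrA ler_wpM2l// ler_wpM2l ?(ltW L0)//.
  by rewrite ler_pdivlMl.
have k0 : 0 <= 2 * L / b * tau by rewrite !mulr_ge0 ?invr_ge0 ?ltW.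
set k := 2 * L / b * tau in gB k0 *.
have mB1 : measurable_fun B (fun y => psi phi p y `|g y|%R * s^-1%:E)%E.
  by apply: emeasurable_funM; [exact: measurable_funTS|exact: measurable_cst].
have psis0 y : (0 <= psi phi p y `|g y|%R * s^-1%:E)%E.
  by rewrite mule_ge0// lee_fin invr_ge0 ltW.
have m1 : measurable_fun B (fun y => 1 + psi phi p y `|g y|%R * s^-1%:E)%E.
  by apply: emeasurable_funD; [exact: measurable_cst|exact: mB1].
have m10 y : (0 <= 1 + psi phi p y `|g y|%R * s^-1%:E)%E by rewrite adde_ge0.
have intg : (\int[mu]_(y in B) `|g y|%:E <= (k * (1 + M))%:E * mu B)%E.
  apply: (@le_trans _ _ (\int[mu]_(y in B) (k%:E *
      (1 + psi phi p y `|g y|%R * s^-1%:E)))%E).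
    apply: (ae_ge0_le_integral mB).
    - by move=> y _; rewrite lee_fin.
    - apply: measurable_funTS; apply/measurable_EFinP; exact: measurableT_comp.
    - by move=> y _; rewrite mule_ge0 ?lee_fin.
    - exact: measurable_funeM.
    - exact: gB.
  rewrite (ge0_integralZl_EFin mu mB (fun y _ => m10 y) m1 k0) (EFinM k) -muleA.
  apply: lee_wpmul2l; first by rewrite lee_fin.
  rewrite (ge0_integralD mu mB (fun y _ => lee01) (measurable_cst _) (fun y _ => psis0 y) mB1).
  rewrite integral_cst// mul1e EFinD ge0_muleDl ?lee_fin// mul1e leeD2lE//.
  under eq_integral => y _ do rewrite muleC.
  rewrite (ge0_integralZl_EFin mu mB (fun y _ => psi0 y `|g y|) (measurable_funTS mpsi)); last first.
    by rewrite invr_ge0 ltW.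
  rewrite lee_pdivrMl// muleA -EFinM (mulrC s); exact: psiM.
have {ha}atau : a < tau.
  have := le_trans ha intg.
  rewrite -(fineK Bfin) -!EFinM lee_fin ler_pM2r; last by rewrite fine_gt0// B0 ltey_eq Bfin.
  move=> h; have M1 : 0 < 1 + M by rewrite ltr_wpDr.
  have kk : 0 < 2 * L / b * (1 + M) by rewrite !mulr_gt0 ?invr_gt0.
  have : 2 * L / b * (1 + M) * (2 * a) <= 2 * L / b * (1 + M) * tau.
    apply: le_trans (le_trans _ h) _; rewrite le_eqVlt; apply/orP; left; apply/eqP.
      by field; rewrite gt_eqF.
    by rewrite /k; field; rewrite gt_eqF.
  rewrite ler_pM2l// => h2; move: a0; rewrite le_eqVlt => /orP[/eqP <-//|a0].
  by apply: lt_le_trans h2; rewrite mulr_natl mulr2n ltrDl.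
have psia : (psi phi p x a < s%:E)%E by apply: gen_inv_gt => //; rewrite tauE lte_fin.
have /andP[p1 _] : 1 < p x <= P by near: x.
have p0 : 0 < p x by apply: lt_trans p1.
rewrite (phi_psi p0 (weak_Phi_ge0 hphi x a0)) -poweR_EFin.
apply: gt0_ler_poweR; [exact: ltW| | |exact: ltW].
  by rewrite in_itv/= leey andbT.
by rewrite in_itv/= leey andbT lee_fin ltW.
Unshelve. all: by end_near. Qed.

(** Young's inequality for the product of [t^(1/p) w^(1/p) / lam] and
    [w^(-1/p) / m]. *)
Lemma young_psi (t : \bar R) (q v lam m : R) : (0 <= t)%E -> 1 < q -> 0 < v ->
  0 < lam -> 0 < m ->
  (t `^ q^-1 <= (lam * m)%:E * (t * (lam `^ (- q) * v)%:E +
     ((v `^ (- q^-1) / m) `^ (q / (q - 1)))%:E))%E.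
Proof.
move=> t0 q1 v0 l0 m0; have q0 : 0 < q by apply: lt_trans q1.
have lm0 : 0 < lam * m by rewrite mulr_gt0.
have lv0 : 0 < lam `^ (- q) * v by rewrite mulr_gt0// powR_gt0.
case: t t0 => [t t0| |//]; last first.
  by move=> _; rewrite gt0_mulye ?lte_fin// addye// gt0_muley ?lte_fin// leey.
rewrite lee_fin in t0; rewrite poweR_EFin.
suff H : t `^ q^-1 <= lam * m * (t * (lam `^ (- q) * v) +
    (v `^ (- q^-1) / m) `^ (q / (q - 1))) by rewrite -lee_fin in H.
have qn : q != 0 by rewrite gt_eqF.
pose a := t `^ q^-1 * lam^-1 * v `^ q^-1.
pose b := v `^ (- q^-1) / m.
have a0 : 0 <= a by rewrite !mulr_ge0 ?powR_ge0// invr_ge0 ltW.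
have b0 : 0 <= b by rewrite divr_ge0 ?powR_ge0 ?ltW.
have aq : a `^ q = t * (lam `^ (- q) * v).
  rewrite /a powRM ?mulr_ge0 ?powR_ge0 ?invr_ge0 ?(ltW l0)//.
  rewrite powRM ?powR_ge0 ?invr_ge0 ?(ltW l0)// -!powRrM mulVf// !powRr1 ?(ltW v0)//.
  by rewrite -mulrA; congr (_ * (_ * _)); rewrite (powR_invl _ (ltW l0)).
have tE : t `^ q^-1 = lam * m * (a * b).
  rewrite /a /b powRN; have vn : v `^ q^-1 != 0 by rewrite gt_eqF// powR_gt0.
  by field; rewrite vn !gt_eqF.
rewrite tE -aq ler_wpM2l ?(ltW lm0)//.
exact: young.
Qed.

(** Numbers slightly larger than the two norms of the Muckenhoupt condition bring
    the corresponding modulars below 1. Both norms are positive, so twice the norm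
    will do, which costs the factor 4. *)
Lemma muckenhoupt_modular : exists2 A : R, 0 < A & forall (c : Rn) (r : R), 0 < r ->
  (lp_norm p w \1_(eball c r) <= 1)%E ->
  exists nu m : R, [/\ 0 < nu /\ 0 < m,
    (0 < lp_norm p w \1_(eball c r) <= nu%:E)%E,
    (\int[mu]_(x in eball c r) (nu `^ (- p x) * `|w x|)%:E <= 1)%E,
    (\int[mu]_(x in eball c r) ((w x `^ (- (p x)^-1) / m) `^ (p x / (p x - 1)))%:E <= 1)%E &
    ((nu * m)%:E <= A%:E * mu (eball c r))%E].
Proof.
have [P P1 hP] := exponent_bounds (condH_log hH).1.
have mnw : measurable_fun setT (fun x => `|w x|) by exact: measurableT_comp.
have [A0 A00 hA0] : exists2 A0 : R, 0 <= A0 & forall (c : Rn) (r : R), 0 < r ->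
    ((mu (eball c r))^-1 * lp_norm p w \1_(eball c r) *
     lp_norm (conj_exponent p) (cst 1%R)
       (fun x => w x `^ (- (p x)^-1) * \1_(eball c r) x)%R <= A0%:E)%E.
  move: hA; rewrite /muckenhoupt; set S := ereal_sup _ => Soo.
  have SA : (S <= `|fine S|%:E)%E.
    by case: S Soo => [s _| |] //=; [rewrite lee_fin ler_norm|move=> _; rewrite leNye].
  exists `|fine S| => // c r r0; apply: le_trans SA; apply: ereal_sup_ubound.
  by exists c, r.
exists (4 * (A0 + 1)); first by rewrite mulr_gt0// ltr_wpDl.
move=> c r r0 lp1; have := hA0 c r r0; set B := eball c r in lp1 *.
have mB : measurable B := measurable_eball c r.
have Bfin : mu B \is a fin_num := leb_eball_fin c r.
have B0 : (0 < mu B)%E := leb_eball_gt0 c r0.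
have B0' : 0 < fine (mu B) by rewrite fine_gt0// B0 ltey_eq Bfin.
have mI : measurable_fun setT (\1_B : Rn -> R) by exact: measurable_indic.
have mI' : measurable_fun setT (fun x => `|\1_B x| : R) by exact: measurableT_comp.
have notB : ~ (\forall x \ae mu, ~ B x).
  move=> nB; have /(negligibleP mu mB) : mu.-negligible B.
    by apply: negligibleS nB => x Bx /=; apply.
  by move=> E; move: B0; rewrite E ltxx.
have mpV : measurable_fun setT (fun x => - (p x)^-1).
  by apply: measurable_funN; exact: measurable_fun_inv.
pose f2 (x : Rn) : R := w x `^ (- (p x)^-1) * \1_B x.
have mf2 : measurable_fun setT f2.
  exact: (measurable_funM (measurable_powR_exp mw mpV) mI).
have mf2' : measurable_fun setT (fun x => `|f2 x|) by exact: measurableT_comp.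
have mcp : measurable_fun setT (conj_exponent p).
  apply: (measurable_funM mp); apply: measurable_fun_inv.
  by apply: measurable_funB; [exact: mp|exact: measurable_cst].
have N10 : (0 < lp_norm p w \1_B)%E.
  apply: (lp_norm_gt0 mp mw mI) => [| |h].
  - by apply: filterS hP => x /andP[/ltW].
  - exact: hw.2.
  - apply: notB; apply: filterS h => x /eqP; rewrite indicE pnatr_eq0 eqb0.
    by rewrite notin_setE.
have N20 : (0 < lp_norm (conj_exponent p) (cst 1%R) f2)%E.
  have m1 : measurable_fun setT (cst 1%R : Rn -> R) by exact: measurable_cst.
  apply: (lp_norm_gt0 mcp m1 mf2) => [| |h].
  - apply: filterS hP => x /andP[p1 _]; rewrite /conj_exponent ler_pdivlMr ?subr_gt0// mul1r.
    by rewrite lerBlDr lerDl.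
  - by apply: aeW => x; rewrite ltr01.
  - apply: notB; apply: filterS2 h hw.2 => x /eqP; rewrite /f2 mulf_eq0 powR_eq0.
    move=> /orP[/andP[/eqP -> _]|]; first by rewrite ltxx.
    by rewrite indicE pnatr_eq0 eqb0 notin_setE.
have N1fin : lp_norm p w \1_B \is a fin_num.
  by rewrite ge0_fin_numE ?(ltW N10)// (le_lt_trans lp1)// ltry.
rewrite -/f2 => hN.
have invB : (mu B)^-1%E = ((fine (mu B))^-1)%:E by rewrite -{1}(fineK Bfin) inver gt_eqF.
rewrite invB -(fineK N1fin) -EFinM in hN.
have n10 : 0 < fine (lp_norm p w \1_B) by rewrite -lte_fin fineK.
have c0 : 0 < (fine (mu B))^-1 * fine (lp_norm p w \1_B) by rewrite mulr_gt0 ?invr_gt0.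
have N2fin : lp_norm (conj_exponent p) (cst 1%R) f2 \is a fin_num.
  rewrite ge0_fin_numE ?(ltW N20)// ltNge leye_eq; apply/negP => /eqP E.
  by move: hN; rewrite E gt0_muley ?lte_fin// leye_eq.
have n20 : 0 < fine (lp_norm (conj_exponent p) (cst 1%R) f2) by rewrite -lte_fin fineK.
rewrite -(fineK N2fin) -EFinM lee_fin in hN.
set n1 := fine (lp_norm p w _) in n10 c0 hN; set n2 := fine (lp_norm _ _ f2) in n20 hN.
have lt1 : (lp_norm p w \1_B < (2 * n1)%:E)%E.
  by rewrite -[ltLHS](fineK N1fin) -/n1 lte_fin mulr_natl mulr2n ltrDl.
have lt2 : (lp_norm (conj_exponent p) (cst 1%R) f2 < (2 * n2)%:E)%E.
  by rewrite -[ltLHS](fineK N2fin) -/n2 lte_fin mulr_natl mulr2n ltrDl.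
have [_ [nu [nu0 hnu] <-] nu2] := ereal_inf_lt lt1.
have [_ [m [m0 hm] <-] m2] := ereal_inf_lt lt2.
rewrite lte_fin in nu2; rewrite lte_fin in m2.
exists nu, m; split => //.
- by rewrite N10; apply: ereal_inf_lbound; exists nu.
- apply: le_trans hnu; rewrite integral_mkcond le_eqVlt; apply/orP; left; apply/eqP.
  have mnu : measurable_fun setT (fun x => (nu `^ (- p x) * `|w x|)%:E).
    apply/measurable_EFinP; apply: (measurable_funM _ mnw).
    by apply: (measurable_powR_exp (measurable_cst nu)); exact: measurableT_comp.
  apply: (ae_eq_integral _ _ measurableT).
  + by apply: (measurable_restrictT _ mB).1; exact: measurable_funTS.
  + apply: emeasurable_funM; apply/measurable_EFinP; last exact: mw.
    exact: (measurable_powR_exp (measurable_funM mI' (measurable_cst nu^-1)) mp).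
  + apply: filterS2 hP hw.2 => x /andP[p1 _] wx _; rewrite patchE indicE.
    have p0 : p x != 0 by rewrite gt_eqF// (lt_trans ltr01).
    case: ifPn => _ /=; last by rewrite normr0 mul0r powR0// mul0e.
    by rewrite normr1 mul1r -EFinM (powR_invl _ (ltW nu0)) (gtr0_norm wx).
- apply: le_trans hm; rewrite integral_mkcond le_eqVlt; apply/orP; left; apply/eqP.
  apply: (ae_eq_integral _ _ measurableT).
  + apply: (measurable_restrictT _ mB).1; apply: measurable_funTS; apply/measurable_EFinP.
    apply: (measurable_powR_exp _ mcp).
    exact: (measurable_funM (measurable_powR_exp mw mpV) (measurable_cst m^-1)).
  + apply: emeasurable_funM; apply/measurable_EFinP; last exact: measurable_cst.
    exact: (measurable_powR_exp (measurable_funM mf2' (measurable_cst m^-1)) mcp).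
  + apply: filterS hP => x /andP[p1 _] _; rewrite patchE /f2 indicE mule1.
    have p0 : conj_exponent p x != 0.
      by rewrite mulf_neq0 ?invr_neq0// gt_eqF ?subr_gt0// (lt_trans ltr01).
    case: ifPn => _ /=; last by rewrite mulr0 normr0 mul0r powR0.
    by rewrite mulr1 ger0_norm ?powR_ge0.
- rewrite -(fineK Bfin) -EFinM lee_fin.
  apply: (@le_trans _ _ ((2 * n1) * (2 * n2))).
    by apply: ler_pM; apply: ltW.
  have h : n1 * n2 <= A0 * fine (mu B).
    by move: hN; rewrite -mulrA ler_pdivrMl// (mulrC _ A0).
  have -> : 2 * n1 * (2 * n2) = 4 * (n1 * n2) by ring.
  rewrite -mulrA ler_pM2l//; apply: le_trans h _.
  by rewrite ler_wpM2r ?(ltW B0')// lerDl.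
Qed.

Let mnw : measurable_fun setT (fun x => `|w x|).
Proof. exact: measurableT_comp. Qed.
Let mnwE : measurable_fun setT (fun x => `|w x|%:E).
Proof. exact/measurable_EFinP. Qed.
Let nw0 x : (0 <= `|w x|%:E)%E.
Proof. by rewrite lee_fin. Qed.

Let lp_norm_ball_le1 (c : Rn) r :
  (\int[mu]_(x in eball c r) `|w x|%:E <= 1)%E -> (lp_norm p w \1_(eball c r) <= 1)%E.
Proof.
have [P P1 hP] := exponent_bounds (condH_log hH).1.
set B := eball c r => wB; have mB : measurable B := measurable_eball c r.
apply: ereal_inf_lbound; exists 1 => //; split=> //.
apply: le_trans wB; rewrite [leRHS]integral_mkcond le_eqVlt; apply/orP; left; apply/eqP.
have mI : measurable_fun setT (fun x : Rn => `|\1_B x| / 1 : R).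
  apply: measurable_funM; last exact: measurable_cst.
  by apply: measurableT_comp => //; exact: measurable_indic.
apply: (ae_eq_integral _ _ measurableT).
- apply: emeasurable_funM; apply/measurable_EFinP; last exact: mw.
  exact: (measurable_powR_exp mI mp).
- by apply: (measurable_restrictT _ mB).1; exact: measurable_funTS.
- apply: filterS2 hP hw.2 => x /andP[p1 _] wx _; rewrite patchE indicE divr1.
  have p0 : p x != 0 by rewrite gt_eqF// (lt_trans ltr01).
  case: ifPn => _ /=; last by rewrite normr0 powR0// mul0e.
  by rewrite normr1 powR1 mul1e (gtr0_norm wx).
Qed.

(** Young's inequality and the Muckenhoupt condition bound the mean of [psi] over
    the ball by a multiple of [lam / nu]. The Jensen inequality at this level, or at
    level 1 if that is larger, bounds [phi x (a x)] by the [p x]-th power of the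
    level. The integral of the weight over [T] pays for the level 1. *)
Lemma ball_estimate : exists kappa K : R, [/\ 0 < kappa, 0 <= K &
  forall (c : Rn) (r : R), 0 < r -> r <= 1 ->
  (\int[mu]_(x in eball c r) `|w x|%:E <= 1)%E -> (mu (eball c r) <= 1)%E ->
  forall g : Rn -> R, measurable_fun setT g ->
  (\int[mu]_(x in eball c r) phiw phi w g x <= 1)%E ->
  forall (T : set Rn) (a : Rn -> R), measurable T -> T `<=` eball c r ->
  measurable_fun setT a ->
  (forall x, T x -> (`|a x|%:E * mu (eball c r) <=
     kappa%:E * \int[mu]_(y in eball c r) `|g y|%:E)%E) ->
  (\int[mu]_(x in T) phiw phi w a x <= \int[mu]_(x in T) `|w x|%:E +
    K%:E * (\int[mu]_(x in eball c r) phiw phi w g x + mu (eball c r)))%E].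
Proof.
have [K K1 hK] := log_hoelder_power.
have [A A0 hAm] := muckenhoupt_modular.
have [L1 L10 hJ] := jensen_ball.
have [P P1 hP] := exponent_bounds (condH_log hH).1.
have K0 : 0 < K by apply: lt_le_trans K1.
pose M := (K + 1) * A.
have M0 : 0 <= M by rewrite mulr_ge0 ?addr_ge0 ?ltW.
have LM0 : 0 < L1 * (1 + M) by rewrite mulr_gt0// ltr_wpDr.
exists (L1 * (1 + M))^-1, K; split; [by rewrite invr_gt0|exact: ltW|].
move=> c r r0 r1 wB B1 g mg gB T a mT TB ma aT.
have lp1 := lp_norm_ball_le1 wB.
have [nu [m [[nu0 m0] /andP[lp0 lpnu] hnu hm num]]] := hAm c r r0 lp1.
set B := eball c r in wB B1 gB TB aT lp1 lp0 lpnu hnu hm num *.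
have mB : measurable B := measurable_eball c r.
have Bfin : mu B \is a fin_num := leb_eball_fin c r.
have bge : (r / n%:R) ^+ n <= fine (mu B).
  by rewrite -lee_fin fineK//; exact: leb_eball_ge.
set b := fine (mu B) in bge.
have bE : mu B = b%:E by rewrite fineK.
have b0 : 0 < b by apply: lt_le_trans bge; rewrite exprn_gt0// divr_gt0// ltr0n.
have b1 : b <= 1 by rewrite -lee_fin -bE.
have gw0 x : (0 <= phiw phi w g x)%E by exact: (phiw_ge0 w dP).
have mgw : measurable_fun setT (phiw phi w g) by exact: (measurable_phiw dP hw mg).
have rho0 : (0 <= \int[mu]_(x in B) phiw phi w g x)%E by exact: integral_ge0.
have rhofin : (\int[mu]_(x in B) phiw phi w g x)%E \is a fin_num.
  by rewrite ge0_fin_numE// (le_lt_trans gB)// ltry.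
set rho := fine (\int[mu]_(x in B) phiw phi w g x)%E.
have rhoE : (\int[mu]_(x in B) phiw phi w g x)%E = rho%:E by rewrite fineK.
have rho_ge0 : 0 <= rho by rewrite fine_ge0.
have rho1 : rho <= 1 by rewrite -lee_fin -rhoE.
(* [t] lies between the volume of the ball and 1, so that the powers of [lam] with
   exponents [p x] are all comparable with [t]. *)
pose t := Num.max rho b.
have bt : b <= t by rewrite le_max lexx orbT.
have t0 : 0 < t by apply: lt_le_trans bt.
have t1 : t <= 1 by rewrite ge_max rho1 b1.
pose p0 := Num.max (p c) 1.
have p01 : 1 <= p0 by rewrite le_max lexx orbT.
have p0p : 0 < p0 by apply: lt_le_trans p01.
pose lam := t `^ p0^-1.
have lam0 : 0 < lam by rewrite powR_gt0.
have lam1 : lam <= 1.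
  by rewrite -(powRr0 t); apply: ger_powR; rewrite ?t0// invr_ge0 ltW.
have lamp x : B x -> 1 <= p x -> K^-1 * t <= lam `^ p x <= K * t.
  move=> Bx px; rewrite -powRrM (mulrC p0^-1).
  exact: (hK c x r t r0 r1 Bx px (le_trans bge bt) t1).
(* The mean of [psi] will be at most a multiple of [lam / nu]; since [lam <= 1],
   this level is in the range of (A1). *)
pose s := Num.max 1 (lam / nu).
have s1 : 1 <= s by rewrite le_max lexx.
have s0 : 0 < s by apply: lt_le_trans s1.
have lpfin : lp_norm p w \1_B \is a fin_num.
  by rewrite ge0_fin_numE ?(ltW lp0)// (le_lt_trans lp1)// ltry.
have slp : (s%:E <= (lp_norm p w \1_B)^-1)%E.
  rewrite -(fineK lpfin) inver gt_eqF; last by rewrite -lte_fin fineK.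
  have n10 : 0 < fine (lp_norm p w \1_B) by rewrite -lte_fin fineK.
  have n11 : fine (lp_norm p w \1_B) <= 1 by rewrite -lee_fin fineK.
  have n1nu : fine (lp_norm p w \1_B) <= nu by rewrite -lee_fin fineK.
  rewrite lee_fin ge_max invf_ge1// n11 /=.
  apply: (@le_trans _ _ nu^-1); last by rewrite lef_pV2.
  by rewrite ler_piMl// invr_ge0 ltW.
have mcj : measurable_fun setT (fun y => ((w y `^ (- (p y)^-1) / m) `^ (p y / (p y - 1)))%:E).
  apply/measurable_EFinP; apply: measurable_powR_exp.
    apply: measurable_funM; last exact: measurable_cst.
    apply: (measurable_powR_exp mw); apply: measurable_funN.
    exact: (measurable_fun_inv mp).
  apply: (measurable_funM mp); apply: measurable_fun_inv.
  by apply: measurable_funB; [exact: mp|exact: measurable_cst].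
have cj0 y : (0 <= ((w y `^ (- (p y)^-1) / m) `^ (p y / (p y - 1)))%:E)%E.
  by rewrite lee_fin powR_ge0.
have lm0 : 0 <= lam * m by rewrite mulr_ge0 ?ltW.
have Kt0 : 0 <= K / t by rewrite divr_ge0 ?ltW.
have psiB : (\int[mu]_(y in B) psi phi p y `|g y|%R <= (M * s)%:E * mu B)%E.
  have s0y y : (0 <= (K / t)%:E * phiw phi w g y +
      ((w y `^ (- (p y)^-1) / m) `^ (p y / (p y - 1)))%:E)%E.
    by rewrite adde_ge0// mule_ge0// lee_fin.
  have msy : measurable_fun setT (fun y => (K / t)%:E * phiw phi w g y +
      ((w y `^ (- (p y)^-1) / m) `^ (p y / (p y - 1)))%:E)%E.
    by apply: emeasurable_funD; [exact: measurable_funeM|exact: mcj].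
  apply: (@le_trans _ _ (\int[mu]_(y in B) ((lam * m)%:E * ((K / t)%:E * phiw phi w g y +
      ((w y `^ (- (p y)^-1) / m) `^ (p y / (p y - 1)))%:E)))%E).
    apply: (ae_ge0_le_integral mB).
    - by move=> y _; exact: poweR_ge0.
    - by apply: measurable_funTS; exact: (weak_Phi_meas (condH_psi hH) mg).
    - by move=> y _; rewrite mule_ge0 ?lee_fin.
    - by apply: measurable_funeM; exact: measurable_funTS.
    - apply: filterS2 hP hw.2 => y /andP[py _] wy By.
      have ph0 : (0 <= phi y `|g y|)%E by exact: (weak_Phi_ge0 hphi).
      apply: le_trans (young_psi ph0 py wy lam0 m0) _.
      rewrite lee_wpmul2l ?lee_fin// leeD2r// /phiw (gtr0_norm wy).
      rewrite muleCA lee_wpmul2l// lee_fin ler_wpM2r ?(ltW wy)//.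
      have /andP[h _] := lamp y By (ltW py).
      rewrite powRN -[leRHS]invrK lef_pV2 ?posrE ?powR_gt0 ?invr_gt0 ?divr_gt0//.
      by rewrite invf_div mulrC.
  rewrite (ge0_integralZl_EFin mu mB (fun y _ => s0y y) (measurable_funTS msy) lm0).
  have gwK0 y : (0 <= (K / t)%:E * phiw phi w g y)%E by rewrite mule_ge0// lee_fin.
  have mgwK : measurable_fun B (fun y => (K / t)%:E * phiw phi w g y)%E.
    by apply: measurable_funeM; exact: measurable_funTS.
  rewrite (ge0_integralD mu mB (fun y _ => gwK0 y) mgwK (fun y _ => cj0 y) (measurable_funTS mcj)).
  rewrite (ge0_integralZl_EFin mu mB (fun y _ => gw0 y) (measurable_funTS mgw) Kt0) rhoE.
  apply: (@le_trans _ _ ((lam * m)%:E * (K + 1)%:E)%E).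
    rewrite lee_wpmul2l ?lee_fin// EFinD leeD// -EFinM lee_fin.
    by rewrite mulrAC ler_pdivrMr// ler_wpM2l ?(ltW K0)// le_max lexx.
  rewrite bE -!EFinM lee_fin /M; rewrite bE -EFinM lee_fin in num.
  have -> : lam * m * (K + 1) = (K + 1) * (lam / nu * (nu * m)) by field; rewrite gt_eqF.
  have -> : (K + 1) * A * s * b = (K + 1) * (s * (A * b)) by ring.
  apply: ler_wpM2l; first by rewrite addr_ge0// ltW.
  apply: ler_pM => //; [by rewrite divr_ge0 ?ltW|by rewrite mulr_ge0 ?ltW|].
  by rewrite le_max lexx orbT.
have J := hJ c r s M g r0 lp1 s1 slp mg M0 psiB.
have mnu : measurable_fun setT (fun x => (nu `^ (- p x) * `|w x|)%:E).
  apply/measurable_EFinP; apply: (measurable_funM _ mnw).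
  by apply: (measurable_powR_exp (measurable_cst nu)); exact: measurable_funN.
have nup0 x : (0 <= (nu `^ (- p x) * `|w x|)%:E)%E by rewrite lee_fin mulr_ge0 ?powR_ge0.
have Kt : 0 <= K * t by rewrite mulr_ge0 ?ltW.
have mKnu : measurable_fun T (fun x => (K * t)%:E * (nu `^ (- p x) * `|w x|)%:E)%E.
  by apply: measurable_funeM; exact: measurable_funTS.
have Knu0 x : (0 <= (K * t)%:E * (nu `^ (- p x) * `|w x|)%:E)%E.
  by rewrite mule_ge0// lee_fin.
have maw : measurable_fun setT (phiw phi w a) by exact: (measurable_phiw dP hw ma).
apply: (@le_trans _ _ (\int[mu]_(x in T) (`|w x|%:E + (K * t)%:E * (nu `^ (- p x) * `|w x|)%:E))%E).
  apply: (ae_ge0_le_integral mT).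
  - by move=> x _; exact: (phiw_ge0 w dP).
  - exact: measurable_funTS.
  - by move=> x _; rewrite adde_ge0.
  - exact: emeasurable_funD (measurable_funTS mnwE) mKnu.
  - apply: filterS2 hP J => x /andP[px _] Jx Tx.
    have Bx := TB x Tx.
    have phs : (phi x `|a x| <= (s `^ p x)%:E)%E.
      apply: (Jx Bx) => //; rewrite EFinM -muleA.
      have := lee_wpmul2l (_ : 0 <= (L1 * (1 + M))%:E)%E (aT x Tx).
      rewrite lee_fin (ltW LM0) => /(_ isT) /le_trans; apply.
      by rewrite muleA -EFinM divff ?mul1e// gt_eqF.
    have sp : s `^ p x <= 1 + K * t * nu `^ (- p x).
      rewrite /s /Num.max; case: ifPn => _; last first.
        by rewrite powR1 lerDl mulr_ge0// powR_ge0.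
      have /andP[_ h] := lamp x Bx (ltW px).
      rewrite powRM ?invr_ge0 ?(ltW lam0) ?(ltW nu0)// (powR_invl _ (ltW nu0)).
      by apply: ler_wpDl => //; rewrite ler_wpM2r ?powR_ge0.
    rewrite /phiw; apply: le_trans (lee_wpmul2r (nw0 x) phs) _.
    rewrite -!EFinM -EFinD lee_fin.
    have -> : `|w x| + K * t * (nu `^ (- p x) * `|w x|) =
        (1 + K * t * nu `^ (- p x)) * `|w x| by ring.
    by rewrite ler_wpM2r.
rewrite (ge0_integralD mu mT (fun x _ => nw0 x) (measurable_funTS mnwE) (fun x _ => Knu0 x) mKnu).
rewrite leeD2l//.
rewrite (ge0_integralZl_EFin mu mT (fun x _ => nup0 x) (measurable_funTS mnu) Kt).
apply: (@le_trans _ _ ((K * t)%:E * 1)%E).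
  rewrite lee_wpmul2l ?lee_fin//; apply: le_trans hnu.
  apply: (ge0_subset_integral mu mT mB _ _ TB); [exact: measurable_funTS|move=> x _; exact: nup0].
rewrite mule1 EFinM lee_wpmul2l ?lee_fin ?(ltW K0)// rhoE bE -EFinD lee_fin.
by rewrite /t /Num.max; case: ifP => _; rewrite ?lerDl ?lerDr// ltW.
Qed.

(** * Mollification on bounded regions *)

(** At a point of a tile the mollification is at most a multiple of the average
    over the ball of the tile, so the estimate on balls applies to every tile; the
    bounded overlap of the balls lets the estimates add up. *)
Lemma local_mollifier_bound (N : nat) : exists c C : R, [/\ 0 < c, 0 <= C &
  exists m0 : nat, forall m : nat, (m0 < m)%N ->
  forall g, loc_integrable g -> (modular phi w g <= 1)%E ->
  (modular phi w (fun x => c * (\1_(region N) x * convol g (mollifier m%:R) x))%R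
   <= C%:E)%E].
Proof.
have [kappa [K [k0 K0 hB]]] := ball_estimate.
have n1 : (1 : R) <= n%:R by rewrite ler1n.
have [d d0 hd] := loc_integrable_small (N%:R + 1) hw.1 ltr01.
pose W := (\int[mu]_(x in cube 0 (N%:R + 1)) `|w x|%:E)%E.
have mC : measurable (cube (0 : Rn) (N%:R + 1)) by exact: measurable_cube.
have W0 : (0 <= W)%E by apply: integral_ge0 => x _; rewrite lee_fin.
have Wfin : W \is a fin_num.
  apply: (integrable_fin_num mC).
  exact: (integrable_abse (loc_integrable_cube 0 (N%:R + 1) hw.1)).
pose M : R := (((2 * (3 * n)).+1 ^ n)%N)%:R.
have M0 : 0 <= M by exact: ler0n.
pose E : R := (12 * n%:R * expR 4) ^+ n.
have E0 : 0 < E by rewrite exprn_gt0// !mulr_gt0 ?expR_gt0// ltr0n.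
have [c c0 cE] : exists2 c : R, 0 < c & c * E = kappa.
  by exists (kappa / E); rewrite ?divr_gt0// divfK// gt_eqF.
exists c, (M * fine W + K * (M + (24 * N%:R * n%:R) ^+ n)).
split => //.
  have W00 := fine_ge0 W0.
  rewrite addr_ge0// mulr_ge0// addr_ge0// exprn_ge0// !mulr_ge0//.
pose d1 := Num.min d 1.
have d10 : 0 < d1 by rewrite lt_min d0 ltr01.
exists (Num.truncn (12 * n%:R / d1)) => m mm g lg g1.
have mR : 12 * n%:R / d1 < m%:R.
  have := truncnS_gt (12 * n%:R / d1); move/lt_le_trans; apply.
  by rewrite ler_nat.
have m0 : (0 : R) < m%:R by apply: le_lt_trans mR; rewrite divr_ge0 ?mulr_ge0 ?(ltW d10).
have m_gt0 : (0 < m)%N by rewrite -(ltr0n R).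
have md : 12 * n%:R / m%:R < d1.
  by rewrite ltr_pdivrMr// [ltRHS]mulrC -ltr_pdivrMr.
have d11 : d1 <= 1 by rewrite ge_min lexx orbT.
have t1 : 12 * n%:R / m%:R <= 1 :> R by exact: le_trans (ltW md) d11.
have t0 : 0 <= 12 * n%:R / m%:R :> R by rewrite divr_ge0 ?mulr_ge0// ltW.
have tn : (12 * n%:R / m%:R) ^+ n <= 12 * n%:R / m%:R :> R.
  by rewrite -[leRHS]expr1 ler_wiXn2l.
have nm : 3 * n%:R <= m%:R :> R.
  move: t1; rewrite ler_pdivrMr// mul1r; apply: le_trans.
  by rewrite ler_wpM2r// ler_nat.
have r0 : 0 < tile_radius R n m by rewrite /tile_radius divr_gt0// mulr_gt0// ltr0n.
have r1 : tile_radius R n m <= 1 by rewrite /tile_radius ler_pdivrMr// mul1r.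
have mB z : measurable (@tile_ball R n N m z) by exact: measurable_eball.
have mT z : measurable (@tile R n N m z) by exact: measurable_box.
have muB z : (mu (@tile_ball R n N m z) <= ((12 * n%:R / m%:R) ^+ n)%:E)%E.
  apply: le_trans (leb_eball_le _ r0) _; rewrite /tile_radius lee_fin.
  by rewrite (_ : 4 * _ = 12 * n%:R / m%:R)//; ring.
have BC z : @tile_ball R n N m z `<=` cube 0 (N%:R + 1) by exact: tile_ball_sub.
have wB z : (\int[mu]_(x in @tile_ball R n N m z) `|w x|%:E <= 1)%E.
  apply: hd => //; apply: le_lt_trans (muB z) _.
  rewrite lte_fin (le_lt_trans tn)// (lt_le_trans md)//.
  by rewrite ge_min lexx.
have mB1 z : (mu (@tile_ball R n N m z) <= 1)%E.
  by apply: le_trans (muB z) _; rewrite lee_fin (le_trans tn).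
have mg : measurable_fun setT g := lg.1.
have mgw : measurable_fun setT (phiw phi w g) by exact: (measurable_phiw dP hw mg).
have gw0 x : (0 <= phiw phi w g x)%E by exact: (phiw_ge0 w dP).
have gB z : (\int[mu]_(x in @tile_ball R n N m z) phiw phi w g x <= 1)%E.
  apply: le_trans g1.
  by apply: (ge0_subset_integral mu (mB z) measurableT mgw (fun x _ => gw0 x)).
pose a x := c * (\1_(region N) x * convol g (mollifier m%:R) x).
have mreg : measurable (@region R n N) by exact: measurable_box.
have mconv : measurable_fun setT (convol g (mollifier m%:R)).
  apply: continuous_measurable.
  exact: (convol_continuous lg (@test_mollifier R n _ m0)).
have ma : measurable_fun setT a.
  apply: measurable_funM; first exact: measurable_cst.
  by apply: measurable_funM => //; exact: measurable_indic.
have maw : measurable_fun setT (phiw phi w a) by exact: (measurable_phiw dP hw ma).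
have aw0 x : (0 <= phiw phi w a x)%E by exact: (phiw_ge0 w dP).
have aB z x : tile z x -> (`|a x|%:E * mu (@tile_ball R n N m z) <=
    kappa%:E * \int[mu]_(y in @tile_ball R n N m z) `|g y|%:E)%E.
  move=> xz.
  have I0 : (0 <= \int[mu]_(y in @tile_ball R n N m z) `|g y|%:E)%E.
    by apply: integral_ge0 => y _; rewrite lee_fin.
  have cx := convol_mollifier_le lg m0 (mB z) (@cube_sub_tile_ball R n n_gt0 N m m_gt0 z x xz).
  have ax : (`|a x|%:E <= (c * (expR 4 * m%:R) ^+ n)%:E *
      \int[mu]_(y in @tile_ball R n N m z) `|g y|%:E)%E.
    apply: (@le_trans _ _ (c%:E * `|convol g (mollifier m%:R) x|%:E)%E).
      rewrite -EFinM lee_fin /a normrM (gtr0_norm c0) ler_wpM2l ?(ltW c0)//.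
      by rewrite normrM ler_piMl// indicE normr_nat lern1 leq_b1.
    by rewrite (EFinM c) -muleA lee_wpmul2l// lee_fin ltW.
  apply: le_trans (lee_pmul _ _ ax (muB z)) _; rewrite ?lee_fin//.
  rewrite -muleA muleCA -EFinM [X in (_ * X%:E)%E](_ : _ = kappa).
    by rewrite muleC.
  have EE : E = (expR 4 * m%:R) ^+ n * (12 * n%:R / m%:R) ^+ n.
    by rewrite -exprMn /E; congr (_ ^+ n); field; rewrite gt_eqF.
  by rewrite -(mulrA c) -EE.
have tileB z : (\int[mu]_(x in tile z) phiw phi w a x <=
    \int[mu]_(x in @tile_ball R n N m z) `|(w \_ (cube 0 (N%:R + 1))) x|%:E +
    K%:E * (\int[mu]_(x in @tile_ball R n N m z) phiw phi w g x +
      ((12 * n%:R / m%:R) ^+ n)%:E))%E.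
  apply: le_trans (hB _ _ r0 r1 (wB z) (mB1 z) g mg (gB z) (tile z) a (mT z)
    (@tile_sub_ball R n n_gt0 N m m_gt0 z) ma (aB z)) _.
  apply: leeD; last by rewrite lee_wpmul2l ?lee_fin// leeD2l// muB.
  rewrite (_ : (\int[mu]_(x in @tile_ball R n N m z) _)%E =
      \int[mu]_(x in @tile_ball R n N m z) `|w x|%:E)%E; last first.
    by apply: eq_integral => x /set_mem/BC xC; rewrite patchE mem_set.
  apply: (ge0_subset_integral mu (mT z) (mB z)) => [|x _|].
  - by apply/measurable_EFinP/measurableT_comp => //; exact: (measurable_funTS hw.1.1).
  - by rewrite lee_fin.
  - exact: tile_sub_ball.
have mwC : measurable_fun setT (fun x => `|(w \_ (cube 0 (N%:R + 1))) x|%:E).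
  apply/measurable_EFinP/measurableT_comp => //.
  by apply: (measurable_restrictT _ mC).1; exact: (measurable_funTS hw.1.1).
have wC0 x : (0 <= `|(w \_ (cube 0 (N%:R + 1))) x|%:E)%E by rewrite lee_fin.
have WE : (\int[mu]_x `|(w \_ (cube 0 (N%:R + 1))) x|%:E = W)%E.
  rewrite /W [RHS]integral_mkcond; apply: eq_integral => x _.
  by rewrite !patchE; case: ifP => //; rewrite normr0.
(* Outside the region the function vanishes, and so does the integrand. *)
apply: (@le_trans _ _ (\int[mu]_(x in @region R n N) phiw phi w a x)%E).
  rewrite [leRHS]integral_mkcond; apply: (ae_ge0_le_integral measurableT (fun x _ => aw0 x) maw).
  - by move=> x _; rewrite patchE; case: ifP.
  - by apply: (measurable_restrictT _ mreg).1; exact: measurable_funTS.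
  - apply: filterS (dPhi_at0 dP) => x h0 _; rewrite patchE; case: ifPn => // xN.
    by rewrite /phiw /a indicE (negbTE xN) mul0r mulr0 normr0 h0 mul0e.
apply: le_trans (@region_tile_sum R n N m m_gt0 _ maw aw0) _.
apply: le_trans (lee_sum _ (fun z _ => tileB z)) _.
rewrite big_split /= EFinD leeD//.
  apply: le_trans (@tile_ball_sum R n N m m_gt0 _ mwC wC0) _.
  by rewrite WE EFinM fineK.
have K0E : (0 <= K%:E)%E by rewrite lee_fin.
rewrite -ge0_sume_distrr; last first.
  move=> z _; rewrite adde_ge0 ?lee_fin ?exprn_ge0//; exact: integral_ge0.
rewrite EFinM lee_wpmul2l// big_split /= EFinD leeD//.
  apply: le_trans (@tile_ball_sum R n N m m_gt0 _ mgw gw0) _.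
  by rewrite -[leRHS]mule1 lee_wpmul2l ?lee_fin.
rewrite sumEFin lee_fin sumr_const card_index -[leLHS]mulr_natl natrX -exprMn.
rewrite !natrM (_ : 2 * N%:R * m%:R * (12 * n%:R / m%:R) = 24 * N%:R * n%:R)//.
by field; rewrite gt_eqF.
Qed.

(** * Convergence of mollification in modular *)

Section MollifierConvergence.
Variable N : nat.

Let reg : Rn -> R := \1_(region N).

Let m_reg : measurable_fun setT reg.
Proof. by apply: measurable_indic; exact: measurable_box. Qed.

Let reg_le x : `|reg x| <= 1.
Proof. by rewrite /reg indicE normr_nat lern1 leq_b1. Qed.

Let m_convol u k : (0 < k)%N -> loc_integrable u ->
  measurable_fun setT (convol u (mollifier k%:R)).
Proof.
move=> k0 lu; apply: continuous_measurable.
have kR : (0 : R) < k%:R by rewrite ltr0n.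
exact: (convol_continuous lu (@test_mollifier R n _ kR)).
Qed.

(** Doubling turns the uniform bound for functions of modular at most one into
    continuity at the origin: small modulars stay small under mollification,
    uniformly in the scale. *)
Lemma mollifier_small (eta : R) : 0 < eta -> exists2 d : R, 0 < d &
  exists m0 : nat, forall m : nat, (m0 < m)%N -> forall g, loc_integrable g ->
  (modular phi w g <= d%:E)%E ->
  (modular phi w (fun x => (reg x * convol g (mollifier m%:R) x)%R) <= eta%:E)%E.
Proof.
move=> eta0.
have [c [C [c0 C0 [m0 hC]]]] := local_mollifier_bound N.
have [L L1 hL] := modular_shrink dP hw; have L0 : 0 <= L by apply: le_trans L1.
pose K := 1 + L * C / eta; pose T := 1 + K / c.
have K0 : 0 <= L * C / eta by rewrite divr_ge0 ?mulr_ge0 ?(ltW eta0).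
have K1 : 1 <= K by rewrite lerDl.
have T1 : 1 <= T by rewrite lerDl divr_ge0 ?(le_trans _ K1)// ltW.
have KT : K <= T * c by rewrite /T mulrDl divfK ?gt_eqF// mul1r lerDr ltW.
have KT0 : 0 < T * c by apply: lt_le_trans KT; exact: lt_le_trans K1.
have [D D1 hD] := modular_dilate dP hw T1; have D0 : 0 < D by apply: lt_le_trans D1.
exists D^-1; first by rewrite invr_gt0.
exists m0 => m mm g lg gd.
have m1 : (0 < m)%N by apply: leq_ltn_trans mm.
have mR : (0 : R) < m%:R by rewrite ltr0n.
have lTg : loc_integrable (fun x => T * g x) by exact: loc_integrableZ.
have Tg1 : (modular phi w (fun x => (T * g x)%R) <= 1)%E.
  apply: le_trans (hD g lg.1) _; apply: le_trans (lee_wpmul2l _ gd) _.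
    by rewrite lee_fin ltW.
  by rewrite -EFinM divff// gt_eqF.
have h := hC m mm _ lTg Tg1.
pose a x := c * (reg x * convol (fun x => T * g x) (mollifier m%:R) x).
have ma : measurable_fun setT a.
  apply: measurable_funM; first exact: measurable_cst.
  exact: (measurable_funM m_reg (m_convol m1 lTg)).
have -> : (fun x => reg x * convol g (mollifier m%:R) x) = (fun x => (T * c)^-1 * a x).
  apply/funext => x; rewrite /a (convolZ T x lg (@test_mollifier R n _ mR)).
  by field; move: KT0; rewrite -mulrC => /gt_eqF/negbT; rewrite mulf_eq0 negb_or andbC.
apply: le_trans (hL _ _ (le_trans K1 KT) ma) _.
apply: le_trans (lee_wpmul2l _ h) _; first by rewrite lee_fin divr_ge0// ltW.
rewrite -EFinM lee_fin mulrAC ler_pdivrMr// [leRHS]mulrC -ler_pdivrMr//.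
by apply: le_trans KT; rewrite /K lerDr.
Qed.

(** Convergence on a bounded region, which is all that functions multiplied by a
    cutoff need. *)
Definition mollif_cvg v : Prop := forall eta : R, 0 < eta ->
  exists m0 : nat, forall m : nat, (m0 < m)%N ->
  (modular phi w (fun x => (reg x * (convol v (mollifier m%:R) x - v x))%R) <= eta%:E)%E.

Let m_err v k : (0 < k)%N -> loc_integrable v ->
  measurable_fun setT (fun x => reg x * (convol v (mollifier k%:R) x - v x)).
Proof.
move=> k0 lv; apply: (measurable_funM m_reg).
by apply: measurable_funB; [exact: m_convol|exact: lv.1].
Qed.

Lemma mollif_cvgD u v : loc_integrable u -> loc_integrable v ->
  mollif_cvg u -> mollif_cvg v -> mollif_cvg (fun x => u x + v x).
Proof.
move=> lu lv hu hv eta eta0.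
have [D D1 hD] := modularD dP hw; have D0 : 0 < D by apply: lt_le_trans D1.
have e0 : 0 < eta / (2 * D) by rewrite divr_gt0// mulr_gt0.
have [k1 h1] := hu _ e0; have [k2 h2] := hv _ e0.
exists (maxn k1 k2) => k; rewrite gtn_max => /andP[kk1 kk2].
have k0 : (0 < k)%N by apply: leq_ltn_trans kk1.
have kR : (0 : R) < k%:R by rewrite ltr0n.
rewrite (_ : (fun x => _) = (fun x => reg x * (convol u (mollifier k%:R) x - u x) +
    reg x * (convol v (mollifier k%:R) x - v x))); last first.
  apply/funext => x; have tm := @test_mollifier R n _ kR.
  rewrite (_ : (fun x => u x + v x) = (fun x => u x - (-1) * v x)); last first.
    by apply/funext => y; rewrite mulN1r opprK.
  rewrite (convolB x lu (loc_integrableZ (-1) lv) tm) (convolZ (-1) x lv tm).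
  by ring.
apply: le_trans (hD _ _ (m_err k0 lu) (m_err k0 lv)) _.
apply: (@le_trans _ _ (D%:E * ((eta / (2 * D))%:E + (eta / (2 * D))%:E))%E).
  apply: lee_wpmul2l; first by rewrite lee_fin ltW.
  exact: (leeD (h1 k kk1) (h2 k kk2)).
rewrite -EFinD -EFinM lee_fin (_ : D * _ = eta)//.
by field; rewrite gt_eqF.
Qed.

Lemma mollif_cvgZ (c : R) v : loc_integrable v -> mollif_cvg v ->
  mollif_cvg (fun x => c * v x).
Proof.
move=> lv hv eta eta0.
have l1 : 1 <= 1 + `|c| by rewrite lerDl.
have [D D1 hD] := modular_dilate dP hw l1; have D0 : 0 < D by apply: lt_le_trans D1.
have e0 : 0 < eta / D by rewrite divr_gt0.
have [m0 h] := hv _ e0; exists m0 => m mm.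
have m1 : (0 < m)%N by apply: leq_ltn_trans mm.
have mR : (0 : R) < m%:R by rewrite ltr0n.
have me := m_err m1 lv.
apply: (@le_trans _ _ (modular phi w (fun x => ((1 + `|c|) *
    (reg x * (convol v (mollifier m%:R) x - v x)))%R))).
  apply: (modular_mono dP hw (m_err m1 (loc_integrableZ c lv))).
    exact: (measurable_funM (measurable_cst _) me).
  apply: aeW => x; rewrite (convolZ c x lv (@test_mollifier R n _ mR)) -mulrBr mulrCA.
  rewrite [leRHS]normrM [leLHS]normrM ler_wpM2r//.
  by rewrite [leRHS]ger0_norm ?addr_ge0// lerDr.
apply: le_trans (hD _ me) _; apply: le_trans (lee_wpmul2l _ (h m mm)) _.
  by rewrite lee_fin ltW.
by rewrite -EFinM mulrC divfK ?gt_eqF.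
Qed.

(** Limits in modular inherit convergence, by the uniform smallness. *)
Lemma mollif_cvg_closed v : loc_integrable v ->
  (forall d : R, 0 < d -> exists2 v', loc_integrable v' /\ mollif_cvg v' &
    (modular phi w (fun x => (v x - v' x)%R) <= d%:E)%E) ->
  mollif_cvg v.
Proof.
move=> lv hv eta eta0.
have [D D1 hD] := modularD dP hw; have D0 : 0 < D by apply: lt_le_trans D1.
have e0 : 0 < eta / (D * (2 * D + 1)) by rewrite divr_gt0// !mulr_gt0// addr_gt0// mulr_gt0.
set e := eta / _ in e0.
have [d d0 [k1 h1]] := mollifier_small e0.
have de0 : 0 < Num.min d e by rewrite lt_min d0.
have [v' [lv' cv'] vd] := hv _ de0.
have [k2 h2] := cv' _ e0.
exists (maxn k1 k2) => k; rewrite gtn_max => /andP[kk1 kk2].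
have k0 : (0 < k)%N by apply: leq_ltn_trans kk1.
have kR : (0 : R) < k%:R by rewrite ltr0n.
have lvv := loc_integrableB lv lv'.
rewrite (_ : (fun x => _) = (fun x => reg x * convol (fun y => v y - v' y) (mollifier k%:R) x +
   reg x * (convol v' (mollifier k%:R) x - v' x) + reg x * (v' x - v x))); last first.
  apply/funext => x; rewrite (convolB x lv lv' (@test_mollifier R n _ kR)).
  by ring.
have mA : measurable_fun setT (fun x => reg x * convol (fun y => v y - v' y) (mollifier k%:R) x).
  by apply: (measurable_funM m_reg); exact: m_convol.
have mB := m_err k0 lv'.
have mC : measurable_fun setT (fun x => reg x * (v' x - v x)).
  by apply: (measurable_funM m_reg); exact: (measurable_funB lv'.1 lv.1).
apply: le_trans (hD _ _ (measurable_funD mA mB) mC) _.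
have hAB : (modular phi w (fun x => (reg x * convol (fun y => v y - v' y) (mollifier k%:R) x +
   reg x * (convol v' (mollifier k%:R) x - v' x))%R) <= D%:E * (e%:E + e%:E))%E.
  apply: le_trans (hD _ _ mA mB) _; apply: lee_wpmul2l; first by rewrite lee_fin ltW.
  apply: leeD (h2 k kk2); apply: (h1 _ kk1 _ lvv); apply: le_trans vd _.
  by rewrite lee_fin ge_min lexx.
have hC : (modular phi w (fun x => (reg x * (v' x - v x))%R) <= e%:E)%E.
  apply: (@le_trans _ _ (Num.min d e)%:E); last by rewrite lee_fin ge_min lexx orbT.
  apply: le_trans vd; apply: (modular_mono dP hw mC (measurable_funB lv.1 lv'.1)).
  by apply: aeW => x; rewrite normrM distrC ler_piMl.
apply: le_trans (lee_wpmul2l _ (leeD hAB hC)) _; first by rewrite lee_fin ltW.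
rewrite -!EFinD -!EFinM lee_fin /e.
rewrite [leLHS](_ : _ = eta)//; field.
by apply/andP; split; rewrite gt_eqF// addr_gt0// mulr_gt0.
Qed.


Let m_region : measurable (@region R n N).
Proof. exact: measurable_box. Qed.

Let region_sub : @region R n N `<=` cube 0 N%:R.
Proof.
move=> x xN; apply: box_sub_cube => // i; have := xN i.
by rewrite /= !mxE sub0r add0r.
Qed.

(** Where the indicator is locally constant, mollification at a small scale does
    not change it. *)
Lemma mollif_cvg_box_union F m : mollif_cvg (\1_(@box_union R n F m)).
Proof.
set U := box_union F m; have mU : measurable U by exact: measurable_box_union.
have lU := @indic_loc_integrable R n U mU.
have kR k : (0 : R) < k.+1%:R by rewrite ltr0n.
pose f k x := reg x * (convol (\1_U) (mollifier k.+1%:R) x - \1_U x).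
have mf k : measurable_fun setT (f k).
  apply: (measurable_funM m_reg); apply: measurable_funB; last exact: lU.1.
  apply: continuous_measurable.
  exact: (convol_continuous lU (@test_mollifier R n _ (kR k))).
have mg : measurable_fun setT (fun x => 2 * reg x).
  exact: (measurable_funM (measurable_cst _) m_reg).
have goo : (modular phi w (fun x => (2 * reg x)%R) < +oo)%E.
  have [K K0 hK] := modular_indic dP hw (ler0n R 2).
  apply: le_lt_trans (hK _ _ m_region mg _) _.
    by move=> x; rewrite normrM !ger0_norm// /reg indicE.
  by rewrite lte_mul_pinfty ?lee_fin//; exact: weight_bounded_fin m_region region_sub.
have fg k : \forall x \ae mu, `|f k x| <= `|2 * reg x|.
  apply: aeW => x; rewrite /f mulrC !normrM ler_wpM2r//.
  rewrite (le_trans (ler_normB _ _))// (ger0_norm (ler0n R 2)) -[leRHS]/(1 + 1) lerD//.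
    exact: convol_indic_le1.
  by rewrite indicE normr_nat lern1 leq_b1.
have f0 : \forall x \ae mu, f k x @[k --> \oo] --> 0.
  apply: filterS (box_union_locally_constant F m) => x [r r0 xr].
  rewrite /f -(mulr0 (reg x)) -(subrr (\1_U x : R)).
  apply: (@cvgM _ _ \oo); first exact: cvg_cst.
  apply: (@cvgB _ _ _ \oo); last exact: cvg_cst.
  exact: convol_indic_cvg r0 xr.
move=> eta eta0.
have [m0 hm] := cvge0_le (modular_cvg0 dP hw mf mg goo f0 fg) eta0.
exists m0 => k; case: k => // k mk; exact: (hm k mk).
Qed.

Lemma mollif_cvg_indic (E : set Rn) (M : R) : measurable E -> E `<=` cube 0 M ->
  mollif_cvg (\1_E).
Proof.
move=> mE EM; apply: mollif_cvg_closed.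
  exact: indic_loc_integrable.
move=> d d0.
have [K K0 hK] := modular_indic dP hw (ler01 : 0 <= 1 :> R).
have e0 : 0 < d / (K + 1) by rewrite divr_gt0// ltr_wpDl.
have [F [m [_ hS]]] := approx_box_union_integral hw.1 mE EM e0.
set U := box_union F m in hS; have mU : measurable U := measurable_box_union F m.
exists (\1_U); first by split; [exact: indic_loc_integrable|exact: mollif_cvg_box_union].
have mS : measurable ((E `\` U) `|` (U `\` E)) by apply: measurableU; exact: measurableD.
have mEU : measurable_fun setT (fun x : Rn => \1_E x - \1_U x : R).
  by apply: measurable_funB; exact: measurable_indic.
apply: le_trans (hK _ _ mS mEU _) _.
  move=> x; rewrite mul1r !indicE in_setU !in_setD.
  by case: (x \in E); case: (x \in U); rewrite /= ?subr0 ?subrr ?sub0r ?normrN ?normr0 ?normr1.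
apply: (@le_trans _ _ (K%:E * (d / (K + 1))%:E)%E).
  by apply: lee_wpmul2l; [rewrite lee_fin|exact: hS].
rewrite -EFinM lee_fin mulrA ler_pdivrMr ?ltr_wpDl// mulrC ler_wpM2l ?(ltW d0)//.
by rewrite lerDl.
Qed.

Let mollif_cvg_sum (r : seq R) (A : R -> set Rn) (M : R) :
  (forall y, measurable (A y)) -> (forall y, A y `<=` cube 0 M) ->
  loc_integrable (fun x => \sum_(y <- r) y * \1_(A y) x : R) /\
  mollif_cvg (fun x => \sum_(y <- r) y * \1_(A y) x : R).
Proof.
move=> mA AM; elim: r => [|y r [lr cr]].
  rewrite (_ : (fun x => _) = (fun x => 0 * \1_(A 0) x)); last first.
    by apply/funext => x; rewrite big_nil mul0r.
  have lA := @indic_loc_integrable R n (A 0) (mA 0).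
  split; first exact: loc_integrableZ.
  exact: (mollif_cvgZ 0 lA (mollif_cvg_indic (mA 0) (AM 0))).
rewrite (_ : (fun x => _) = (fun x => y * \1_(A y) x + \sum_(y <- r) y * \1_(A y) x)); last first.
  by apply/funext => x; rewrite big_cons.
have lA := loc_integrableZ y (@indic_loc_integrable R n (A y) (mA y)).
split; first exact: loc_integrableD.
apply: (mollif_cvgD lA lr _ cr).
exact: (mollif_cvgZ y (indic_loc_integrable (mA y)) (mollif_cvg_indic (mA y) (AM y))).
Qed.

(** Simple functions, truncated to large cubes, approximate from below. *)
Lemma mollif_cvg_ge0 v : loc_integrable v -> (forall x, 0 <= v x) ->
  (modular phi w v < +oo)%E -> mollif_cvg v.
Proof.
move=> lv v0 voo; apply: (mollif_cvg_closed lv) => d d0.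
have mvE : measurable_fun setT (EFin \o v) by apply/measurable_EFinP; exact: lv.1.
pose f := nnsfun_approx measurableT mvE.
pose s k x := f k x * \1_(cube 0 k%:R) x.
have vE0 x : setT x -> (0 <= (EFin \o v) x)%E by rewrite lee_fin.
have fv k x : 0 <= f k x <= v x.
  rewrite fun_ge0 /= -lee_fin /f nnsfun_approxE; exact: (le_approx k vE0).
have ms k : measurable_fun setT (s k).
  apply: measurable_funM; first exact: measurable_funP.
  by apply: measurable_indic; exact: measurable_cube.
have sv k x : 0 <= s k x <= v x.
  have /andP[f0 fvx] := fv k x; rewrite /s indicE.
  by case: (x \in _); rewrite ?mulr1 ?mulr0 ?f0 ?lexx ?v0.
pose A k y := f k @^-1` [set y] `&` cube 0 k%:R.
have sE k : s k = (fun x => \sum_(y <- finmap.enum_fset (fset_set (range (f k)))) y * \1_(A k y) x).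
  apply/funext => x; rewrite /s fimfunE fsbig_finite//= mulr_suml.
  by apply: eq_bigr => y _; rewrite -mulrA !indicE in_setI; do 2 case: (x \in _); rewrite ?mulr1 ?mulr0.
have mA k y : measurable (A k y).
  apply: measurableI; last exact: measurable_cube.
  by rewrite -[X in measurable X]setTI; exact: measurable_funP.
have hs k : loc_integrable (s k) /\ mollif_cvg (s k).
  by rewrite sE; exact: (@mollif_cvg_sum _ (A k) k%:R (mA k) (fun y x h => h.2)).
have fcvg x : s k x @[k --> \oo] --> v x.
  have fx : f k x @[k --> \oo] --> v x.
    exact: (fine_cvg (cvg_nnsfun_approx measurableT mvE vE0 I)).
  rewrite -[v x]mulr1; apply: (@cvgM _ _ \oo) => //.
  apply: cvg_near_cst; near=> k; rewrite indicE mem_set//.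
  rewrite /cube /= subr0; near: k; exact: nbhs_infty_ger.
have m0 : modular phi w (fun x => v x - s k x) @[k --> \oo] --> 0%E.
  apply: (@modular_cvg0 _ _ _ _ dP hw (fun k x => v x - s k x) v _ lv.1 voo).
  - by move=> k; apply: measurable_funB => //; exact: lv.1.
  - apply: aeW => x; rewrite -(subrr (v x)).
    by apply: (@cvgB _ _ _ \oo); [exact: cvg_cst|exact: fcvg].
  - move=> k; apply: aeW => x; have /andP[s0 sv'] := sv k x.
    by rewrite !ger0_norm ?v0 ?subr_ge0// gerBl.
have [k hk] := cvge0_le m0 d0.
by exists (s k); [exact: hs|exact: hk].
Unshelve. all: by end_near. Qed.

(** The positive and the negative part, written through the absolute value. *)
Theorem mollif_cvg_modular v : loc_integrable v -> (modular phi w v < +oo)%E ->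
  mollif_cvg v.
Proof.
move=> lv voo.
have lnv : loc_integrable (fun x => `|v x|).
  split; first by apply: measurableT_comp => //; exact: lv.1.
  by move=> K cK; exact: (integrable_abse (lv.2 K cK)).
have part (c : R) : `|c| = 1 -> loc_integrable (fun x => 2^-1 * (`|v x| + c * v x)) /\
    mollif_cvg (fun x => 2^-1 * (`|v x| + c * v x)).
  move=> c1; have lc := loc_integrableZ 2^-1 (loc_integrableD lnv (loc_integrableZ c lv)).
  have cv x : `|c * v x| = `|v x| by rewrite normrM c1 mul1r.
  have h0 x : 0 <= 2^-1 * (`|v x| + c * v x).
    by rewrite mulr_ge0// -(cv x); have := ler_norm (- (c * v x)); rewrite normrN; lra.
  split => //; apply: mollif_cvg_ge0 => //.
  apply: le_lt_trans voo; apply: (modular_mono dP hw lc.1 lv.1).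
  apply: aeW => x; rewrite ger0_norm// mulrC ler_pdivrMr// mulr_natr mulr2n lerD2l.
  by rewrite -(cv x) ler_norm.
have [lp cp] := part 1 (normr1 _).
have [ln cn] : _ := part (-1) (normrN1 _).
rewrite (_ : v = (fun x => 2^-1 * (`|v x| + 1 * v x) + (-1) * (2^-1 * (`|v x| + (-1) * v x)))).
  apply: (mollif_cvgD lp (loc_integrableZ (-1) ln) cp).
  exact: (mollif_cvgZ (-1) ln cn).
by apply/funext => x; field.
Qed.

End MollifierConvergence.

(** * Density *)

Lemma Cc_infty_sobolev k : @Cc_infty R n `<=` sobolev k phi w.
Proof.
move=> f Cf; have [rho rho0 tf] := Cc_infty_test Cf.
have wf a := weak_derivative_smooth a tf.1.
split; first split; first exact: smooth_loc_integrable tf.1.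
  by move=> a _; exists (wderiv (rev (word a)) f); exact: wf.
move=> a _; have mD : measurable_fun setT (weakD a f).
  by case: (weak_derivative_weakD (wf a)) => _ [].
split => //; apply/(LphiP dP hw mD).
have tD := test_wderiv (rev (word a)) tf.
rewrite (modular_ae dP hw mD (test_measurable tD) (weakD_ae (wf a))).
have [M M0 hM] := test_bounded tD.
have [K K0 hK] := modular_indic dP hw M0.
apply: le_lt_trans (hK _ _ (measurable_cube 0 rho) (test_measurable tD) _) _.
  move=> x; rewrite indicE; have [xc|xc] := boolP (x \in _); first by rewrite mulr1.
  rewrite tD.2 ?normr0 ?mulr0// ltNge; apply: contra xc => xr.
  by rewrite inE /cube /= subr0.
have := weight_bounded_fin hw (measurable_cube 0 rho) (@subset_refl _ (cube (0 : Rn) rho)).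
by apply: lte_mul_pinfty; rewrite ?lee_fin.
Qed.

Section Approximants.
Variables (k : nat) (u : Rn -> R).
Hypothesis ku : sobolev k phi w u.

Let cnt (q : seq 'I_n) : 'I_n -> nat := fun i => count_mem i q.

Let v q := weakD (cnt q) u.

Let wd q : (size q <= k)%N -> weak_derivative (cnt q) u (v q).
Proof.
rewrite size_count => qk; have [v' vP] := ku.1.2 (cnt q) qk.
exact: weak_derivative_weakD vP.
Qed.

Let lv q : (size q <= k)%N -> loc_integrable (v q).
Proof. by move=> /wd[]. Qed.

Let voo q : (size q <= k)%N -> (modular phi w (v q) < +oo)%E.
Proof.
move=> qk; apply/(LphiP dP hw (lv qk).1).
by apply: (ku.2 (cnt q) _).2; rewrite /morder /cnt -size_count.
Qed.

(** What the cutoff destroys, as a term of the Leibniz rule; the Kronecker symbol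
    is the limit of the derivatives of the cutoff. *)
Let tail_term (pq : seq 'I_n * seq 'I_n) (r : nat) (x : Rn) : R :=
  ((pq.1 == [::])%:R - wderiv pq.1 (cutoff r) x) * v pq.2 x.

Let moll_term (r : nat) (pq : seq 'I_n * seq 'I_n) (m : nat) (x : Rn) : R :=
  wderiv pq.1 (cutoff r) x * (v pq.2 x - convol (v pq.2) (mollifier m.+1%:R) x).

Let m_cut q r : measurable_fun setT (wderiv q (cutoff r) : Rn -> R).
Proof. exact: (test_measurable (test_wderiv q (@test_cutoff R n r))). Qed.

Let m_tail pq r : (size pq.2 <= k)%N -> measurable_fun setT (tail_term pq r).
Proof.
move=> qk; apply: measurable_funM; last exact: (lv qk).1.
by apply: measurable_funB; [exact: measurable_cst|exact: m_cut].
Qed.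

Let m_moll r pq m : (size pq.2 <= k)%N -> measurable_fun setT (moll_term r pq m).
Proof.
move=> qk; apply: (measurable_funM (m_cut _ _)).
apply: (measurable_funB (lv qk).1); apply: continuous_measurable.
have mR : (0 : R) < m.+1%:R by rewrite ltr0n.
exact: (convol_continuous (lv qk) (@test_mollifier R n _ mR)).
Qed.

Let tail_small pq (eta : R) : (size pq.2 <= k)%N -> 0 < eta ->
  \forall r \near \oo, (modular phi w (tail_term pq r) <= eta%:E)%E.
Proof.
move=> qk eta0; have [C C0 hC] := @wderiv_cutoff_le R n pq.1.
have C1 : 1 <= 1 + C by rewrite lerDl.
have [D D1 hD] := modular_dilate dP hw C1.
have mg : measurable_fun setT (fun x => (1 + C) * v pq.2 x).
  exact: (measurable_funM (measurable_cst _) (lv qk).1).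
have goo : (modular phi w (fun x => ((1 + C) * v pq.2 x)%R) < +oo)%E.
  apply: le_lt_trans (hD _ (lv qk).1) _.
  by rewrite lte_mul_pinfty ?lee_fin ?(le_trans _ D1)//; exact: voo.
have t0 : \forall x \ae mu, tail_term pq r x @[r --> \oo] --> 0.
  apply: aeW => x; apply: cvg_near_cst.
  apply: filterS (wderiv_cutoff_near pq.1 x) => r; rewrite /tail_term => ->.
  by rewrite subrr mul0r.
have tg r : \forall x \ae mu, `|tail_term pq r x| <= `|(1 + C) * v pq.2 x|.
  apply: aeW => x; rewrite /tail_term !normrM ler_wpM2r//.
  rewrite (ger0_norm (le_trans ler01 C1)) (le_trans (ler_normB _ _))// lerD//.
  by rewrite normr_nat lern1 leq_b1.
have [m0 h] := cvge0_le (modular_cvg0 dP hw (fun r => m_tail r qk) mg goo t0 tg) eta0.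
by exists m0.
Qed.

Let moll_small r pq (eta : R) : (size pq.2 <= k)%N -> 0 < eta ->
  \forall m \near \oo, (modular phi w (moll_term r pq m) <= eta%:E)%E.
Proof.
move=> qk eta0; have [C C0 hC] := @wderiv_cutoff_le R n pq.1.
have C1 : 1 <= 1 + C by rewrite lerDl.
have [D D1 hD] := modular_dilate dP hw C1; have D0 : 0 < D by apply: lt_le_trans D1.
have e0 : 0 < eta / D by rewrite divr_gt0.
have [m0 h] := @mollif_cvg_modular r.+2 _ (lv qk) (voo qk) _ e0.
exists m0 => // m m0m.
have mR : (0 : R) < m.+1%:R by rewrite ltr0n.
pose err x := \1_(region r.+2) x * (convol (v pq.2) (mollifier m.+1%:R) x - v pq.2 x).
have me : measurable_fun setT err.
  apply: measurable_funM; first by apply: measurable_indic; exact: measurable_box.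
  apply: measurable_funB; last exact: (lv qk).1.
  apply: continuous_measurable.
  exact: (convol_continuous (lv qk) (@test_mollifier R n _ mR)).
apply: (@le_trans _ _ (modular phi w (fun x => ((1 + C) * err x)%R))).
  apply: (modular_mono dP hw (m_moll _ _ qk)).
    exact: (measurable_funM (measurable_cst _) me).
  apply: aeW => x; rewrite /moll_term /err indicE.
  have [xr|xr] := boolP (x \in region r.+2).
    rewrite mul1r !normrM distrC ler_wpM2r// (ger0_norm (le_trans ler01 C1)).
    by rewrite (le_trans (hC r x))// lerDr.
  rewrite (test_wderiv pq.1 (@test_cutoff R n r)).2 ?mul0r ?normr0//.
  rewrite ltNge; apply: contra xr => xr; rewrite inE => i; rewrite !mxE.
  have := le_trans (coord_le_norm x i) xr; rewrite ler_norml -[r.+2%:R]natr1 -natr1.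
  by move=> /andP[h1 h2]; apply/andP; split; lra.
apply: le_trans (hD _ me) _; apply: le_trans (lee_wpmul2l _ (h m.+1 _)) _ => //.
  by rewrite lee_fin ltW.
by rewrite -EFinM mulrC divfK ?gt_eqF.
Qed.

(** All terms of the Leibniz rule, with the one that [leibniz] leaves out. *)
Let Q (a : 'I_n -> nat) : seq (seq 'I_n * seq 'I_n) :=
  ([::], rev (word a)) :: leibniz (rev (word a)).

Let Q_size a pq : (morder a <= k)%N -> pq \in Q a -> (size pq.2 <= k)%N.
Proof.
move=> ak; have sk : (size (rev (word a)) <= k)%N by rewrite size_rev size_word.
by rewrite inE => /orP[/eqP -> //|/leibniz_size/leq_trans]; exact.
Qed.

Let approximant r m : Rn -> R :=
  fun x => cutoff r x * convol u (mollifier m.+1%:R) x.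

Let test_approximant r m : test_fun (r%:R + 1) (approximant r m).
Proof.
have mR : (0 : R) < m.+1%:R by rewrite ltr0n.
rewrite /approximant; under eq_fun do rewrite mulrC.
apply: test_mul (@test_cutoff R n r).
exact: smooth_convol ku.1.1 (@test_mollifier R n _ mR).
Qed.

(** The Leibniz rule splits the error of an approximant into the part lost by
    cutting off and the part lost by mollifying. *)
Let weakD_error a r m : (morder a <= k)%N -> \forall x \ae mu,
  weakD a (u \- approximant r m) x =
  \sum_(pq <- Q a) tail_term pq r x + \sum_(pq <- Q a) moll_term r pq m x.
Proof.
move=> ak; set s := rev (word a).
have sk : (size s <= k)%N by rewrite size_rev size_word.
have cs : cnt s = a by apply/funext => i; rewrite /cnt count_rev count_word.
have wu : weak_derivative a u (v s) by have := wd sk; rewrite cs.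
have tf := test_approximant r m.
have := weakD_ae (weak_derivativeB wu (weak_derivative_smooth a tf.1)).
apply: filterS => x ->; rewrite -/s.
have mR : (0 : R) < m.+1%:R by rewrite ltr0n.
rewrite /approximant (wderiv_mul s (@test_cutoff R n r).1); last first.
  exact: smooth_convol ku.1.1 (@test_mollifier R n _ mR).
have -> : v s x = \sum_(pq <- Q a) (pq.1 == [::])%:R * v pq.2 x.
  rewrite big_cons /= mul1r big1_seq ?addr0// => pq /andP[_ /leibniz_neq0/negbTE ->].
  by rewrite mul0r.
set e := mollifier _.
have -> : cutoff r x * wderiv s (convol u e) x +
    \sum_(pq <- leibniz s) wderiv pq.1 (cutoff r) x * wderiv pq.2 (convol u e) x =
    \sum_(pq <- Q a) wderiv pq.1 (cutoff r) x * convol (v pq.2) e x.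
  rewrite -(big_cons _ _ ([::], s) _ xpredT
    (fun pq => wderiv pq.1 (cutoff r) x * wderiv pq.2 (convol u e) x)).
  apply: eq_big_seq => pq pqQ; congr (_ * _).
  by rewrite (wderiv_convol_mollifier mR (wd (Q_size ak pqQ)))//.
rewrite -sumrB -big_split /=; apply: eq_bigr => pq _.
by rewrite /tail_term /moll_term -/e; ring.
Qed.

Lemma sobolev_approx (eps : R) : 0 < eps ->
  exists2 f, @Cc_infty R n f & (sobolev_norm k phi w (u \- f)%R < eps%:E)%E.
Proof.
move=> eps0; pose c := #|{ffun 'I_n -> 'I_k.+1}|.
have e0 : 0 < eps / c.+1%:R by rewrite divr_gt0.
have [d d0 hd] := lux_norm_lt dP hw e0.
have [D D1 hD] := modularD dP hw; have D0 : 0 < D by apply: lt_le_trans D1.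
have d10 : 0 < d / (2 * D) by rewrite divr_gt0// mulr_gt0.
pose nat_a (a : {ffun 'I_n -> 'I_k.+1}) i : nat := a i.
have : \forall r \near \oo, forall a, (morder (nat_a a) <= k)%N ->
    (modular phi w (fun x => (\sum_(pq <- Q (nat_a a)) tail_term pq r x)%R) <= (d / (2 * D))%:E)%E.
  apply: filter_forall => a; have [ak|ak] := boolP (morder (nat_a a) <= k)%N; last exact: nearW.
  have := modular_sum_near dP hw (fun pq r h => m_tail r (Q_size ak h))
    (fun pq h eta => tail_small (Q_size ak h)) d10.
  by apply: filterS => r hr _.
(* The radius of the cutoff is fixed before the scale of the mollifier, since
   mollification converges on bounded regions only. *)
move=> [r _ /(_ r (leqnn r)) hr].
have : \forall m \near \oo, forall a, (morder (nat_a a) <= k)%N ->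
    (modular phi w (fun x => (\sum_(pq <- Q (nat_a a)) moll_term r pq m x)%R) <= (d / (2 * D))%:E)%E.
  apply: filter_forall => a; have [ak|ak] := boolP (morder (nat_a a) <= k)%N; last exact: nearW.
  have := modular_sum_near dP hw (fun pq m h => m_moll r m (Q_size ak h))
    (fun pq h eta => moll_small r (Q_size ak h)) d10.
  by apply: filterS => m hm _.
move=> [m _ /(_ m (leqnn m)) hm].
have wu a : (morder (nat_a a) <= k)%N -> weak_derivative (nat_a a) u (weakD (nat_a a) u).
  by move=> ak; have [v' vP] := ku.1.2 _ ak; exact: weak_derivative_weakD vP.
exists (approximant r m); first exact: test_Cc_infty (test_approximant r m).
have small a : (morder (nat_a a) <= k)%N ->
    (lux_norm phi w (weakD (nat_a a) (u \- approximant r m)%R) <= (eps / c.+1%:R)%:E)%E.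
  move=> ak; apply: ltW; apply: hd.
    have := weak_derivative_weakD (weak_derivativeB (wu a ak)
      (weak_derivative_smooth (nat_a a) (test_approximant r m).1)).
    by move=> [_ []].
  have mS1 := measurable_sum_seq (fun pq h => m_tail r (Q_size ak h)).
  have mS2 := measurable_sum_seq (fun pq h => m_moll r m (Q_size ak h)).
  have mD : measurable_fun [set: Rn] (weakD (nat_a a) (u \- approximant r m)%R).
    have := weak_derivative_weakD (weak_derivativeB (wu a ak)
      (weak_derivative_smooth (nat_a a) (test_approximant r m).1)).
    by move=> [_ []].
  rewrite (modular_ae dP hw mD (measurable_funD mS1 mS2) (weakD_error r m ak)).
  apply: le_trans (hD _ _ mS1 mS2) _.
  apply: le_trans (lee_wpmul2l _ (leeD (hr a ak) (hm a ak))) _; first by rewrite lee_fin ltW.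
  rewrite -EFinD -EFinM lee_fin (_ : D * _ = d)//.
  by field; rewrite gt_eqF.
apply: (@le_lt_trans _ _ (\sum_(a : {ffun 'I_n -> 'I_k.+1}) (eps / c.+1%:R)%:E)%E).
  rewrite /sobolev_norm big_mkcond /=; apply: lee_sum => a _.
  by case: ifPn => [/small//|_]; rewrite lee_fin ltW.
rewrite sumEFin lte_fin sumr_const -[X in X < _]mulr_natr mulrAC ltr_pdivrMr//.
by rewrite ltr_pM2l// ltr_nat.
Qed.

End Approximants.

End Main.

Theorem theorem2p19 (R : realType) (n : nat) (n_gt0 : (0 < n)%N)
    (w : 'rV[R]_n -> R) (phi : 'rV[R]_n -> R -> \bar R) (p : 'rV[R]_n -> R) :
  is_weight w ->
  weak_Phi phi ->
  condH phi w p ->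
  muckenhoupt p w ->
  (exists2 q : R, 1 <= q & aDec q (psi phi p)) ->
  forall k : nat, dense_in_sobolev (@Cc_infty R n) k phi w.
Proof.
move=> hw hphi hH hA hq k; split; first exact: (Cc_infty_sobolev hw hphi hH hq).
move=> u ku eps; exact: (sobolev_approx n_gt0 hw hphi hH hA hq ku).
Qed.
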